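(* Let $\beta\in(0,1)$ and $q=\frac{1}{1-\beta}$. Then the map $f\mapsto(\widetilde M_{\beta}f)'$ is continuous from $W^{1,1}(\mathbb{R})$ to $L^{q}(\mathbb{R})$; that is, whenever $f\in W^{1,1}(\mathbb{R})$, $\{f_j\}_{j\in\mathbb{N}}\subset W^{1,1}(\mathbb{R})$ and $\|f_j-f\|_{W^{1,1}(\mathbb{R})}\to 0$ as $j\to\infty$, one has $\|(\widetilde M_{\beta}f_j)'-(\widetilde M_{\beta}f)'\|_{L^q(\mathbb{R})}\to 0$ as $j\to\infty$.
   Context: For $f\in L^1_{loc}(\mathbb{R})$ and $0\le\beta<1$, the non-centered fractional maximal function is $$\widetilde M_{\beta}f(x)=\sup_{B(z,r)\ni x}\frac{r^{\beta}}{|B(z,r)|}\int_{B(z,r)}|f(y)|\,dy=\sup_{B(z,r)\ni x}\frac{r^{\beta}}{2r}\int_{z-r}^{z+r}|f(y)|\,dy,$$ the supremum being over all closed balls (intervals) $B(z,r)=[z-r,z+r]$, $z\in\mathbb{R}$, $r>0$, that contain $x$. Here $(\widetilde M_\beta f)'$ denotes the weak derivative of $\widetilde M_\beta f$. It is known that for $\beta\in(0,1)$ and $f\in W^{1,1}(\mathbb{R})$ the function $\widetilde M_\beta f$ is absolutely continuous with derivative in $L^q(\mathbb{R})$, $q=1/(1-\beta)$, so the map is well defined. *)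

(* Defs.v *)
From HB Require Import structures.
From mathcomp Require Import all_boot all_order all_algebra.
From mathcomp Require Import all_classical all_reals all_analysis.
Set Implicit Arguments.
Unset Strict Implicit.
Unset Printing Implicit Defensive.
Import Order.TTheory GRing.Theory Num.Theory.
Import numFieldNormedType.Exports.
Local Open Scope classical_set_scope.
Local Open Scope ring_scope.

(* C_c^oo(R) *)
Definition test_function (R : realType) (phi : R -> R) : Prop :=
  (forall (n : nat) (x : R), derivable (derive1n n phi) x 1) /\
  compact (closure [set x | phi x != 0]).

Definition is_weak_derivative (R : realType) (u g : R -> R) : Prop :=
  [/\ locally_integrable setT u,
      locally_integrable setT g &
      forall phi : R -> R, test_function phi ->
        (\int[lebesgue_measure]_x (u x * derive1 phi x)%:E =
         - \int[lebesgue_measure]_x (g x * phi x)%:E)%E].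

(* A chosen representative of the weak derivative, which is unique up to a.e.
   equality; it is the junk value 0 if u has no weak derivative. *)
Definition weak_derivative (R : realType) (u : R -> R) : R -> R :=
  xget (cst 0) [set g | is_weak_derivative u g].

Definition weakly_differentiable (R : realType) (u : R -> R) : Prop :=
  exists g : R -> R, is_weak_derivative u g.

Definition W11 (R : realType) (f : R -> R) : Prop :=
  [/\ f \in Lfun lebesgue_measure 1%E,
      weakly_differentiable f &
      weak_derivative f \in Lfun lebesgue_measure 1%E].

Definition W11_norm (R : realType) (f : R -> R) : \bar R :=
  ('N[lebesgue_measure]_1[EFin \o f] +
   'N[lebesgue_measure]_1[EFin \o weak_derivative f])%E.

(* The supremum is taken in the extended reals, since it may be infinite for a
   general locally integrable f. *)
Definition frac_maximal (R : realType) (beta : R) (f : R -> R) (x : R) : \bar R :=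
  ereal_sup [set a : \bar R | exists z r : R,
    [/\ 0 < r, x \in `[z - r, z + r] &
        a = ((r `^ beta / (2 * r))%:E *
             \int[lebesgue_measure]_(y in `[(z - r)%R, (z + r)%R]) `|f y|%:E)%E]].

(* Real-valued version, meaningful where frac_maximal is finite. *)
Definition frac_maximal_fun (R : realType) (beta : R) (f : R -> R) : R -> R :=
  fun x => fine (frac_maximal beta f x).

(* Main.v *)
Require Import Defs.
From HB Require Import structures.
From mathcomp Require Import all_boot all_order all_algebra.
From mathcomp Require Import all_classical all_reals all_analysis.
From mathcomp Require Import measurable_realfun.
From mathcomp Require Import ring lra.
Set Implicit Arguments.
Unset Strict Implicit.
Unset Printing Implicit Defensive.
Import Order.TTheory GRing.Theory Num.Theory.
Import numFieldNormedType.Exports.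
Local Open Scope classical_set_scope.
Local Open Scope ring_scope.

(** Write [c = 2^-beta] and [w(L) = c L^(beta-1)].  In terms of the endpoints
    [a <= x <= b] of the ball, with [F] a primitive of [|f|], the maximal function is
    [M x = sup P(a,b)], [P(a,b) = w(b-a) (F b - F a)].  The derivative of [M] is
    bounded pointwise by an integral operator applied to [|f'|], whose kernel has
    uniformly bounded column integrals; this gives the norm bound, and a
    truncation of [|f'|] turns it into a domination that yields the convergence.

    Pointwise information.  Since [0 < beta < 1], very short and very long
    intervals have small [P], so the supremum is attained where [M x > 0]; sliding
    an optimal interval [(a,b)] shows that [M' x = w(b-a) (|f|(b) - |f|(a))]
    ([frac_max_deriv]).  If [a < x < b], then [M >= M x] on [(a,b)] and
    [M' x = 0].  So a nonzero derivative forces [x] to be an endpoint, say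
    [x = a].  Put [L = b - a] and let [lam] be the mean of [|f|] over [(a,b)].  The other
    endpoint is then free, which gives [|f|(b) = (1-beta) lam], while comparison
    of [(a,b)] with [(a, a + eta L)] shows that [|f|] reaches [(1-beta/2) lam] at
    distance at least [eta L] from [x].  Between the two, [|f|] crosses a band of
    height [(beta/2) lam] ([rising_edge], [slope_witness]): the slope
    [|M' x| <= w(L) lam] is paid for by variation of [f] on a set [[u,v]] at
    distance comparable to [L] from [x], where moreover [|f|] is comparable to [lam],
    and [M >= M x] between [x] and [[u,v]].

    The kernel.  Call [(x,t)] an edge if [c |t-x|^beta |f|(t)] is comparable to
    [M x] and [M >= M x] on the segment from [x] to [t].  With [q = 1/(1-beta)],
    [w(L)^q <= 1/L], and the above becomes
    [|M' x|^q <= C m^(q-1) T|f'|(x)], where [m] bounds [|f|] and [T] is the integral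
    operator with kernel [1_edge(x,t) / |t-x|] ([slope_pow_le]).  For fixed [t], two
    edges [(x,t)] and [(y,t)] on the same side of [t] with [y] closer satisfy
    [M x <= M y], hence [|x-t|] and [|y-t|] are comparable
    ([edge_set_comparable]); therefore the kernel has integral at most a constant in
    [x], and by Tonelli [T] is bounded on L^1 ([edge_transform_le]).  This gives
    [||M'||_q^q <= C m^(q-1) ||f'||_1] ([frac_maximal_energy]).

    Convergence.  Let [f_j -> f] in W^{1,1}.  If [f = 0], the bound just stated suffices,
    because [m_j -> 0].  Otherwise [M > 0] everywhere, and at each
    common point of differentiability [M_j' x -> M' x], because near-optimal intervals for
    [f] have nearly the slope [M' x] and the optimal intervals for [f_j] are near-optimal
    for [f] ([frac_max_stability]).  To pass to L^q, replace [|f'|] by a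
    bounded [h] of bounded support up to a small error in L^1.  If the variation
    behind [M_j' x] comes mostly from [h], then [|M_j' x|^q <= A/(1+x^2)] with [A]
    independent of [j]; otherwise [|M_j' x|^q <= C T_j | |f_j'| - h |(x)], whose
    integral is small uniformly in [j] ([slope_pow_le_truncated]).  Dominated
    convergence for the first part concludes ([almost_dominated_cvg]).

    Finally weak and pointwise derivatives have to be compared: a function in
    W^{1,1} has a continuous representative that is a primitive of its weak
    derivative ([W11_continuous_representative]), and a locally Lipschitz function, such
    as [M], is differentiable almost everywhere with its pointwise derivative as a weak
    derivative ([locally_lipschitz_weak_derivative]). *)


(** * The weight of an interval *)

(** For an interval of length [L = 2r], this is the factor [r^beta / (2r)] in front of
    the integral. *)
Definition frac_weight {R : realType} (beta L : R) : R :=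
  2 `^ (- beta) * L `^ (beta - 1).

Section frac_weight.
Context {R : realType}.
Variable beta : R.
Hypotheses (beta_gt0 : 0 < beta) (beta_lt1 : beta < 1).
Local Notation w := (frac_weight beta).

Lemma frac_weightE (r : R) : 0 < r -> r `^ beta / (2 * r) = w (2 * r).
Proof.
move=> r0; rewrite /frac_weight powRM ?ltW// mulrA -powRD; last first.
  by rewrite pnatr_eq0 implybT.
have -> : - beta + (beta - 1) = -1 by ring.
have rB : r `^ (beta - 1) = r `^ beta / r.
  by rewrite powRB ?powRr1 ?(ltW r0)// (gt_eqF r0) implybT.
rewrite powR_inv1// rB invfM.
by rewrite mulrCA.
Qed.

Lemma frac_weight_gt0 (L : R) : 0 < L -> 0 < w L.
Proof. by move=> L0; rewrite mulr_gt0// powR_gt0. Qed.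

Lemma frac_weight_ge0 (L : R) : 0 <= w L.
Proof. by rewrite mulr_ge0// powR_ge0. Qed.

Lemma frac_weightM (L : R) : 0 < L -> w L * L = 2 `^ (- beta) * L `^ beta.
Proof.
move=> L0; rewrite /frac_weight -mulrA; congr (_ * _).
by rewrite mulrC mulr_powRB1// ltW.
Qed.

Lemma frac_weight_scale (t L : R) : 0 < t -> 0 < L ->
  w (t * L) = t `^ (beta - 1) * w L.
Proof. by move=> t0 L0; rewrite /frac_weight powRM ?ltW//; ring. Qed.

Lemma frac_weight_le (L L' : R) : 0 < L -> L <= L' -> w L' <= w L.
Proof.
move=> L0 LL'; rewrite ler_wpM2l ?powR_ge0//.
have -> : beta - 1 = - (1 - beta) by ring.
rewrite !powRN lef_pV2 ?posrE ?powR_gt0 ?(lt_le_trans L0 LL')//.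
by apply: ge0_ler_powR; rewrite ?nnegrE ?subr_ge0// ?ltW// (lt_le_trans L0 LL').
Qed.

Lemma is_derive_frac_weight (L : R) : 0 < L ->
  is_derive L 1 w ((beta - 1) * w L / L).
Proof.
move=> L0; have := is_deriveZ (2 `^ (- beta)) (is_derive1_powR (beta - 1) L0).
rewrite -[_ \*: _]/w => h; apply: (is_derive_eq h).
have LB : L `^ (beta - 1 - 1) = L `^ (beta - 1) / L.
  by rewrite powRB ?powRr1 ?(ltW L0)// (gt_eqF L0) implybT.
rewrite /frac_weight LB.
by rewrite [LHS]/GRing.scale/=; ring.
Qed.

Lemma frac_weight_small (e : R) : 0 < e ->
  exists2 L0, 0 < L0 & forall L, L0 <= L -> w L <= e.
Proof.
move=> e0; exists ((e * 2 `^ beta) `^ (beta - 1)^-1).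
  by rewrite powR_gt0// mulr_gt0// powR_gt0.
move=> L LL; apply: (@le_trans _ _ (w ((e * 2 `^ beta) `^ (beta - 1)^-1))).
  apply: frac_weight_le LL.
  by rewrite powR_gt0// mulr_gt0// powR_gt0.
rewrite /frac_weight -powRrM mulVf ?subr_eq0 ?lt_eqF// powRr1; last first.
  by rewrite mulr_ge0 ?powR_ge0// ltW.
by rewrite powRN mulrCA mulVf ?mulr1// gt_eqF// powR_gt0.
Qed.

Lemma frac_weightM_small (e : R) : 0 < e ->
  exists2 L0, 0 < L0 & forall L, 0 < L -> L <= L0 -> w L * L <= e.
Proof.
move=> e0; exists (e `^ beta^-1); first exact: powR_gt0.
move=> L L0 LL; rewrite frac_weightM//.
have : L `^ beta <= e.
  rewrite -[leRHS](@powRr1 _ e (ltW e0)) -[X in e `^ X](mulVf (lt0r_neq0 beta_gt0)).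
  rewrite powRrM; apply: ge0_ler_powR; rewrite ?nnegrE ?powR_ge0 ?(ltW L0) ?(ltW beta_gt0)//.
move=> h; apply: le_trans h; rewrite ler_piMl ?powR_ge0//.
rewrite powRN invf_le1 ?powR_gt0//.
by rewrite -[leLHS](@powRr0 _ 2); apply: ler_powR; rewrite ?ler1n// ltW.
Qed.

(** The exponent [q = 1/(1-beta)] is the one that turns [L^(beta-1)] into [1/L]. *)
Lemma frac_weight_pow (L : R) : 0 < L -> w L `^ (1 / (1 - beta)) <= L^-1.
Proof.
move=> L0; rewrite /frac_weight powRM ?powR_ge0// -!powRrM.
have -> : (beta - 1) * (1 / (1 - beta)) = -1.
  by field; rewrite subr_eq0 gt_eqF.
rewrite [L `^ _]powR_inv1 ?(ltW L0)// ler_piMl// ?invr_ge0 ?(ltW L0)//.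
rewrite -[leRHS](@powRr0 _ 2); apply: ler_powR; rewrite ?ler1n//.
rewrite mulNr oppr_le0 mulr_ge0 ?(ltW beta_gt0)// divr_ge0// subr_ge0.
exact: ltW.
Qed.

End frac_weight.

(** * Derivatives, extrema and level bands *)

Section derivative_facts.
Context {R : realType}.
Implicit Types (h F f : R -> R) (x d : R).

Lemma is_derive_approx h x d : is_derive x 1 h d -> forall e, 0 < e ->
  exists2 r, 0 < r & forall y, `|y - x| < r ->
    `|h y - h x - d * (y - x)| <= e * `|y - x|.
Proof.
move=> [dh dE] e e0; move: dh => /cvg_ex[/= l hl].
have ld : l = d by rewrite -dE; apply/esym/cvg_lim.
move: hl; rewrite ld => /cvgrPdist_le /(_ e e0) [r /= r0 hr].
exists r => // y yx; have [->|yNx] := eqVneq y x.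
  by rewrite !subrr mulr0 subr0 !normr0 mulr0.
have yx0 : y - x != 0 by rewrite subr_eq0.
have := hr (y - x); rewrite /ball_/= sub0r normrN => /(_ yx yx0).
rewrite [_%:A]mulr1 subrK => hle.
have -> : h y - h x - d * (y - x) = - ((d - (y - x)^-1 * (h y - h x)) * (y - x)).
  by field.
by rewrite normrN normrM ler_wpM2r// normr_ge0.
Qed.

Lemma is_derive_continuous h x d : is_derive x 1 h d -> {for x, continuous h}.
Proof.
by move=> hd; apply: differentiable_continuous; apply/derivable1_diffP; case: hd.
Qed.

Lemma derive_ge0_right h x d b : is_derive x 1 h d -> x < b ->
  (forall y, x <= y -> y <= b -> h x <= h y) -> 0 <= d.
Proof.
move=> hd xb hmin; rewrite leNgt; apply/negP => d0.
have [|r r0 hr] := is_derive_approx hd (e:=- d / 2); first by lra.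
pose y := x + Num.min (r / 2) (b - x).
have y0 : 0 < y - x.
  by rewrite /y addrC addKr lt_min subr_gt0 xb andbT divr_gt0.
have yr : y - x <= r / 2 by rewrite /y addrC addKr ge_min lexx.
have yb : y <= b.
  have : y - x <= b - x by rewrite /y addrC addKr ge_min lexx orbT.
  lra.
have := hr y; rewrite gtr0_norm// => /(_ ltac:(lra)).
rewrite ler_norml => /andP[_ h2].
have := hmin y ltac:(lra) yb.
nra.
Qed.

Lemma derive_le0_left h x d a : is_derive x 1 h d -> a < x ->
  (forall y, a <= y -> y <= x -> h x <= h y) -> d <= 0.
Proof.
move=> hd ax hmin; rewrite leNgt; apply/negP => d0.
have [|r r0 hr] := is_derive_approx hd (e:=d / 2); first by lra.
pose t := Num.min (r / 2) (x - a).
have t0 : 0 < t by rewrite /t lt_min subr_gt0 ax andbT divr_gt0.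
have tr : t <= r / 2 by rewrite /t ge_min lexx.
have ta : t <= x - a by rewrite /t ge_min lexx orbT.
have := hr (x - t); have -> : x - t - x = - t by ring.
rewrite normrN gtr0_norm// => /(_ ltac:(lra)).
rewrite ler_norml => /andP[_ h2].
have := hmin (x - t) ltac:(lra) ltac:(lra).
nra.
Qed.

Lemma derive_at_min h x d a b : is_derive x 1 h d -> a < x -> x < b ->
  (forall y, a <= y -> y <= b -> h x <= h y) -> d = 0.
Proof.
move=> hd ax xb hmin; apply/eqP; rewrite eq_le; apply/andP; split.
  by apply: (derive_le0_left hd ax) => y ay yx; apply: hmin => //; lra.
by apply: (derive_ge0_right hd xb) => y ay yx; apply: hmin => //; lra.
Qed.

(** A smooth function touching another from below at an interior point has the same
    derivative there; all derivative formulas for the maximal function come from this. *)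
Lemma derive_touching h k x d d' a b : is_derive x 1 h d -> is_derive x 1 k d' ->
  a < x -> x < b -> (forall y, a <= y -> y <= b -> k y <= h y) -> k x = h x ->
  d = d'.
Proof.
move=> hd kd ax xb kh khx; apply/eqP; rewrite -subr_eq0; apply/eqP.
apply: (derive_at_min (is_deriveB hd kd) ax xb) => y ay yb.
by change (h x - k x <= h y - k y); rewrite khx subrr subr_ge0 kh.
Qed.

Lemma derive_MVT F f a b : (forall x, is_derive x 1 F (f x)) -> a < b ->
  exists2 c, a < c /\ c < b & F b - F a = f c * (b - a).
Proof.
move=> dF ab; have cF : {within `[a, b], continuous F}.
  by apply: continuous_in_subspaceT => x _; exact: is_derive_continuous (dF x).
have [c cab Fc] := MVT ab (fun x _ => dF x) cF.
by move: cab; rewrite in_itv/= => /andP[ac cb]; exists c.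
Qed.

Lemma is_derive_translate h x c d : is_derive (x + c) 1 h d ->
  is_derive x 1 (fun y => h (y + c)) d.
Proof.
move=> hd; have := @is_derive1_comp R h (shift c) x d 1 hd (is_derive_shift _ _ _).
by rewrite mulr1.
Qed.

Lemma is_derive_reflect h x d : is_derive (- x) 1 h d ->
  is_derive x 1 (fun y => h (- y)) (- d).
Proof.
move=> hd; have := @is_derive1_comp R h -%R x d (-1) hd (is_deriveNid _ _).
by rewrite mulrN1.
Qed.

(** Take for [u] the last point of [[p,q]] where [f >= B], then for [v] the first later
    point where [f <= A]. *)
Lemma band_crossing f p q A B : continuous f -> p <= q -> A < B ->
  B <= f p -> f q <= A ->
  exists u v, [/\ p <= u, u < v, v <= q & [/\ f u = B, f v = A &
    forall t, u <= t -> t <= v -> A <= f t <= B]].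
Proof.
move=> cf pq AB fp fq.
have closedB : closed [set t | B <= f t].
  by apply: (@preimage_closed _ _ f [set y | B <= y]) => [x _|]; [exact: cf|exact: closed_ge].
have closedA : closed [set t | f t <= A].
  by apply: (@preimage_closed _ _ f [set y | y <= A]) => [x _|]; [exact: cf|exact: closed_le].
have IVTf (a b y : R) : a <= b -> f b <= y -> y <= f a -> exists2 c, a <= c <= b & f c = y.
  move=> ab fby yfa; have [| |c] := @IVT R f a b y ab.
  - exact: continuous_subspaceT.
  - by rewrite ge_min le_max fby yfa orbT.
  by rewrite in_itv/= => cab <-; exists c.
have Kcompact (a b : R) (S : set R) : closed S -> compact (`[a, b]%classic `&` S).
  move=> cS; apply: (subclosed_compact _ (@segment_compact R a b)).
    by apply: closedI => //; exact: itv_closed.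
  by move=> z [].
have [| |u uK umax] := @compact_EVT_max _ _ id _ _ (Kcompact p q _ closedB).
- by exists p; split => //=; rewrite in_itv/= lexx.
- by apply: continuous_subspaceT => x; exact: cvg_id.
move: uK; rewrite inE/= in_itv/= => -[/andP[pu uq] fu].
have fuB : f u = B.
  have [c /andP[uc cq] fc] := IVTf u q B uq (le_trans fq (ltW AB)) fu.
  have : c <= u.
    by apply: umax; rewrite inE/= in_itv/= cq fc lexx (le_trans pu uc).
  by move=> cu; rewrite -fc; congr f; apply/eqP; rewrite eq_le uc cu.
have [| |v vK vmin] := @compact_EVT_min _ _ id _ _ (Kcompact u q _ closedA).
- by exists q; split => //=; rewrite in_itv/= lexx uq.
- by apply: continuous_subspaceT => x; exact: cvg_id.
move: vK; rewrite inE/= in_itv/= => -[/andP[uv vq] fv].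
have fvA : f v = A.
  have [c /andP[uc cv] fc] := IVTf u v A uv fv ltac:(by rewrite fuB ltW).
  have : v <= c.
    by apply: vmin; rewrite inE/= in_itv/= uc fc lexx (le_trans cv vq).
  by move=> vc; rewrite -fc; congr f; apply/eqP; rewrite eq_le vc cv.
exists u, v; split => //.
  rewrite lt_neqAle uv andbT; apply/eqP => uvE.
  by move: AB; rewrite -fuB -fvA uvE ltxx.
split => // t ut tv; apply/andP; split; rewrite leNgt; apply/negP => ft.
- have tv' : v <= t.
    by apply: vmin; rewrite inE/= in_itv/= ut (le_trans tv vq) ltW.
  by move: ft; rewrite (_ : t = v) ?fvA ?ltxx//; apply/eqP; rewrite eq_le tv.
- have tu : t <= u.
    by apply: umax; rewrite inE/= in_itv/= (le_trans pu ut) (le_trans tv vq) ltW.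
  by move: ft; rewrite (_ : t = u) ?fuB ?ltxx//; apply/eqP; rewrite eq_le tu.
Qed.

End derivative_facts.

(** * Optimal intervals *)

Definition frac_avg {R : realType} (beta : R) (F : R -> R) (a b : R) : R :=
  frac_weight beta (b - a) * (F b - F a).

(** The derivative at [s = 0] of [frac_avg beta F (a + s) (b + s)] when [f] is the
    derivative of [F]. *)
Definition frac_slope {R : realType} (beta : R) (f : R -> R) (a b : R) : R :=
  frac_weight beta (b - a) * (f b - f a).

(** [M] is the maximal function of the nonnegative continuous [f], with primitive [F],
    sup bound [m] and mass bound [N].  The supremum is described by an upper bound and
    an approximation property, so that [f] can be replaced by its reflection or by
    another function without unfolding suprema. *)
Record frac_max_data {R : realType} (beta : R) (F f M : R -> R) (m N : R) :
    Prop := FracMaxData {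
  fmd_derive : forall x : R, is_derive x 1 F (f x) ;
  fmd_cont : continuous f ;
  fmd_ge0 : forall x, 0 <= f x ;
  fmd_le : forall x, f x <= m ;
  fmd_mass : forall a b : R, F b - F a <= N ;
  fmd_ub : forall x a b : R, a <= x -> x <= b -> a < b -> frac_avg beta F a b <= M x ;
  fmd_sup : forall x e : R, 0 < e -> exists a b : R,
    [/\ a <= x, x <= b, a < b & M x - e < frac_avg beta F a b] }.

Section frac_max.
Context {R : realType}.
Variables (beta : R) (F f M : R -> R) (m N : R).
Hypotheses (beta_gt0 : 0 < beta) (beta_lt1 : beta < 1).
Hypothesis D : frac_max_data beta F f M m N.
Implicit Types x y a b d e l : R.
Local Notation w := (frac_weight beta).
Local Notation P := (frac_avg beta F).
Local Notation Q := (frac_slope beta f).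

Let Fx x := fmd_derive D x.

Lemma fmd_m_ge0 : 0 <= m.
Proof. exact: le_trans (fmd_ge0 D 0) (fmd_le D 0). Qed.

Lemma fmd_N_ge0 : 0 <= N.
Proof. by have := fmd_mass D 0 0; rewrite subrr. Qed.

Lemma fmd_homo a b : a <= b -> F a <= F b.
Proof.
rewrite le_eqVlt => /predU1P[->//|ab]; rewrite -subr_ge0.
have [c _ ->] := derive_MVT Fx ab.
by rewrite mulr_ge0 ?subr_ge0 ?(ltW ab)//; exact: fmd_ge0 D c.
Qed.

Lemma fmd_lip a b : a <= b -> F b - F a <= m * (b - a).
Proof.
rewrite le_eqVlt => /predU1P[->|ab]; first by rewrite !subrr mulr0.
have [c _ ->] := derive_MVT Fx ab.
by rewrite ler_wpM2r ?subr_ge0 ?(ltW ab)//; exact: fmd_le D c.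
Qed.

Lemma frac_avg_le_mass a b : P a b <= w (b - a) * N.
Proof. by rewrite ler_wpM2l ?frac_weight_ge0//; exact: fmd_mass D a b. Qed.

Lemma frac_avg_le_sup a b : a <= b -> P a b <= w (b - a) * (b - a) * m.
Proof.
move=> ab; rewrite -mulrA ler_wpM2l ?frac_weight_ge0// mulrC.
exact: fmd_lip.
Qed.

Lemma frac_max_ge0 x : 0 <= M x.
Proof.
apply: le_trans (fmd_ub D (a := x) (b := x + 1) _ _ _); rewrite ?lerDl ?ltrDl//.
by rewrite mulr_ge0 ?frac_weight_ge0// subr_ge0 fmd_homo// lerDl.
Qed.

Lemma fmd_strict x0 a b : 0 < f x0 -> a < x0 -> x0 < b -> F a < F b.
Proof.
move=> fx0 ax xb; rewrite lt_neqAle fmd_homo ?andbT; last by lra.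
apply/eqP => Fab; move: fx0; rewrite (derive_at_min (Fx x0) ax xb) ?ltxx// => y ay yb.
by apply: (@le_trans _ _ (F a)); [rewrite Fab; apply: fmd_homo; lra|exact: fmd_homo].
Qed.

Lemma frac_max_bounded_below x0 A : 0 < f x0 ->
  exists2 mu, 0 < mu & forall x, - A <= x -> x <= A -> mu <= M x.
Proof.
move=> fx0; pose B := `|A| + `|x0| + 1.
have [A0 x00] : A <= `|A| /\ `|x0| >= 0 by rewrite ler_norm normr_ge0.
have [x1 x2] : - `|x0| <= x0 /\ x0 <= `|x0| by apply/andP; rewrite -ler_norml.
have A1 := normr_ge0 A.
exists (P (- B) B) => [|x Ax xA].
  rewrite mulr_gt0 ?frac_weight_gt0 ?subr_gt0 ?(@fmd_strict x0)// /B; lra.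
by apply: (fmd_ub D); rewrite /B; lra.
Qed.

Lemma frac_max_gt0 x0 x : 0 < f x0 -> 0 < M x.
Proof.
move=> /(@frac_max_bounded_below _ `|x|)[mu mu0]; move=> /(_ x) h.
by apply: lt_le_trans mu0 (h _ (ler_norm _)); rewrite lerNl -normrN ler_norm.
Qed.

(** [w(L) N] tends to 0 as [L] tends to infinity, because [beta < 1]. *)
Lemma long_interval_small e : 0 < e ->
  exists2 L2, 0 < L2 & forall a b, a < b -> e <= P a b -> b - a <= L2.
Proof.
move=> e0; have N0 := fmd_N_ge0.
have [|L2 L20 hL2] := @frac_weight_small _ beta beta_lt1 (e / (N + 1)).
  by rewrite divr_gt0// ltr_wpDl.
exists L2 => // a b ab; apply: contraTT; rewrite -!ltNge => L2ab.
apply: le_lt_trans (frac_avg_le_mass a b) _.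
apply: (@le_lt_trans _ _ (e / (N + 1) * N)); first by rewrite ler_wpM2r// hL2// ltW.
by rewrite mulrAC -mulrA gtr_pMr// ltr_pdivrMr ?ltr_wpDl// mul1r ltrDl.
Qed.

(** [w(L) L m] tends to 0 with [L], because [beta > 0]. *)
Lemma short_interval_small e : 0 < e ->
  exists2 L1, 0 < L1 & forall a b, a < b -> e <= P a b -> L1 <= b - a.
Proof.
move=> e0; have m0 := fmd_m_ge0.
have [|L1 L10 hL1] := @frac_weightM_small _ beta beta_gt0 (e / (m + 1)).
  by rewrite divr_gt0// ltr_wpDl.
exists L1 => // a b ab; apply: contraTT; rewrite -!ltNge => L1ab.
apply: le_lt_trans (frac_avg_le_sup (ltW ab)) _.
apply: (@le_lt_trans _ _ (e / (m + 1) * m)).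
  by rewrite ler_wpM2r// hL1 ?subr_gt0// ltW.
by rewrite mulrAC -mulrA gtr_pMr// ltr_pdivrMr ?ltr_wpDl// mul1r ltrDl.
Qed.

(** A compact set of pairs of endpoints; by the two preceding lemmas, for suitable [l1]
    and [l2] it contains every interval around [x] with average at least [M x / 2]. *)
Definition interval_box (x l1 l2 : R) : set (R * R) :=
  (`[x - l2, x]%classic `*` `[x, x + l2]%classic) `&` [set p | l1 <= p.2 - p.1].

Lemma interval_box_compact (x l1 l2 : R) : compact (interval_box x l1 l2).
Proof.
apply: (@subclosed_compact _ _ (`[x - l2, x]%classic `*` `[x, x + l2]%classic)); last first.
- by move=> z [].
- by apply: compact_setX; exact: segment_compact.
apply: closedI.
  by apply: compact_closed => //; apply: compact_setX; exact: segment_compact.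
apply: (@preimage_closed _ _ (fun p : R * R => p.2 - p.1) [set y | l1 <= y]); last exact: closed_ge.
by move=> p _; apply: cvgB; [exact: cvg_snd|exact: cvg_fst].
Qed.

Lemma box_continuous (G : R -> R) (x l1 l2 : R) : 0 < l1 -> continuous G ->
  {within interval_box x l1 l2,
    continuous (fun p : R * R => w (p.2 - p.1) * (G p.2 - G p.1))}.
Proof.
move=> l10 cG; apply: continuous_in_subspaceT => p; rewrite inE => -[_ /= pl].
apply: cvgM.
  apply: (@continuous_comp _ _ _ (fun p : R * R => p.2 - p.1) w).
    by apply: cvgB; [exact: cvg_snd|exact: cvg_fst].
  by apply: is_derive_continuous (is_derive_frac_weight beta (lt_le_trans l10 pl)).
apply: cvgB.
  by apply: (@continuous_comp _ _ _ snd G); [exact: cvg_snd|exact: cG].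
by apply: (@continuous_comp _ _ _ fst G); [exact: cvg_fst|exact: cG].
Qed.

Let cF : continuous F.
Proof. by move=> x; exact: is_derive_continuous (Fx x). Qed.

Lemma frac_box x : 0 < M x -> exists l1 l2, 0 < l1 /\
  forall a b, a <= x -> x <= b -> a < b -> M x / 2 <= P a b ->
    interval_box x l1 l2 (a, b).
Proof.
move=> Mx; have Mx2 : 0 < M x / 2 by rewrite divr_gt0.
have [l1 l10 hl1] := short_interval_small Mx2.
have [l2 l20 hl2] := long_interval_small Mx2.
exists l1, l2; split => // a b ax xb ab hP.
have h1 := hl1 _ _ ab hP; have h2 := hl2 _ _ ab hP.
by split => //=; split; rewrite /= in_itv/=; lra.
Qed.

Lemma optimal_interval x : 0 < M x ->
  exists a b, [/\ a <= x, x <= b, a < b & P a b = M x].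
Proof.
move=> Mx; have [l1 [l2 [l10 hbox]]] := frac_box Mx.
have Mx2 : 0 < M x / 2 by rewrite divr_gt0.
have [|[a b]] := compact_EVT_max _ (@interval_box_compact x l1 l2) (box_continuous l10 cF).
- have [a [b [ax xb ab hP]]] := fmd_sup D x Mx2.
  by exists (a, b); apply: hbox => //; lra.
rewrite inE => -[[/=]]; rewrite !in_itv/= => /andP[_ ax] /andP[xb _] abl hmax.
have ab : a < b by lra.
exists a, b; split => //; apply/eqP; rewrite eq_le (fmd_ub D)//=.
rewrite leNgt; apply/negP => lt.
pose e := Num.min (M x - P a b) (M x / 2).
have e0 : 0 < e by rewrite lt_min subr_gt0 lt Mx2.
have [e1 e2] : e <= M x - P a b /\ e <= M x / 2 by rewrite /e !ge_min !lexx orbT.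
have [a' [b' [ax' xb' ab' hP]]] := fmd_sup D x e0.
(* [(a',b')] lies in the box and beats the maximum over the box *)
have := hmax (a', b'); rewrite inE => /(_ (hbox _ _ ax' xb' ab' ltac:(lra))).
move=> /= hle; have : P a' b' <= P a b by []. lra.
Qed.

(** Translating the optimal interval by [s] gives an interval around [x + s], so the
    average of the translate touches [M] from below at [s = 0]. *)
Lemma frac_max_deriv x d a b : is_derive x 1 M d ->
  a <= x -> x <= b -> a < b -> P a b = M x -> d = Q a b.
Proof.
move=> dM ax xb ab PM.
have dP : is_derive x 1 (fun y => w (b - a) * (F (y + (b - x)) - F (y + (a - x))))
    (w (b - a) * (f b - f a)).
  have d1 : is_derive x 1 (fun y => F (y + (b - x))) (f b).
    by apply: is_derive_translate; rewrite (_ : x + (b - x) = b) //; ring.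
  have d2 : is_derive x 1 (fun y => F (y + (a - x))) (f a).
    by apply: is_derive_translate; rewrite (_ : x + (a - x) = a) //; ring.
  exact: is_deriveZ (is_deriveB d1 d2).
apply: (derive_touching dM dP (a := x - 1) (b := x + 1)); rewrite ?ltrBlDr ?ltrDl//.
  move=> y _ _; have : P (y + (a - x)) (y + (b - x)) <= M y by apply: (fmd_ub D); lra.
  by rewrite /frac_avg (_ : y + (b - x) - (y + (a - x)) = b - a); last ring.
by rewrite -PM /frac_avg !(addrC x) !subrK.
Qed.

End frac_max.

(** * The band behind a nonzero slope *)

Section frac_max_regularity.
Context {R : realType}.
Variables (beta : R) (F f M : R -> R) (m N : R).
Hypotheses (beta_gt0 : 0 < beta) (beta_lt1 : beta < 1).
Hypothesis D : frac_max_data beta F f M m N.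
Implicit Types x y a b d e l : R.
Local Notation w := (frac_weight beta).
Local Notation P := (frac_avg beta F).
Local Notation Q := (frac_slope beta f).

(** Compactness: on the box, the nonnegative continuous function [H = (M x - P) + 2
    max(0, e - |Q - d|)] has no zero, hence a positive minimum.  It is stated under the
    assumption that all optimal intervals have the slope [d], which [frac_max_deriv]
    provides wherever [M] is differentiable. *)
Lemma near_optimal_slope x d : 0 < M x ->
  (forall a b, a <= x -> x <= b -> a < b -> P a b = M x -> Q a b = d) ->
  forall e, 0 < e -> exists2 r, 0 < r &
    forall a b, a <= x -> x <= b -> a < b -> M x - r < P a b -> `|Q a b - d| < e.
Proof.
move=> Mx Qd e e0; have [l1 [l2 [l10 hbox]]] := frac_box beta_gt0 beta_lt1 D Mx.
have Mx2 : 0 < M x / 2 by rewrite divr_gt0.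
have cF : continuous F by move=> y; exact: is_derive_continuous (fmd_derive D y).
pose s (p : R * R) := e - `|w (p.2 - p.1) * (f p.2 - f p.1) - d|.
pose H (p : R * R) := (M x - w (p.2 - p.1) * (F p.2 - F p.1)) + (s p + `|s p|).
have cs : {within interval_box x l1 l2, continuous s}.
  move=> p; apply: cvgB; first exact: cvg_cst.
  apply: cvg_norm; apply: cvgB; last exact: cvg_cst.
  exact: box_continuous l10 (fmd_cont D) p.
have cH : {within interval_box x l1 l2, continuous H}.
  move=> p; apply: cvgD; last by apply: cvgD; [|apply: cvg_norm]; exact: cs.
  by apply: cvgB; [exact: cvg_cst|exact: box_continuous l10 cF p].
have [|[a b]] := compact_EVT_min _ (@interval_box_compact _ x l1 l2) cH.
  have [a [b [ax xb ab hP]]] := optimal_interval beta_gt0 beta_lt1 D Mx.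
  by exists (a, b); apply: hbox => //; rewrite hP; lra.
rewrite inE => -[[/=]]; rewrite !in_itv/= => /andP[_ ax] /andP[xb _] abl hmin.
have ab : a < b by lra.
have Hab : 0 < H (a, b).
  rewrite /H/= -/(P a b); have s0 : 0 <= s (a, b) + `|s (a, b)|.
    by have := ler_norm (- s (a, b)); rewrite normrN; lra.
  have := fmd_ub D ax xb ab; rewrite le_eqVlt => /predU1P[PM|PM].
    rewrite PM subrr add0r /s/= -/(Q a b) Qd// subrr normr0 subr0.
    by rewrite gtr0_norm// addr_gt0.
  by rewrite ltr_wpDr// subr_gt0.
exists (Num.min (H (a, b)) (M x / 2)); first by rewrite lt_min Hab.
move=> a' b' ax' xb' ab' hP.
have [h1 h2] : M x - P a' b' < H (a, b) /\ M x / 2 <= P a' b'.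
  move: hP; set r := Num.min _ _.
  have [r1 r2] : r <= H (a, b) /\ r <= M x / 2 by rewrite /r !ge_min !lexx orbT.
  by move=> hP; split; lra.
have := hmin (a', b'); rewrite inE => /(_ (hbox _ _ ax' xb' ab' h2)).
rewrite {2}/H/= -/(P a' b') => h3.
have : 0 < s (a', b') + `|s (a', b')| by lra.
rewrite -[in X in _ -> X]subr_gt0 -/(s (a', b')); have [s0|s0 _ //] := leP (s (a', b')) 0.
by rewrite ler0_norm// subrr ltxx.
Qed.

(** Optimal intervals have length at least [L1] on a compact set, and translating such
    an interval changes its average by at most [2 m w(L1)] times the translation. *)
Lemma frac_max_lipschitz x0 A : 0 < f x0 -> exists2 k, 0 <= k &
  forall x y, - A <= x -> x <= A -> - A <= y -> y <= A ->
    `|M x - M y| <= k * `|x - y|.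
Proof.
move=> fx0; have [mu mu0 muM] := frac_max_bounded_below D A fx0.
have [L1 L10 hL1] := short_interval_small beta_gt0 D mu0.
have m0 := fmd_m_ge0 D.
have k0 : 0 <= 2 * m * w L1 by rewrite mulr_ge0 ?frac_weight_ge0// mulr_ge0.
have lip x y : - A <= x -> x <= A -> M x - M y <= 2 * m * w L1 * `|x - y|.
  move=> Ax xA; have muMx := muM _ Ax xA.
  have [a [b [ax xb ab PM]]] := optimal_interval beta_gt0 beta_lt1 D (lt_le_trans mu0 muMx).
  have Lab := hL1 _ _ ab ltac:(by rewrite PM).
  have : P (a + (y - x)) (b + (y - x)) <= M y by apply: (fmd_ub D); lra.
  rewrite /frac_avg (_ : b + (y - x) - (a + (y - x)) = b - a); last by ring.
  move: PM; rewrite /frac_avg => PM PMy.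
  have dF z h : F z - F (z + h) <= m * `|h| /\ F (z + h) - F z <= m * `|h|.
    have [h0|h0] := leP 0 h.
      have := fmd_homo D (a := z) (b := z + h); have := fmd_lip D (a := z) (b := z + h).
      rewrite lerDl h0 [X in m * (X - _)]addrC addrK => /(_ erefl) h1 /(_ erefl) h2.
      by have mh := mulr_ge0 m0 h0; rewrite ger0_norm//; split; lra.
    have h0' : 0 <= - h by lra.
    have := fmd_homo D (a := z + h) (b := z); have := fmd_lip D (a := z + h) (b := z).
    rewrite gerDl (ltW h0) opprD addNKr => /(_ erefl) h1 /(_ erefl) h2.
    by have mh := mulr_ge0 m0 h0'; rewrite ltr0_norm//; split; lra.
  have [h1 _] := dF b (y - x); have [_ h2] := dF a (y - x).
  have wL : w (b - a) <= w L1 by exact: frac_weight_le.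
  have h3 : F b - F a - (F (b + (y - x)) - F (a + (y - x))) <= 2 * m * `|x - y|.
    by rewrite distrC; lra.
  have h4 : M x - M y <= w (b - a) * (2 * m * `|x - y|).
    apply: le_trans (ler_wpM2l (frac_weight_ge0 beta (b - a)) h3).
    rewrite mulrBr; lra.
  apply: (le_trans h4); rewrite mulrC mulrAC.
  by rewrite ler_wpM2r// ler_wpM2l// mulr_ge0.
exists (2 * m * w L1) => // x y Ax xA Ay yA; rewrite ler_norml lip// andbT.
by rewrite lerNl opprB (le_trans (lip _ _ Ay yA))// distrC.
Qed.

(** Chosen so that [w(eta L) = (beta/2)^-1 w(L)]: by optimality of an interval of length
    [L], its initial piece of length [eta L] carries at most a fraction [beta/2] of the
    mass. *)
Definition frac_eta : R := (beta / 2) `^ (1 / (1 - beta)).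

Lemma frac_eta_gt0 : 0 < frac_eta.
Proof. by rewrite powR_gt0// divr_gt0. Qed.

Lemma frac_etaV : frac_eta `^ (beta - 1) = (beta / 2)^-1.
Proof.
rewrite -powRrM (_ : 1 / (1 - beta) * (beta - 1) = -1).
  by rewrite powR_inv1// divr_ge0// ltW.
by field; rewrite subr_eq0 gt_eqF.
Qed.

Lemma frac_eta_lt1 : frac_eta < 1.
Proof.
rewrite ltNge; apply/negP => h.
have : frac_eta `^ (1 - beta) >= 1.
  have b10 : 0 <= 1 - beta by rewrite subr_ge0 ltW.
  have := @ge0_ler_powR R (1 - beta) b10 1 frac_eta.
  by rewrite powR1 !nnegrE ler01 (le_trans _ h)// => /(_ erefl erefl h).
have b1 := beta_lt1; rewrite -(opprB beta 1) powRN frac_etaV invrK => h1; lra.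
Qed.

(** At the free end [b] the average is critical, which forces [f b = (1-beta) lam];
    beyond [x + eta L] at least a fraction [1 - beta/2] of the mass remains, so [f]
    takes a value at least [(1-beta/2) lam] there.  The band between the two values is
    crossed on [[u,v]]. *)
Lemma rising_edge x b d : 0 < M x -> is_derive x 1 M d -> x < b -> P x b = M x ->
  let L := b - x in let lam := (F b - F x) / L in
  [/\ 0 < lam, 0 <= d, d <= w L * lam, M x = w L * L * lam &
    exists u v, [/\ u < v, `|f u - f v| = beta / 2 * lam &
      forall t, u <= t -> t <= v -> [/\ frac_eta * L <= t - x, t <= b &
        (1 - beta) * lam <= f t <= (1 - beta / 2) * lam]]].
Proof.
move=> Mx dM xb PM L lam.
have [b0 b1] := (beta_gt0, beta_lt1).
have L0 : 0 < L by rewrite subr_gt0.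
have wL := frac_weight_gt0 beta L0.
have FL : F b - F x = lam * L by rewrite /lam divfK// gt_eqF.
have MxE : M x = w L * L * lam by rewrite -PM /frac_avg FL; ring.
have lam0 : 0 < lam by move: Mx; rewrite MxE pmulr_rgt0// mulr_gt0.
have d0 : 0 <= d.
  apply: (derive_ge0_right dM xb) => y xy yb; rewrite -PM.
  exact: (fmd_ub D).
have dE : d = w L * (f b - f x) by exact: (frac_max_deriv D dM (lexx x) (ltW xb) xb PM).
(* the right end of the optimal interval is free, hence critical *)
have fb : f b = (1 - beta) * lam.
  have dw : is_derive b 1 (fun y => w (y + - x)) ((beta - 1) * w L / L).
    by apply: is_derive_translate; apply: is_derive_frac_weight; exact: L0.
  have dF : is_derive b 1 (F - cst (F x)) (f b).
    have := is_deriveB (fmd_derive D b) (is_derive_cst (F x) b 1).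
    by rewrite subr0.
  have dP := is_deriveM dw dF.
  have := derive_touching (is_derive_cst (M x) b 1) dP (a := x + L / 2) (b := b + 1).
  rewrite ltrDl ltr01 => H.
  have : 0 = w (b - x) *: f b + (F b - F x) *: ((beta - 1) * w L / L).
    have L2 : 0 < L / 2 by rewrite divr_gt0.
    apply: H; [by rewrite /L; lra|by []| |by rewrite -[RHS]PM].
    move=> y hy _; change (P x y <= M x); apply: (fmd_ub D) => //; lra.
  rewrite /GRing.scale/= FL -/L => h.
  have : w L * (f b - (1 - beta) * lam) = 0.
    by rewrite h; field; rewrite gt_eqF.
  by move/eqP; rewrite mulf_eq0 (gt_eqF wL)/= subr_eq0 => /eqP.
split => //.
  rewrite dE ler_pM2l//; apply: (@le_trans _ _ (f b)).
    by rewrite gerBl (fmd_ge0 D).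
  by rewrite fb ger_pMl// gerBl ltW.
have e0 := frac_eta_gt0; have e1 := frac_eta_lt1.
pose p := x + frac_eta * L.
have eL0 : 0 < frac_eta * L by rewrite mulr_gt0.
have eL1 : frac_eta * L < L by rewrite gtr_pMl.
have xp : x < p by rewrite /p ltrDl.
have pb : p < b by have : L = b - x by []; rewrite /p; lra.
have Fp : F p - F x <= beta / 2 * (lam * L).
  have : P x p <= M x by apply: (fmd_ub D) => //; exact: ltW.
  rewrite -PM /frac_avg -/L FL (_ : p - x = frac_eta * L); last by rewrite /p; ring.
  rewrite frac_weight_scale// frac_etaV -mulrA mulrCA ler_pM2l// mulrC.
  by rewrite ler_pdivrMr ?divr_gt0// mulrC.
(* a mean value point on the part of the interval beyond x + eta L *)
have [c [pc cb] Fc] := derive_MVT (fmd_derive D) pb.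
have fc : (1 - beta / 2) * lam <= f c.
  have h1 : (1 - beta / 2) * lam * L <= f c * (b - p) by rewrite -Fc; lra.
  have h2 : f c * (b - p) <= f c * L by rewrite ler_wpM2l ?(fmd_ge0 D)// /L; lra.
  by rewrite -(ler_pM2r L0); exact: le_trans h1 h2.
have [||u [v [cu uv vb [fu fv huv]]]] := band_crossing (fmd_cont D) (ltW cb) _ fc (A := (1 - beta) * lam).
- by rewrite ltr_pM2r//; lra.
- by rewrite fb.
exists u, v; split => //.
  have -> : f u - f v = beta / 2 * lam by rewrite fu fv; field.
  by rewrite ger0_norm// mulr_ge0 ?(ltW lam0)// divr_ge0// ltW.
move=> t ut tv; split; [|exact: le_trans tv vb|exact: huv].
by rewrite lerBrDl -/p; lra.
Qed.

End frac_max_regularity.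

Section reflection.
Context {R : realType}.
Variables (beta : R) (F f M : R -> R) (m N : R).

(** Exchanges the roles of the two endpoints. *)
Lemma frac_max_data_reflect : frac_max_data beta F f M m N ->
  frac_max_data beta (fun x => - F (- x)) (fun x => f (- x)) (fun x => M (- x)) m N.
Proof.
have PE a b : frac_avg beta (fun x => - F (- x)) a b = frac_avg beta F (- b) (- a).
  by rewrite /frac_avg opprK (addrC (- a)) (addrC (- F _)) opprK addrC; congr (_ * _); ring.
move=> [dF cf f0 fm FN ub sup]; split => //.
- move=> x; have := is_deriveN (is_derive_reflect (dF (- x))).
  by rewrite opprK.
- by move=> x; apply: (@continuous_comp _ _ _ -%R f); [exact: oppr_continuous|exact: cf].
- by move=> a b; rewrite opprK addrC.
- by move=> x a b ax xb ab; rewrite PE; apply: ub; rewrite ?lerN2 ?ltrN2.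
- move=> x e e0; have [a [b [ax xb ab h]]] := sup (- x) e e0.
  by exists (- b), (- a); rewrite PE !opprK lerNl lerNr ltrN2.
Qed.

End reflection.

Section slope_witness.
Context {R : realType}.
Variables (beta : R) (F f M : R -> R) (m N : R).
Hypotheses (beta_gt0 : 0 < beta) (beta_lt1 : beta < 1).
Hypothesis D : frac_max_data beta F f M m N.
Implicit Types x d L lam u v t th : R.
Local Notation w := (frac_weight beta).

(** An interior [x] would be a minimum of [M] over the optimal interval, so [x] is one
    of its endpoints; the right endpoint reduces to the left one by reflection.  The
    last clause holds because every point of the optimal interval has maximal value at
    least [M x]. *)
Lemma slope_witness x d : 0 < M x -> is_derive x 1 M d -> d != 0 ->
  exists L lam u v,
    [/\ 0 < L, 0 < lam, `|d| <= w L * lam, M x = w L * L * lam & lam * L <= N] /\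
    [/\ u < v, `|f u - f v| = beta / 2 * lam & forall t, u <= t -> t <= v ->
      [/\ frac_eta beta * L <= `|t - x|, `|t - x| <= L,
          (1 - beta) * lam <= f t <= (1 - beta / 2) * lam &
          forall th, 0 <= th -> th <= 1 -> M x <= M (x + th * (t - x))]].
Proof.
move=> Mx dM d0; have e0 := frac_eta_gt0 beta_gt0.
have [a [b [ax xb ab PM]]] := optimal_interval beta_gt0 beta_lt1 D Mx.
have up y : a <= y -> y <= b -> M x <= M y.
  by move=> ay yb; rewrite -PM; exact: (fmd_ub D).
have [aE|aNx] := eqVneq a x.
  rewrite aE in ab up PM.
  have [lam0 d0' dle MxE [u [v [uv fuv huv]]]] := rising_edge beta_gt0 beta_lt1 D Mx dM ab PM.
  have L0 : 0 < b - x by rewrite subr_gt0.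
  exists (b - x), ((F b - F x) / (b - x)), u, v; split; split => //.
  - by rewrite ger0_norm.
  - by rewrite divfK ?gt_eqF// (fmd_mass D).
  move=> t ut tv; have [h1 h2 h3] := huv t ut tv.
  have tx : 0 <= t - x by apply: le_trans h1; rewrite mulr_ge0// ltW.
  rewrite ger0_norm//; split => //; first by lra.
  move=> th th0 th1; apply: up; first by rewrite lerDl mulr_ge0.
  by have : th * (t - x) <= 1 * (t - x) by [exact: ler_wpM2r]; lra.
have [bE|bNx] := eqVneq b x; last first.
  have ax' : a < x by rewrite lt_neqAle aNx.
  have xb' : x < b by rewrite lt_neqAle eq_sym bNx.
  by move: d0; rewrite (derive_at_min dM ax' xb' up) eqxx.
rewrite bE in ab up PM.
(* the interval ends at x: apply the other case to the reflected data at -x *)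
have D' := frac_max_data_reflect D.
have dM' : is_derive (- x) 1 (fun y => M (- y)) (- d).
  by apply: is_derive_reflect; rewrite opprK.
have ab' : - x < - a by rewrite ltrN2.
have Mx' : 0 < M (- - x) by rewrite opprK.
have PM' : frac_avg beta (fun y => - F (- y)) (- x) (- a) = M (- - x).
  by rewrite opprK -PM /frac_avg !opprK; congr (frac_weight _ _ * _); ring.
have [lam0 d0' dle MxE [u [v [uv fuv huv]]]] :=
  rising_edge beta_gt0 beta_lt1 D' Mx' dM' ab' PM'.
have LE : - a + x = x - a by ring.
have L0 : 0 < x - a by rewrite subr_gt0.
move: lam0 dle MxE fuv huv; rewrite !opprK LE.
have -> : - F a + F x = F x - F a by ring.
set lam := (F x - F a) / (x - a) => lam0 dle MxE fuv huv.
exists (x - a), lam, (- v), (- u); split; split => //.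
- by rewrite ler0_norm// -oppr_ge0.
- by rewrite divfK ?gt_eqF// (fmd_mass D).
- by rewrite ltrN2.
- by rewrite distrC.
move=> t vt tu; have := huv (- t); rewrite lerNr tu lerNl vt => /(_ erefl erefl).
rewrite !opprK => -[h1 h2 h3].
have tx : 0 <= x - t by rewrite addrC; apply: le_trans h1; rewrite mulr_ge0// ltW.
rewrite distrC ger0_norm//; split => //; [lra|lra|].
move=> th th0 th1; have h : 0 <= th * (x - t) by rewrite mulr_ge0.
by apply: up; have : th * (x - t) <= 1 * (x - t) by [exact: ler_wpM2r]; lra.
Qed.

End slope_witness.

(** * A smooth step *)

Section smooth_step.
Context {R : realType}.
Implicit Types (f g : R -> R) (x y : R).

Lemma is_derive_quadratic f x d C : 0 <= C ->
  (forall y, `|f y - f x - d * (y - x)| <= C * (y - x) ^+ 2) -> is_derive x 1 f d.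
Proof.
move=> C0 fC.
have fd : (h^-1 *: ((f \o shift x) (h *: 1) - f x)) @[h --> 0^'] --> d.
  apply/cvgrPdist_le => /= e e0; exists (e / (C + 1)) => /=.
    by rewrite divr_gt0// ltr_wpDl.
  move=> h; rewrite /ball_/= sub0r normrN => he h0.
  rewrite [_%:A]mulr1; have := fC (h + x); rewrite addrK => hC.
  have -> : d - h^-1 *: (f (h + x) - f x) = - (h^-1 * (f (h + x) - f x - d * h)).
    by rewrite /GRing.scale/=; field.
  rewrite normrN normrM normfV ler_pdivrMl ?normr_gt0// (le_trans hC)//.
  rewrite -normr_id -(real_normK (num_real h)) expr2 mulrA.
  rewrite normr_id mulrC ler_wpM2l//.
  have : `|h| * (C + 1) <= e by rewrite -ler_pdivlMr ?ltr_wpDl// ltW.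
  by rewrite mulrDr mulr1 mulrC; have := normr_ge0 h; lra.
apply: DeriveDef; last exact/cvg_lim.
by apply/cvg_ex; exists d.
Qed.

(** The family [x^-k exp(-1/x)] on the positive half-line is closed under
    differentiation up to linear combinations, hence consists of smooth functions. *)
Definition flat (k : nat) (x : R) : R :=
  if 0 < x then x^-1 ^+ k * expR (- x^-1) else 0.

Lemma flat_le0 k x : x <= 0 -> flat k x = 0.
Proof. by rewrite /flat ltNge => ->. Qed.

Lemma flat0_gt0 x : 0 < x -> 0 < flat 0 x.
Proof. by rewrite /flat => ->; rewrite expr0 mul1r expR_gt0. Qed.

Lemma flat0_ge0 x : 0 <= flat 0 x.
Proof. by have [/flat_le0->//|/flat0_gt0/ltW] := leP x 0. Qed.

Lemma flat_quadratic k x : `|flat k x| <= k.+2`!%:R * x ^+ 2.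
Proof.
have [x0|x0] := leP x 0.
  by rewrite flat_le0// normr0 mulr_ge0// sqr_ge0.
rewrite /flat x0 ger0_norm; last by rewrite mulr_ge0 ?expR_ge0// exprn_ge0// invr_ge0 ltW.
set y := x^-1; have y0 : 0 < y by rewrite invr_gt0.
have -> : x = y^-1 by rewrite invrK.
rewrite expRN ler_pdivrMr ?expR_gt0// (exprVn y) mulrAC ler_pdivlMr ?exprn_gt0//.
rewrite -exprD addn2 mulrC -ler_pdivrMr ?ltr0n ?fact_gt0//.
have := expR_ge1Dxn k.+1 (ltW y0); apply: le_trans.
by rewrite lerDr.
Qed.

Lemma is_derive_flat k x :
  is_derive x 1 (flat k) (- k%:R * flat k.+1 x + flat k.+2 x).
Proof.
have [x0|x0|x0] := ltgtP x 0.
- rewrite !flat_le0 ?ltW// mulr0 addr0; apply: near_eq_is_derive (is_derive_cst 0 x 1).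
  near=> y; rewrite /= flat_le0//; near: y; exact: lt_le_nbhsl.
- have dV : is_derive x 1 (fun y : R => y^-1) (- x^-1 ^+ 2).
    have := @is_deriveV R id x 1 1 (lt0r_neq0 x0) (is_derive_id x 1).
    by rewrite /GRing.scale/= mulr1 exprVn.
  have dE : is_derive x 1 (fun y : R => expR (- y^-1)) (expR (- x^-1) * x^-1 ^+ 2).
    have := @is_derive1_comp R expR (fun y : R => - y^-1) x _ _ (is_derive_expR _) (is_deriveN dV).
    by rewrite opprK.
  have dX := is_deriveX k dV.
  have := is_deriveM dX dE.
  rewrite (_ : _ *: _ + _ = - k%:R * flat k.+1 x + flat k.+2 x).
    apply: near_eq_is_derive; near=> y.
    have y0 : 0 < y by near: y; exact: lt_nbhsr.
    by rewrite /flat y0 !fctE.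
  rewrite /flat x0 /GRing.scale/= fctE.
  case: k {dX} => [|k]; first by rewrite /= !exprS !expr0; ring.
  by rewrite /= !exprS; ring.
- rewrite x0 !flat_le0// mulr0 addr0.
  apply: (@is_derive_quadratic _ _ _ k.+2`!%:R) => // y.
  by rewrite (@flat_le0 k 0)// mul0r !subr0 flat_quadratic.
Unshelve. all: by end_near. Qed.

(** An inductively generated class of functions that is closed under differentiation, so
    that membership gives all iterated derivatives at once. *)
Inductive smooth_expr : (R -> R) -> Prop :=
| smooth_flat k : smooth_expr (flat k)
| smooth_cst c : smooth_expr (cst c)
| smooth_add f g : smooth_expr f -> smooth_expr g -> smooth_expr (f + g)
| smooth_mul f g : smooth_expr f -> smooth_expr g -> smooth_expr (f * g)
| smooth_inv f : smooth_expr f -> (forall x, f x != 0) ->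
    smooth_expr (fun x => (f x)^-1)
| smooth_affine f a b : smooth_expr f -> smooth_expr (fun x => f (a * x + b)).

Lemma smooth_expr_derive f : smooth_expr f ->
  exists2 g, smooth_expr g & forall x, is_derive x 1 f (g x).
Proof.
elim=> [k|c|{}f g _ [f' sf' df] _ [g' sg' dg]|{}f g sf [f' sf' df] sg [g' sg' dg]
  |{}f sf [f' sf' df] f0|{}f a b _ [f' sf' df]].
- exists (cst (- k%:R) * flat k.+1 + flat k.+2).
    by do !constructor.
  by move=> x; exact: is_derive_flat.
- by exists (cst 0); [constructor|move=> x; exact: is_derive_cst].
- by exists (f' + g'); [constructor|move=> x; exact: is_deriveD].
- by exists (f * g' + g * f'); [do !constructor|move=> x; exact: is_deriveM].
- exists (cst (-1) * ((fun x => (f x)^-1) * (fun x => (f x)^-1)) * f').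
    by do !constructor.
  move=> x; apply: (is_derive_eq (is_deriveV (f0 x) (df x))).
  by rewrite /GRing.scale/= !fctE; field; exact: f0.
- exists (cst a * (fun x => f' (a * x + b))); first by do !constructor.
  move=> x; rewrite [X in is_derive _ _ _ X]mulrC.
  have da : is_derive x 1 (fun y => a * y + b) a.
    have := is_deriveD (is_deriveZ a (is_derive_id x (1 : R))) (is_derive_cst b x 1).
    by rewrite addr0 /GRing.scale/= mulr1.
  exact: (@is_derive1_comp R f (fun y => a * y + b) x _ _ (df _) da).
Qed.

Lemma smooth_expr_derivable f : smooth_expr f ->
  forall n x, derivable (derive1n n f) x 1.
Proof.
move=> sf n; elim: n f sf => [|n IH] f sf x.
  by have [g _ dg] := smooth_expr_derive sf; case: (dg x).
have [g sg dg] := smooth_expr_derive sf.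
have -> : derive1n n.+1 f = derive1n n g.
  rewrite /derive1n iterSr; congr iter; apply/funext => y.
  by rewrite derive1E; case: (dg y).
exact: IH.
Qed.

Definition step : R -> R := fun x => flat 0 x / (flat 0 x + flat 0 (1 - x)).

Let step_den x : 0 < flat 0 x + flat 0 (1 - x).
Proof.
have [x0|x0] := leP x 0; last by rewrite ltr_wpDr ?flat0_ge0// flat0_gt0.
by rewrite ltr_wpDl ?flat0_ge0// flat0_gt0//; lra.
Qed.

Lemma step_smooth : smooth_expr step.
Proof.
have -> : step = flat 0 * (fun x => ((flat 0 + (fun y => flat 0 (-1 * y + 1))) x)^-1).
  by apply/funext => x; rewrite /step !fctE mulN1r (addrC (- x)).
constructor; first constructor; constructor.
  by constructor; [constructor|apply: (smooth_affine (f := flat 0)); constructor].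
by move=> x; rewrite !fctE mulN1r (addrC (- x)) gt_eqF.
Qed.

Lemma step_le0 x : x <= 0 -> step x = 0.
Proof. by move=> x0; rewrite /step flat_le0// mul0r. Qed.

Lemma step_ge1 x : 1 <= x -> step x = 1.
Proof.
move=> x1; rewrite /step (@flat_le0 0 (1 - x)); last lra.
by rewrite addr0 divff// gt_eqF// flat0_gt0//; lra.
Qed.

Lemma step_bounds x : 0 <= step x <= 1.
Proof.
rewrite /step divr_ge0 ?flat0_ge0 ?(ltW (step_den _))//=.
by rewrite ler_pdivrMr// mul1r lerDl flat0_ge0.
Qed.

Lemma step_derivative : exists b : R -> R, exists K : R, [/\ smooth_expr b,
  forall x, is_derive x 1 step (b x), continuous b, forall x, `|b x| <= K &
  forall x : R, x <= 0 \/ 1 <= x -> b x = 0].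
Proof.
have [b sb db] := smooth_expr_derive step_smooth.
have cb : continuous b.
  move=> x; have [b' _ db'] := smooth_expr_derive sb.
  exact: is_derive_continuous (db' x).
have b0 x : x <= 0 \/ 1 <= x -> b x = 0.
  move=> x01; have [x0|x1] : (x <= 0 \/ 1 <= x) := x01.
  - apply/eqP; rewrite eq_le; apply/andP; split.
      apply: (derive_le0_left (db x) (a := x - 1)) => [|y _ yx].
        by rewrite gtrBl.
      by rewrite !step_le0//; exact: le_trans x0.
    rewrite -oppr_le0.
    have := is_deriveN (db x) => dN.
    apply: (derive_le0_left dN (a := x - 1)) => [|y _ yx]; first by rewrite gtrBl.
    by rewrite !fctE !step_le0//; exact: le_trans x0.
  - apply/eqP; rewrite eq_le; apply/andP; split; last first.
      apply: (derive_ge0_right (db x) (b := x + 1)) => [|y xy _].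
        by rewrite ltrDl.
      by rewrite !step_ge1//; exact: le_trans xy.
    rewrite -oppr_ge0.
    have := is_deriveN (db x) => dN.
    apply: (derive_ge0_right dN (b := x + 1)) => [|y xy _]; first by rewrite ltrDl.
    by rewrite !fctE !step_ge1//; exact: le_trans xy.
have [c _ hc] := @EVT_max R (fun x => `|b x|) 0 1 ler01
  (continuous_subspaceT (fun x => cvg_norm (cb x))).
exists b, `|b c|; split => // x.
have [x01|] := boolP (x \in `[0, 1]); first exact: hc.
rewrite in_itv/= negb_and -!ltNge => /orP[x0|x1]; rewrite b0 ?normr0//.
  by left; exact: ltW.
by right; exact: ltW.
Qed.

End smooth_step.

(** * Increments of a function with a weak derivative *)

Section locally_integrable_facts.
Context {R : realType}.
Local Notation mu := (@lebesgue_measure R).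
Implicit Types (u g k : R -> R).

Lemma locally_integrable_itv u (a b : R) : locally_integrable setT u ->
  mu.-integrable `[a, b] (EFin \o u).
Proof.
move=> [mu_ _ hu]; apply/integrableP; split.
  by apply/measurable_EFinP; exact: measurable_funS mu_.
by apply: hu => //; exact: segment_compact.
Qed.

Lemma locally_integrable_restrict u (a b : R) : locally_integrable setT u ->
  mu.-integrable setT (EFin \o (u \_ `[a, b])).
Proof.
move=> lu; rewrite -restrict_EFin; apply: (iffLR (integrable_mkcond _ _)).
  exact: measurable_itv.
exact: locally_integrable_itv.
Qed.

Lemma locally_integrableM u k (C a b : R) : locally_integrable setT u ->
  measurable_fun setT k -> (forall x, `|k x| <= C) ->
  (forall x, ~ `[a, b]%classic x -> k x = 0) ->
  mu.-integrable setT (EFin \o (fun x => u x * k x)).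
Proof.
move=> lu mk kC k0; have [mu_ _ _] := lu.
have iu : mu.-integrable setT (fun x => (C * (u \_ `[a, b]) x)%:E).
  under eq_fun do rewrite EFinM; apply: integrableZl => //.
  exact: locally_integrable_restrict.
apply: le_integrable iu => //.
  by apply/measurable_EFinP; exact: measurable_funM.
move=> x _ /=; rewrite lee_fin !normrM [`|C|]ger0_norm; last first.
  exact: le_trans (kC 0).
rewrite patchE; case: ifPn => xab; first by rewrite mulrC ler_wpM2r.
by rewrite k0 ?normr0 ?mulr0//; move: xab; rewrite notin_setE.
Qed.

End locally_integrable_facts.

Section cutoff.
Context {R : realType}.
Local Notation mu := (@lebesgue_measure R).
Variables (k : R -> R) (K : R).
Hypotheses (sk : smooth_expr k) (dk : forall x : R, is_derive x 1 step (k x))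
  (ck : continuous k) (kK : forall x, `|k x| <= K)
  (k0 : forall x : R, x <= 0 \/ 1 <= x -> k x = 0).
Implicit Types (a b e x : R) (u g : R -> R).

(** It rises on [[a,a+e]] and falls on [[b,b+e]], so as [e] tends to 0 its limit is the
    indicator of [`]a, b]]. *)
Definition cutoff a b e x : R := step ((x - a) / e) - step ((x - b) / e).

Definition mollifier (f : R -> R) a e x : R := f ((x - a) / e) / e.

Lemma is_derive_step_at a e x :
  is_derive x 1 (fun x => step ((x - a) / e)) (mollifier k a e x).
Proof.
have da : is_derive x 1 (fun y : R => (y - a) / e) e^-1.
  have := is_deriveZ e^-1 (is_deriveB (is_derive_id x (1 : R)) (is_derive_cst a x 1)).
  rewrite subr0 /GRing.scale/= mulr1.
  rewrite (_ : e^-1 \*: _ = (fun y : R => (y - a) / e))//.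
  by apply/funext => y; rewrite /GRing.scale/= mulrC.
exact: (@is_derive1_comp R step (fun y => (y - a) / e) x _ _ (dk _) da).
Qed.

Lemma is_derive_cutoff a b e x :
  is_derive x 1 (cutoff a b e) (mollifier k a e x - mollifier k b e x).
Proof. exact: is_deriveB (is_derive_step_at a e x) (is_derive_step_at b e x). Qed.

Lemma cutoff_support a b e x : a < b -> 0 < e -> ~ `[a, b + e]%classic x ->
  cutoff a b e x = 0.
Proof.
move=> ab e0 /=; rewrite in_itv/= => /negP; rewrite negb_and -!ltNge /cutoff.
move=> /orP[xa|bx].
  rewrite !step_le0 ?subrr// ler_pdivrMr// mul0r subr_le0 ltW//.
  exact: lt_trans xa ab.
rewrite !step_ge1 ?subrr// ler_pdivlMr// mul1r; lra.
Qed.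

Lemma cutoff_test a b e : a < b -> 0 < e -> test_function (cutoff a b e).
Proof.
move=> ab e0; split.
  have se c : smooth_expr (fun x => step ((x - c) / e) : R).
    have := smooth_affine e^-1 (- c / e) (@step_smooth R).
    congr smooth_expr; apply/funext => x; congr step.
    by rewrite mulrBl mulrC mulNr.
  have sc : smooth_expr (cutoff a b e).
    rewrite (_ : cutoff _ _ _ = (fun x => step ((x - a) / e)) +
        cst (-1) * (fun x => step ((x - b) / e))).
      by constructor => //; constructor => //; constructor.
    by apply/funext => x; rewrite /cutoff fctE/= !fctE mulN1r.
  by move=> n x; exact: smooth_expr_derivable.
apply: (subclosed_compact (@closed_closure _ _) (@segment_compact R a (b + e))).
rewrite [X in _ `<=` X](closure_id _).1; last exact: itv_closed.
apply: closureS => x /= /eqP xab; apply: contrapT => xNab; apply: xab.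
exact: cutoff_support.
Qed.

Lemma mollifier0 a e x : 0 < e -> ~ `[a, a + e]%classic x -> mollifier k a e x = 0.
Proof.
move=> e0; rewrite /= in_itv/= => /negP; rewrite negb_and -!ltNge /mollifier => xa.
rewrite k0 ?mul0r//; case/orP : xa => xa; [left|right].
  by rewrite ler_pdivrMr// mul0r subr_le0 ltW.
by rewrite ler_pdivlMr// mul1r; lra.
Qed.

Lemma mollifier_le a e x : 0 < e -> `|mollifier k a e x| <= K / e.
Proof. by move=> e0; rewrite normrM normfV (gtr0_norm e0) ler_wpM2r// invr_ge0 ltW. Qed.

Lemma mollifier_continuous a e : continuous (mollifier k a e).
Proof.
move=> x; apply: cvgM; last exact: cvg_cst.
apply: (@continuous_comp _ _ _ (fun x : R => (x - a) / e) k); last exact: ck.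
by apply: cvgM; [apply: cvgB; [exact: cvg_id|exact: cvg_cst]|exact: cvg_cst].
Qed.

Lemma mollifier_integrable u a e : locally_integrable setT u -> 0 < e ->
  mu.-integrable setT (EFin \o (fun x => u x * mollifier k a e x)).
Proof.
move=> lu e0; apply: (@locally_integrableM _ _ _ (K / e) a (a + e)) => //.
- exact: continuous_measurable_fun (@mollifier_continuous a e).
- by move=> x; exact: mollifier_le.
- by move=> x; exact: mollifier0.
Qed.

Lemma locally_integrable_cst (c : R) : locally_integrable setT (cst c : R -> R).
Proof.
split => //; first exact: openT.
move=> C _ cC; rewrite (integral_cst mu (compact_measurable cC) (`|c|%:E)).
by rewrite lte_mul_pinfty ?lee_fin// compact_finite_measure.
Qed.

Lemma mollifier_mass a e : 0 < e -> (\int[mu]_x (mollifier k a e x)%:E = 1)%E.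
Proof.
move=> e0; rewrite (_ : (fun x => (mollifier k a e x)%:E) =
    (fun x => (mollifier k a e x)%:E) \_ `[a, a + e]); last first.
  apply/funext => x; rewrite patchE; case: ifPn => // /negP xa.
  by rewrite mollifier0//; move=> h; apply: xa; rewrite inE.
rewrite -integral_mkcond.
rewrite (@continuous_FTC2 _ _ (fun x => step ((x - a) / e))).
- rewrite (addrC a) addrK divff ?gt_eqF// subrr mul0r step_ge1// step_le0// -EFinB.
  by rewrite subr0.
- by rewrite ltrDl.
- exact: continuous_subspaceT (@mollifier_continuous a e).
- have cs x : {for x, continuous (fun x => step ((x - a) / e))}.
    exact: is_derive_continuous (is_derive_step_at a e x).
  split.
  + by move=> x _; case: (is_derive_step_at a e x).
  + by apply: cvg_at_right_filter; exact: cs.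
  + by apply: cvg_at_left_filter; exact: cs.
- by move=> x _; rewrite derive1E; case: (is_derive_step_at a e x).
Qed.

(** The mollifier has mass 1, so the difference is the integral of [(u x - u a)] against
    it; the window [[a,a+e]] lies in the ball of radius [2e] around [a], and [4K] is
    [K/e] times the measure of that ball. *)
Lemma mollifier_davg u a e : locally_integrable setT u -> 0 < e ->
  (`| \int[mu]_x (u x * mollifier k a e x)%:E - (u a)%:E |
   <= (4 * K)%:E * davg u a (2 * e))%E.
Proof.
move=> lu e0; have [mu_ _ _] := lu.
have ia := mollifier_integrable a (locally_integrable_cst (u a)) e0.
have iu := mollifier_integrable a lu e0.
have -> : (u a)%:E = (\int[mu]_x (u a * mollifier k a e x)%:E)%E.
  under eq_integral do rewrite EFinM.
  rewrite integralZl// ?mollifier_mass ?mule1//.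
  have := mollifier_integrable a (locally_integrable_cst 1) e0.
  by apply: eq_integrable => // x _ /=; rewrite mul1r.
rewrite -integralB//.
have mm : measurable_fun setT (mollifier k a e).
  exact: continuous_measurable_fun (@mollifier_continuous a e).
have mua : measurable_fun setT (fun x => u x - u a) by exact: measurable_funB.
apply: le_trans (le_abse_integral _ _ _) _ => //.
  apply/measurable_EFinP/measurable_funB; exact: measurable_funM.
have K0 : 0 <= K by exact: le_trans (kK 0).
apply: (@le_trans _ _ (\int[mu]_(x in ball a (2 * e)) (K / e * `|u x - u a|)%:E)%E).
  rewrite [leRHS]integral_mkcond; apply: ge0_le_integral => //.
  - by apply/measurable_EFinP/measurableT_comp => //; apply: measurable_funB; exact: measurable_funM.
  - apply/(measurable_restrictT _ _).1; first exact: measurable_ball.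
    apply/measurable_EFinP/measurable_funM => //.
    by apply: measurableT_comp => //; exact: measurable_funS mua.
  move=> x _; rewrite -EFinB abse_EFin -mulrBl normrM patchE; case: ifPn => xa.
    by rewrite lee_fin mulrC ler_wpM2r// mollifier_le.
  rewrite mollifier0 ?normr0 ?mulr0// => /=; rewrite in_itv/= => xae.
  move: xa; rewrite notin_setE; apply; rewrite /ball/= distrC ger0_norm; lra.
under eq_integral do rewrite EFinM.
rewrite ge0_integralZl//; last 3 first.
- exact: measurable_ball.
- apply/measurable_EFinP; apply: measurableT_comp => //; exact: measurable_funS mua.
- by rewrite lee_fin divr_ge0// ltW.
rewrite /davg /iavg lebesgue_measure_ball; last by rewrite mulr_ge0// ltW.
rewrite muleA; apply: lee_wpmul2r; first exact: integral_ge0.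
rewrite inver gt_eqF; last by rewrite mulrn_wgt0// mulr_gt0.
rewrite -EFinM lee_fin le_eqVlt; apply/orP; left; apply/eqP.
by rewrite -mulr_natl; field; rewrite gt_eqF.
Qed.

Lemma mollifier_cvg u a : locally_integrable setT u -> lebesgue_pt u a ->
  (\int[mu]_x (u x * mollifier k a n.+1%:R^-1 x)%:E)%E @[n --> \oo] --> (u a)%:E.
Proof.
move=> lu la.
have h2 : davg u a (2 * n.+1%:R^-1) @[n --> \oo] --> 0%E.
  have /cvge_at_rightP := la; apply; split; first by move=> n; rewrite mulr_gt0.
  by rewrite -(mulr0 2); apply: cvgM; [exact: cvg_cst|exact: cvg_harmonic].
have h3 : ((4 * K)%:E * davg u a (2 * n.+1%:R^-1))%E @[n --> \oo] --> 0%E.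
  by rewrite -(mule0 (4 * K)%:E); apply: cvgeZl.
apply/(sube_cvg0 _ _).1 => //; apply/cvg_abse0P.
apply: (squeeze_cvge _ (cvg_cst 0%E) h3).
by apply: nearW => n /=; rewrite abse_ge0/= mollifier_davg.
Qed.

Lemma step_cvg c x : step ((x - c) / n.+1%:R^-1) @[n --> \oo] --> ((c < x)%R%:R : R).
Proof.
apply: cvg_near_cst; have [xc|cx] := leP x c.
  by apply: nearW => n; rewrite step_le0// invrK mulr_le0_ge0// subr_le0.
near=> n; rewrite step_ge1// invrK -ler_pdivrMl ?subr_gt0// mulr1.
rewrite ltW//; near: n; have := nbhs_infty_gtr (x - c)^-1.
by apply: filterS => n hn; rewrite (lt_le_trans hn)// ler_nat.
Unshelve. all: by end_near. Qed.

Lemma cutoff_cvg g a b : locally_integrable setT g -> a < b ->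
  (\int[mu]_x (g x * cutoff a b n.+1%:R^-1 x)%:E)%E @[n --> \oo] -->
  (\int[mu]_(x in `]a, b]) (g x)%:E)%E.
Proof.
move=> lg ab; have [mg _ _] := lg.
have mcut n : measurable_fun setT (cutoff a b n.+1%:R^-1).
  apply: continuous_measurable_fun => x.
  exact: is_derive_continuous (is_derive_cutoff _ _ _ _).
rewrite [X in _ --> X](_ : _ = (\int[mu]_x (g x * \1_`]a, b] x)%:E)%E); last first.
  rewrite integral_mkcond; apply: eq_integral => x _; rewrite patchE indicE.
  by case: ifPn => _; rewrite ?mulr1 ?mulr0.
have ig : mu.-integrable setT (fun x => (`|(g \_ `[a, b + 1]) x|)%:E).
  exact: integrable_abse (locally_integrable_restrict a (b + 1) lg).
have [//|||//||_ _] := @dominated_convergence _ _ _ mu setT measurableT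
  (fun n x => (g x * cutoff a b n.+1%:R^-1 x)%:E)
  (fun x => (g x * \1_`]a, b] x)%:E) (fun x => (`|(g \_ `[a, b + 1]) x|)%:E).
- by move=> n; apply/measurable_EFinP; apply: measurable_funM => //; exact: mcut.
- by apply/measurable_EFinP; apply: measurable_funM.
- apply/aeW => x _; apply: cvg_EFin; first exact: nearW.
  change ((g x * cutoff a b n.+1%:R^-1 x) @[n --> \oo] --> g x * \1_`]a, b] x).
  apply: cvgM; first exact: cvg_cst.
  rewrite [X in _ --> X](_ : _ = (a < x)%R%:R - (b < x)%R%:R); last first.
    rewrite indicE mem_setE/= in_itv/=; have [xa|xa] := leP x a.
      by rewrite ltNge (le_trans xa (ltW ab)) subrr.
    by have [xb|xb] := leP x b; rewrite ?subr0 ?subrr.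
  by apply: cvgB; exact: step_cvg.
- apply/aeW => x n _; rewrite lee_fin normrM patchE.
  have e1 : n.+1%:R^-1 <= 1 :> R by rewrite invf_le1// ler1n.
  have e0 : 0 < n.+1%:R^-1 :> R by [].
  case: ifPn => xab.
    rewrite ler_piMr// /cutoff ler_norml.
    have /andP[h1 h2] := step_bounds ((x - a) / n.+1%:R^-1).
    have /andP[h3 h4] := step_bounds ((x - b) / n.+1%:R^-1).
    by apply/andP; split; lra.
  rewrite normr0 (_ : cutoff a b n.+1%:R^-1 x = 0) ?normr0 ?mulr0//.
  apply: cutoff_support => //; move: xab; rewrite notin_setE/=; apply: contra_not.
  by rewrite !in_itv/= => /andP[-> h]; rewrite (le_trans h)// lerD2l.
by apply.
Qed.

End cutoff.

Section weak_derivative_facts.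
Context {R : realType}.
Local Notation mu := (@lebesgue_measure R).
Implicit Types (u g : R -> R) (a b x : R).

(** Test against [cutoff a b e]: its derivative is the difference of mollifiers at [a]
    and [b], which recovers the values of [u] at Lebesgue points, while the cutoff
    itself tends to the indicator of [`]a, b]]. *)
Lemma weak_derivative_increment u g a b : is_weak_derivative u g ->
  lebesgue_pt u a -> lebesgue_pt u b -> a < b ->
  ((u b - u a)%:E = \int[mu]_(x in `]a, b]) (g x)%:E)%E.
Proof.
move=> [lu lg ug] la lb ab; have [k [K [sk dk ck kK k0]]] := @step_derivative R.
have h1 := mollifier_cvg dk ck kK k0 lu la.
have h2 := mollifier_cvg dk ck kK k0 lu lb.
have h3 := cutoff_cvg dk lg ab.
have h4 : (\int[mu]_x (u x * mollifier k a n.+1%:R^-1 x)%:E -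
    \int[mu]_x (u x * mollifier k b n.+1%:R^-1 x)%:E)%E @[n --> \oo] -->
    ((u a)%:E - (u b)%:E)%E by exact: cvgeB.
have E n : (\int[mu]_x (u x * mollifier k a n.+1%:R^-1 x)%:E -
    \int[mu]_x (u x * mollifier k b n.+1%:R^-1 x)%:E =
    - \int[mu]_x (g x * cutoff a b n.+1%:R^-1 x)%:E)%E.
  rewrite -ug; last exact: cutoff_test.
  rewrite -integralB//; last 2 first.
  - exact: (mollifier_integrable ck kK k0).
  - exact: (mollifier_integrable ck kK k0).
  apply: eq_integral => x _; rewrite -EFinB -mulrBr; congr (_ * _)%:E.
  by rewrite derive1E; case: (is_derive_cutoff dk a b n.+1%:R^-1 x).
have h5 : (\int[mu]_x (u x * mollifier k a n.+1%:R^-1 x)%:E -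
    \int[mu]_x (u x * mollifier k b n.+1%:R^-1 x)%:E)%E @[n --> \oo] -->
    (- \int[mu]_(x in `]a, b]) (g x)%:E)%E.
  by rewrite (eq_cvg _ _ E); apply: cvgeN; exact: h3.
have := cvg_unique (@ereal_hausdorff R) h4 h5.
move=> h; rewrite -(opprB (u a)) EFinN EFinB h oppeK//.
Qed.

End weak_derivative_facts.

(** * Primitives and uniqueness of the weak derivative *)

Section primitives.
Context {R : realType}.
Local Notation mu := (@lebesgue_measure R).
Implicit Types (u v g : R -> R) (a b c x y : R).

Lemma aeS (P Q : R -> Prop) : (forall x, P x -> Q x) ->
  {ae mu, forall x, P x} -> {ae mu, forall x, Q x}.
Proof. by move=> PQ; apply: filterS => //; exact: (ae_filter_ringOfSetsType mu). Qed.

Lemma aeS2 (P Q S : R -> Prop) : (forall x, P x -> Q x -> S x) ->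
  {ae mu, forall x, P x} -> {ae mu, forall x, Q x} -> {ae mu, forall x, S x}.
Proof. by move=> PQ; apply: filterS2 => //; exact: (ae_filter_ringOfSetsType mu). Qed.

Lemma aeS3 (P Q S T : R -> Prop) : (forall x, P x -> Q x -> S x -> T x) ->
  {ae mu, forall x, P x} -> {ae mu, forall x, Q x} -> {ae mu, forall x, S x} ->
  {ae mu, forall x, T x}.
Proof. by move=> PQ; apply: filterS3 => //; exact: (ae_filter_ringOfSetsType mu). Qed.

Lemma lebesgue_measure_oc a b : a <= b ->
  (lebesgue_measure (`]a, b]%classic : set R) = (b - a)%:E)%E.
Proof.
rewrite le_eqVlt => /predU1P[->|ab]; rewrite lebesgue_measure_itv/= lte_fin.
  by rewrite ltxx subrr.
by rewrite ab EFinB.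
Qed.

Lemma ae_exists_itv (P : R -> Prop) a b : {ae mu, forall x, P x} -> a < b ->
  exists x, [/\ a < x, x < b & P x].
Proof.
move=> [N [mN N0 PN]] ab; apply: contrapT => noP.
have : `]a, b[%classic `<=` N.
  move=> x; rewrite /= in_itv/= => /andP[ax xb]; apply: PN => /= Px.
  by apply: noP; exists x.
move=> abN; have h : (lebesgue_measure (`]a, b[%classic : set R) <= 0)%E.
  by rewrite -[leRHS]N0; apply: le_measure => //; rewrite inE//.
by move: h; rewrite lebesgue_measure_itv/= lte_fin ab -EFinB lee_fin leNgt subr_gt0 ab.
Qed.

(** The difference of increments vanishes at points arbitrarily close to [x], which
    forces its derivative to vanish. *)
Lemma derive_ae_unique (h k : R -> R) x (d d' : R) : is_derive x 1 h d -> is_derive x 1 k d' ->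
  {ae mu, forall y, x < y -> h y - h x = k y - k x} -> d = d'.
Proof.
move=> dh dk hk; apply/eqP; rewrite -subr_eq0 -normr_le0 leNgt; apply/negP => e0.
have dhk := is_deriveB dh dk.
have [r r0 hr] := is_derive_approx dhk (divr_gt0 e0 (ltr0Sn R 1)).
have [|y [xy yxr]] := ae_exists_itv (a := x) (b := x + r) hk; first by rewrite ltrDl.
have yx0 : 0 < y - x by rewrite subr_gt0.
move=> /(_ xy) hky; have := hr y; rewrite (gtr0_norm yx0) ltrBlDl => /(_ yxr).
have -> : (h - k) y - (h - k) x = 0.
  by change (h y - k y - (h x - k x) = 0); lra.
rewrite sub0r normrN normrM (gtr0_norm yx0) ler_pM2r//.
lra.
Qed.

Lemma locally_integrable_oc g a b : locally_integrable setT g ->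
  mu.-integrable `]a, b] (EFin \o g).
Proof.
move=> lg; apply: integrableS (locally_integrable_itv a b lg) => //.
by apply: subset_itvr; rewrite bnd_simp.
Qed.

Lemma Rintegral_oc_cat g a b c : locally_integrable setT g -> a <= b -> b <= c ->
  \int[mu]_(t in `]a, c]) g t =
  \int[mu]_(t in `]a, b]) g t + \int[mu]_(t in `]b, c]) g t.
Proof.
move=> lg ab bc; apply/eqP; rewrite addrC -subr_eq; apply/eqP.
by rewrite Rintegral_itvB ?bnd_simp//; exact: locally_integrable_oc.
Qed.

Lemma weak_derivative_Rincrement u g a b : is_weak_derivative u g ->
  lebesgue_pt u a -> lebesgue_pt u b -> a < b ->
  u b - u a = \int[mu]_(x in `]a, b]) g x.
Proof. by move=> ug la lb ab; rewrite /Rintegral -(weak_derivative_increment ug la lb ab). Qed.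

Lemma is_derive_primitive g x : locally_integrable setT g -> lebesgue_pt g x ->
  is_derive x 1 (fun y => \int[mu]_(t in `]x - 1, y]) g t) (g x).
Proof.
move=> lg lx; have xx1 : x < x + 1 by rewrite ltrDl.
have [||dg gE] := FTC1_lebesgue_pt (a := BRight (x - 1)) xx1 _ _ lx.
- exact: locally_integrable_oc.
- by change (x - 1 < x); rewrite ltrBlDr ltrDl.
exact: DeriveDef dg (etrans (esym (derive1E _ _)) gE).
Qed.

(** At a common Lebesgue point both are derivatives of the increments of [u]. *)
Lemma weak_derivative_ae_unique u g1 g2 : is_weak_derivative u g1 ->
  is_weak_derivative u g2 -> {ae mu, forall x, g1 x = g2 x}.
Proof.
move=> ug1 ug2; have [lu lg1 _] := ug1; have [_ lg2 _] := ug2.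
have aeu := lebesgue_differentiation lu.
apply: (aeS3 _ aeu (lebesgue_differentiation lg1) (lebesgue_differentiation lg2)).
move=> x ux g1x g2x.
apply: (derive_ae_unique (is_derive_primitive lg1 g1x) (is_derive_primitive lg2 g2x)).
apply: aeS aeu => y uy xy.
have x1 : x - 1 <= x by rewrite gerBl.
rewrite (Rintegral_oc_cat lg1 x1 (ltW xy)) (Rintegral_oc_cat lg2 x1 (ltW xy)).
have addKsub (p r : R) : p + r - p = r by rewrite addrAC subrr add0r.
rewrite !addKsub.
by rewrite -(weak_derivative_Rincrement ug1)// -(weak_derivative_Rincrement ug2).
Qed.

Lemma weak_derivativeP u : weakly_differentiable u ->
  is_weak_derivative u (weak_derivative u).
Proof. by move=> [g ug]; rewrite /weak_derivative; case: xgetP => [_ ->//|/(_ g)]. Qed.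

Lemma integrable_locally_integrable g : mu.-integrable setT (EFin \o g) ->
  locally_integrable setT g.
Proof. by move=> ig; apply: open_integrable_locally => //; exact: openT. Qed.

Lemma Rintegral_subset_norm g (A : set R) : mu.-integrable setT (EFin \o g) ->
  measurable A -> \int[mu]_(t in A) `|g t| <= \int[mu]_t `|g t|.
Proof.
move=> ig mA; have ing : mu.-integrable setT (EFin \o (fun t => `|g t|)).
  exact: integrable_norm ig.
rewrite -lee_fin /Rintegral !fineK; last 2 first.
- exact: integrable_fin_num.
- by apply: integrable_fin_num => //; exact: integrableS ing.
by apply: ge0_subset_integral => //; exact: measurable_int ing.
Qed.

Lemma primitive_continuous g : mu.-integrable setT (EFin \o g) ->
  continuous (fun x => \int[mu]_(t in `]-oo, x]) g t).
Proof.
move=> ig; have diff a b : a <= b -> \int[mu]_(t in `]-oo, b]) g t -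
    \int[mu]_(t in `]-oo, a]) g t = \int[mu]_(t in `]a, b]) g t.
  move=> ab; rewrite Rintegral_itvB ?bnd_simp//.
  exact: integrableS ig.
move=> x; apply/cvgrPdist_lt => e e0.
have [r [r0 hr]] := integral_normr_continuous ig e0.
exists r => //= y; rewrite /ball_/=.
wlog xy : x y / x <= y.
  move=> h; have [|/ltW yx] := leP x y; first exact: h.
  by move=> xyr; rewrite distrC; apply: h => //; rewrite distrC.
rewrite distrC ger0_norm ?subr_ge0// => yxr.
rewrite distrC diff//; apply: le_lt_trans (hr `]x, y]%classic _ _) => //.
  by apply: le_normr_Rintegral => //; exact: integrableS ig.
by change (lebesgue_measure (`]x, y]%classic : set R) < r%:E)%E; rewrite lebesgue_measure_oc.
Qed.

End primitives.

(** * The continuous representative *)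

Section test_functions.
Context {R : realType}.
Local Notation mu := (@lebesgue_measure R).

Lemma test_function_bounded (phi : R -> R) : test_function phi ->
  exists A C : R, [/\ continuous phi, continuous (derive1 phi),
    forall x : R, is_derive x 1 phi (derive1 phi x),
    forall x, `|phi x| <= C /\ `|derive1 phi x| <= C &
    forall x, ~ `[- A, A]%classic x -> phi x = 0 /\ derive1 phi x = 0].
Proof.
move=> [sphi cphi].
have dphi (x : R) : is_derive x 1 phi (derive1 phi x).
  by apply: DeriveDef; [exact: (sphi 0%N)|rewrite derive1E].
have c0 : continuous phi by move=> x; exact: is_derive_continuous (dphi x).
have c1 : continuous (derive1 phi).
  by move=> x; apply: differentiable_continuous; apply/derivable1_diffP; exact: (sphi 1%N x).
have /ex_strict_bound_gt0[A A0 hA] := compact_bounded cphi.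
have z0 x : A <= `|x| -> phi x = 0.
  move=> Ax; apply/eqP; apply: contraT => px.
  by have := hA x (@subset_closure _ [set x | phi x != 0] x px); rewrite /= ltNge Ax.
have z x : A < `|x| -> phi x = 0 /\ derive1 phi x = 0.
  move=> Ax; split; first by rewrite z0// ltW.
  have : is_derive x 1 phi 0.
    apply: near_eq_is_derive (is_derive_cst 0 x 1).
    near=> y; rewrite z0//; near: y.
    have nx : `|y| @[y --> x] --> `|x| by exact: norm_continuous.
    have := cvgr_gt _ nx _ Ax.
    move=> H; near=> y; apply/ltW; near: y; exact: H.
  by move=> d0; rewrite derive1E; case: d0.
have bnd (h : R -> R) : continuous h -> (forall x, A < `|x| -> h x = 0) ->
    exists C, forall x, `|h x| <= C.
  move=> ch h0; have AA : - A <= A by lra.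
  have [c _ hc] := @EVT_max R (fun x => `|h x|) _ _ AA
    (continuous_subspaceT (fun x => cvg_norm (ch x))).
  exists `|h c| => x; have [xA|Ax] := leP `|x| A; last by rewrite h0 ?normr0.
  by apply: hc; rewrite in_itv/= -ler_norml.
have [C0 h0] := bnd phi c0 (fun x Ax => (z x Ax).1).
have [C1 h1] := bnd _ c1 (fun x Ax => (z x Ax).2).
exists A, (Num.max C0 C1); split => // x.
  by rewrite !le_max h0 h1 orbT.
rewrite /= in_itv/= -ler_norml => /negP; rewrite -ltNge; exact: z.
Unshelve. all: by end_near. Qed.

Lemma test_function_integrable (u phi : R -> R) : locally_integrable setT u ->
  test_function phi ->
  mu.-integrable setT (EFin \o (fun x => u x * phi x)) /\
  mu.-integrable setT (EFin \o (fun x => u x * derive1 phi x)).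
Proof.
move=> lu /test_function_bounded[A [C [c0 c1 _ hC hA]]]; split.
- apply: (locally_integrableM lu (C := C) (a := - A) (b := A)).
  + exact: continuous_measurable_fun.
  + by move=> x; exact: (hC x).1.
  + by move=> x /hA[].
- apply: (locally_integrableM lu (C := C) (a := - A) (b := A)).
  + exact: continuous_measurable_fun.
  + by move=> x; exact: (hC x).2.
  + by move=> x /hA[].
Qed.

Lemma is_weak_derivativeB (u1 u2 g1 g2 : R -> R) : is_weak_derivative u1 g1 ->
  is_weak_derivative u2 g2 -> is_weak_derivative (u1 \- u2) (g1 \- g2).
Proof.
move=> [lu1 lg1 h1] [lu2 lg2 h2]; split; [exact: locally_integrableB..|].
move=> phi tphi.
have [_ i1] := test_function_integrable lu1 tphi.
have [_ i2] := test_function_integrable lu2 tphi.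
have [i3 _] := test_function_integrable lg1 tphi.
have [i4 _] := test_function_integrable lg2 tphi.
under eq_integral do rewrite mulrBl EFinB.
under [in RHS]eq_integral do rewrite mulrBl EFinB.
rewrite !integralB// h1// h2// oppeK oppeB//; last first.
exact: fin_num_adde_defr (integrable_fin_num _ i3).
Qed.

End test_functions.

Section W11_facts.
Context {R : realType}.
Local Notation mu := (@lebesgue_measure R).
Implicit Types f v : R -> R.

Lemma W11_integrable f : W11 f -> mu.-integrable setT (EFin \o f) /\
  mu.-integrable setT (EFin \o weak_derivative f).
Proof. by move=> [h1 _ h2]; split; apply/Lfun1_integrable. Qed.

Lemma W11_weak_derivative f : W11 f -> is_weak_derivative f (weak_derivative f).
Proof. by move=> [_ h _]; exact: weak_derivativeP. Qed.

(** The real line has infinite measure. *)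
Lemma ae_ge_not_integrable f (e : R) : 0 < e -> mu.-integrable setT (EFin \o f) ->
  ~ {ae mu, forall x, e <= `|f x|}.
Proof.
move=> e0 /integrableP[mf fi] fe; move: fi; apply/negP; rewrite -leNgt.
have <- : (\int[mu]_(x in setT) (cst e%:E x) = +oo)%E.
  rewrite integral_cst//.
  have -> : (lebesgue_measure_lebesgue_measure__canonical__measure_function_Measure R) setT = +oo%E.
    have := @lebesgue_measure_itv R `]-oo, +oo[; rewrite set_itvNyy => H.
    by transitivity (lebesgue_measure [set: R]) => //; rewrite H.
  by rewrite gt0_muley// lte_fin.
apply: ae_ge0_le_integral => //.
- by move=> x _; rewrite lee_fin ltW.
- exact: measurableT_comp.
- by apply: aeS fe => x fx _; rewrite lee_fin.
Qed.

(** The representative is a primitive of the weak derivative.  Being integrable, it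
    takes arbitrarily small values, and this makes its oscillation a bound for its
    absolute value. *)
Lemma W11_continuous_representative f : W11 f -> exists v,
  [/\ continuous v, {ae mu, forall x, f x = v x},
    forall a b, a <= b ->
      `|v b - v a| <= \int[mu]_(t in `]a, b]) `|weak_derivative f t| &
    forall x, `|v x| <= \int[mu]_t `|weak_derivative f t|].
Proof.
move=> Wf; have [fi gi] := W11_integrable Wf; have fg := W11_weak_derivative Wf.
set g := weak_derivative f in gi fg *.
have [lf lg _] := fg; have aef := lebesgue_differentiation lf.
have [a0 [_ _ la0]] := ae_exists_itv aef (@ltr01 R).
pose G x := \int[mu]_(t in `]-oo, x]) g t.
have GB a b : a <= b -> G b - G a = \int[mu]_(t in `]a, b]) g t.
  by move=> ab; rewrite /G Rintegral_itvB ?bnd_simp//; exact: integrableS gi.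
pose v x := f a0 - G a0 + G x.
have fv : {ae mu, forall x, f x = v x}.
  apply: aeS aef => x lx; rewrite /v; have [xa|xa|->] := ltgtP x a0; last by ring.
  - have := GB _ _ (ltW xa); rewrite -(weak_derivative_Rincrement fg lx la0 xa).
    by move=> h; lra.
  - have := GB _ _ (ltW xa); rewrite -(weak_derivative_Rincrement fg la0 lx xa).
    by move=> h; lra.
have vab a b : a <= b -> `|v b - v a| <= \int[mu]_(t in `]a, b]) `|g t|.
  move=> ab; have -> : v b - v a = G b - G a by rewrite /v; ring.
  by rewrite GB//; apply: le_normr_Rintegral => //; exact: integrableS gi.
have vxy x y : `|v x| <= `|v y| + \int[mu]_t `|g t|.
  have h : `|v x - v y| <= \int[mu]_t `|g t|.
    have [xy|/ltW xy] := leP x y; [rewrite distrC|];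
    by apply: le_trans (vab _ _ xy) _; apply: Rintegral_subset_norm.
  by have := ler_normD (v x - v y) (v y); rewrite subrK; lra.
exists v; split => //.
  move=> x; apply: cvgD; first exact: cvg_cst.
  exact: primitive_continuous.
move=> x; apply/ler_addgt0Pr => e e0.
have [y vy] : exists y, `|v y| < e.
  apply: contrapT => noy; apply: (ae_ge_not_integrable e0 fi).
  apply: aeS fv => y ->; rewrite leNgt; apply/negP => vy; apply: noy.
  by exists y.
by have := vxy x y; lra.
Qed.

Lemma continuous_ae_eq v1 v2 : continuous v1 -> continuous v2 ->
  {ae mu, forall x, v1 x = v2 x} -> v1 = v2.
Proof.
move=> c1 c2 h; apply/funext => x; apply/eqP; rewrite -subr_eq0 -normr_le0 leNgt.
apply/negP => e0.
have c : {for x, continuous (fun y => v1 y - v2 y)} by apply: cvgB; [exact: c1|exact: c2].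
move/cvgrPdist_lt : c => /(_ _ e0)[r /= r0 hr].
have [|y [xy yx /eqP]] := ae_exists_itv (a := x) (b := x + r) h; first by rewrite ltrDl.
rewrite -subr_eq0 => /eqP h0.
have := hr y; rewrite /ball_/= h0 subr0 ltxx => H.
by have : false by apply: H; rewrite distrC gtr0_norm ?subr_gt0// ltrBlDl.
Qed.

End W11_facts.

(** * Densities of Lipschitz functions *)

(** Restricting [nu] to [D] makes it finite, which is what the Radon-Nikodym theorem
    needs. *)
Lemma radon_nikodym_within d (T : measurableType d) (R : realType)
    (mu : {sigma_finite_measure set T -> \bar R}) (nu : {measure set T -> \bar R})
    (D : set T) : measurable D -> (nu D < +oo)%E ->
  (forall A, measurable A -> mu A = 0%E -> nu A = 0%E) ->
  exists f : T -> \bar R, [/\ forall x, f x \is a fin_num, mu.-integrable setT f &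
    forall A, measurable A -> A `<=` D -> (nu A = \int[mu]_(x in A) f x)%E].
Proof.
move=> mD Doo numu; pose nuD := mfrestr mD Doo.
have dom : nuD `<< mu.
  apply/null_content_dominatesP => A mA A0.
  apply/eqP; rewrite eq_le measure_ge0 andbT -(numu _ mA A0).
  by apply: le_measure; rewrite ?inE//; exact: measurableI.
have [f [_ ffin fi fE]] := radon_nikodym_sigma_finite dom.
exists f; split => // A mA AD.
by rewrite -(fE _ mA)/= /mfrestr /mrestr (setIidl AD).
Qed.

Section lipschitz_primitive.
Context {R : realType}.
Local Notation mu := (@lebesgue_measure R).
Implicit Types (g : R -> R).

Lemma lebesgue_stieltjes_oc (G : cumulative R R) (a b : R) : a <= b ->
  lebesgue_stieltjes_measure G `]a, b]%classic = (G b - G a)%:E.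
Proof.
move=> ab; rewrite /lebesgue_stieltjes_measure /measure_extension/= measurable_mu_extE/=.
  exact: wlength_itv_bnd.
exact: is_ocitv.
Qed.

(** [x/2 + g] and [x/2 - g] are nondecreasing with sum [x], so their Stieltjes measures
    add up to Lebesgue measure and each is absolutely continuous; [g] then has the
    density of the first minus 1/2. *)
Lemma half_lipschitz_density g (A : R) : 0 <= A ->
  (forall x y, x <= y -> `|g y - g x| <= (y - x) / 2) ->
  exists2 rho : R -> R, mu.-integrable setT (EFin \o rho) &
    forall a b, - A <= a -> a <= b -> b <= A ->
      g b - g a = \int[mu]_(t in `]a, b]) rho t.
Proof.
move=> A0 glip.
have gcont : continuous g.
  move=> x; apply/cvgrPdist_lt => e e0; exists e => //= y; rewrite /ball_/= => xye.
  have [xy|/ltW yx] := leP x y.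
    rewrite distrC; apply: le_lt_trans (glip _ _ xy) _.
    by move: xye; rewrite distrC ger0_norm ?subr_ge0//; lra.
  by apply: le_lt_trans (glip _ _ yx) _; move: xye; rewrite ger0_norm ?subr_ge0//; lra.
pose G x := x / 2 + g x; pose H x := x / 2 - g x.
have cid : continuous (fun x : R => x / 2) by move=> x; apply: cvgM; [exact: cvg_id|exact: cvg_cst].
have Gnd : {homo G : x y / x <= y}.
  by move=> x y xy; have := glip _ _ xy; rewrite ler_norml /G => /andP[]; lra.
have Hnd : {homo H : x y / x <= y}.
  by move=> x y xy; have := glip _ _ xy; rewrite ler_norml /H => /andP[]; lra.
have Grc : right_continuous G.
  by apply: right_continuousW => x; apply: cvgD; [exact: cid|exact: gcont].
have Hrc : right_continuous H.
  by apply: right_continuousW => x; apply: cvgB; [exact: cid|exact: gcont].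
pose Gc : cumulative R R := HB.pack G (isCumulative.Build R _ R G Gnd Grc).
pose Hc : cumulative R R := HB.pack H (isCumulative.Build R _ R H Hnd Hrc).
pose mG : {measure set _ -> \bar R} := lebesgue_stieltjes_measure Gc.
pose mH : {measure set _ -> \bar R} := lebesgue_stieltjes_measure Hc.
have GHE B : measurable B -> mu B = measure_add mG mH B.
  move=> mB; apply: (@lebesgue_measure_unique R (measure_add mG mH)) => //.
  move=> _ [[a b] _ <-].
  change (mu `]a, b]%classic = measure_add mG mH `]a, b]%classic).
  have [ab|ba] := leP a b; last first.
    by rewrite set_itv_ge ?measure0// bnd_simp -leNgt ltW.
  rewrite measure_addE; transitivity ((b - a)%:E); first exact: lebesgue_measure_oc.
  transitivity ((G b - G a)%:E + (H b - H a)%:E)%E.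
    by rewrite -EFinD; congr EFin; rewrite /G /H; field.
  by congr (_ + _)%E; apply/esym; exact: lebesgue_stieltjes_oc.
pose DA : set R := `]- A, A]%classic.
have mGD : (mG DA < +oo)%E.
  have AA : - A <= A by lra.
  have h : mG DA = (G A - G (- A))%:E := lebesgue_stieltjes_oc Gc AA.
  by rewrite h ltry.
have GN0 N : measurable N -> mu N = 0%E -> mG N = 0%E.
  move=> mN N0; have N1 : (mG N + mH N = 0)%E by rewrite -measure_addE -GHE.
  by apply/eqP; rewrite eq_le measure_ge0 andbT -N1 leeDl// measure_ge0.
have [|rho [rhofin irho nuE]] := radon_nikodym_within _ mGD GN0.
  exact: measurable_itv.
pose rho1 x := fine (rho x); pose rho2 : R -> R := (cst 2^-1 : R -> R) \_ `[- A, A].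
have i1 : mu.-integrable setT (EFin \o rho1).
  by apply: eq_integrable irho => // x _; rewrite /rho1/= fineK.
have i2 : mu.-integrable setT (EFin \o rho2).
  by apply: locally_integrable_restrict; exact: locally_integrable_cst.
exists (fun x => rho1 x - rho2 x).
  by have := integrableB measurableT i1 i2.
move=> a b Aa ab bA.
have -> : g b - g a = (G b - G a) - 2^-1 * (b - a) by rewrite /G; field.
rewrite RintegralB//; [|exact: integrableS i1|exact: integrableS i2].
congr (_ - _).
  have abD (x : R) : `]a, b]%classic x -> `]- A, A]%classic x.
    by rewrite /= !in_itv/= => /andP[ax xb]; apply/andP; split; lra.
  have h : mG `]a, b]%classic = (G b - G a)%:E := lebesgue_stieltjes_oc Gc ab.
  have := nuE `]a, b]%classic (measurable_itv _) abD; rewrite h => hr.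
  rewrite /Rintegral (_ : (\int[mu]_(x in `]a, b]) (rho1 x)%:E)%E = (G b - G a)%:E)//.
  by rewrite hr; apply: eq_integral => x _; rewrite /rho1 fineK.
rewrite (@eq_Rintegral _ _ _ mu _ (cst 2^-1)); last first.
  move=> x; rewrite inE/= in_itv/= => /andP[ax xb].
  by rewrite /rho2 patchE mem_set//= in_itv/=; apply/andP; split; lra.
rewrite Rintegral_cst//; congr (_ * _).
by have /(congr1 fine)/= := lebesgue_measure_oc ab; move=> ->.
Qed.

(** Precompose with the projection onto [[-A,A]] and rescale to reach the constant 1/2. *)
Lemma lipschitz_density g (A K : R) : 0 <= A ->
  (forall x y, - A <= x -> x <= y -> y <= A -> `|g y - g x| <= K * (y - x)) ->
  exists2 rho : R -> R, mu.-integrable setT (EFin \o rho) &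
    forall a b, - A <= a -> a <= b -> b <= A ->
      g b - g a = \int[mu]_(t in `]a, b]) rho t.
Proof.
move=> A0 glip; pose k := `|K| + 1; pose c (x : R) := Num.max (- A) (Num.min x A).
have k0 : 0 < k by rewrite ltr_wpDl.
have cA x : - A <= c x /\ c x <= A.
  by rewrite /c; split; rewrite ?le_max ?lexx// ge_max ge_min lexx orbT andbT; lra.
have cE x : - A <= x -> x <= A -> c x = x.
  by move=> Ax xA; rewrite /c (min_idPl _)// (max_idPr _).
have clip x y : x <= y -> c x <= c y /\ c y - c x <= y - x.
  move=> xy; rewrite /c /Num.min /Num.max.
  by repeat case: ifP => //; move=> *; split; lra.
have [x y xy|rho irho rhoE] := @half_lipschitz_density (fun x => g (c x) / (2 * k)) A A0.
  have [cxy cle] := clip _ _ xy.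
  have h := glip _ _ (cA x).1 cxy (cA y).2.
  have K1 : K <= k by have := ler_norm K; rewrite /k; lra.
  rewrite -mulrBl normrM [X in _ * X]ger0_norm ?invr_ge0//; last by lra.
  rewrite ler_pdivrMr; last by lra.
  apply: (le_trans h); apply: (@le_trans _ _ (k * (y - x))); last by lra.
  apply: (@le_trans _ _ (k * (c y - c x))); first by apply: ler_wpM2r => //; lra.
  by apply: ler_wpM2l => //; exact: ltW.
exists (fun x => 2 * k * rho x).
  rewrite (_ : EFin \o _ = (fun x => (2 * k)%:E * (EFin \o rho) x)%E).
    by apply: integrableZl.
  by apply/funext => x /=; rewrite EFinM.
move=> a b Aa ab bA; rewrite RintegralZl//; last exact: integrableS irho.
rewrite -rhoE// !cE//; try lra.
by field; rewrite ?lt0r_neq0//.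
Qed.

Lemma density_is_derive g rho (A : R) : mu.-integrable setT (EFin \o rho) ->
  (forall a b, - A <= a -> a <= b -> b <= A ->
      g b - g a = \int[mu]_(t in `]a, b]) rho t) ->
  {ae mu, forall x : R, - A < x -> x < A -> is_derive x 1 g (rho x)}.
Proof.
move=> irho gE; have lrho := integrable_locally_integrable irho.
apply: aeS (lebesgue_differentiation lrho) => x px Ax xA.
have dI := is_derive_primitive lrho px.
pose J y : R := \int[mu]_(t in `]x - 1, y]) rho t + (g x - \int[mu]_(t in `]x - 1, x]) rho t).
have dJ : is_derive x 1 J (rho x) by apply: is_derive_eq; rewrite addr0.
apply: near_eq_is_derive dJ.
have alg1 (p r s : R) : p + r + (s - p) = r + s by ring.
have alg2 (p r s : R) : p + (s - (p + r)) = s - r by ring.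
near=> y.
have yA : - A < y by near: y; exact: lt_nbhsr.
have Ay : y < A by near: y; exact: lt_nbhsl.
have x1y : x - 1 < y by near: y; apply: lt_nbhsr; lra.
rewrite /J; have [xy|/ltW yx] := leP x y.
  rewrite (Rintegral_oc_cat (a := x - 1) (b := x) (c := y))// ?alg1.
    by rewrite -(gE x y) ?subrK// ltW.
  by rewrite lerBlDr lerDl.
rewrite (Rintegral_oc_cat (a := x - 1) (b := y) (c := x))// ?alg2; last exact: ltW.
by rewrite -(gE y x) ?subKr// ltW.
Unshelve. all: by end_near. Qed.

End lipschitz_primitive.

(** * Locally Lipschitz functions *)

Definition locally_lipschitz {R : realType} (U : R -> R) : Prop :=
  forall A : R, exists2 k, 0 <= k & forall x y : R, - A <= x -> x <= A ->
    - A <= y -> y <= A -> `|U x - U y| <= k * `|x - y|.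

Section locally_lipschitz.
Context {R : realType}.
Local Notation mu := (@lebesgue_measure R).
Implicit Types (U phi rho : R -> R).

Lemma locally_lipschitz_continuous U : locally_lipschitz U -> continuous U.
Proof.
move=> lU x; have [k k0 kU] := lU (`|x| + 1).
have k1 : 0 < k + 1 by lra.
apply/cvgrPdist_lt => e e0; near=> y.
have y1 : `|x - y| < 1 by near: y; exact: (@cvgr_dist_lt _ _ _ _ _ id x (@cvg_id _ _)).
have ye : `|x - y| < e / (k + 1).
  by near: y; apply: (@cvgr_dist_lt _ _ _ _ _ id x (@cvg_id _ _)); rewrite divr_gt0.
have xA : `|x| <= `|x| + 1 by lra.
have yA : `|y| <= `|x| + 1.
  by rewrite -[y](subrK x); have := ler_normD (y - x) x; rewrite distrC; lra.
move: xA yA; rewrite !ler_norml => /andP[? ?] /andP[? ?].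
apply: (@le_lt_trans _ _ (k * `|x - y|)); first exact: kU.
have := ye; rewrite ltr_pdivlMr// => h; apply: le_lt_trans h.
by rewrite mulrC; apply: ler_wpM2l => //; lra.
Unshelve. all: by end_near. Qed.

Lemma locally_lipschitz_mul_test U phi : locally_lipschitz U -> test_function phi ->
  locally_lipschitz (fun x => U x * phi x).
Proof.
move=> lU /test_function_bounded[B [C [c0 _ dphi hC _]]] A.
have [k k0 kU] := lU A; have C0 : 0 <= C by apply: le_trans (hC 0).1.
have philip x y : `|phi x - phi y| <= C * `|x - y|.
  wlog xy : x y / x < y => [hw|].
    case: (ltgtP x y) => [/hw//|/hw|->]; last by rewrite !subrr normr0 mulr0.
    by rewrite distrC [`|x - y|]distrC.
  have [c _ h] := derive_MVT dphi xy.
  rewrite distrC [`|x - y|]distrC h normrM; apply: ler_wpM2r => //; exact: (hC c).2.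
have UB x : - A <= x -> x <= A -> `|U x| <= `|U 0| + k * A.
  move=> Ax xA; rewrite -[U x](subrK (U 0)); apply: (le_trans (ler_normD _ _)).
  rewrite addrC lerD2l; apply: (@le_trans _ _ (k * `|x - 0|)).
    by apply: kU => //; lra.
  by apply: ler_wpM2l => //; rewrite subr0 ler_norml Ax.
exists (k * C + (`|U 0| + k * `|A|) * C) => [|x y Ax xA Ay yA].
  by rewrite addr_ge0// mulr_ge0// addr_ge0// mulr_ge0.
have -> : U x * phi x - U y * phi y = (U x - U y) * phi x + U y * (phi x - phi y).
  by ring.
apply: (le_trans (ler_normD _ _)); rewrite !normrM mulrDl; apply: lerD.
  rewrite mulrAC; apply: ler_pM => //; [exact: kU|exact: (hC x).1].
rewrite -mulrA; apply: ler_pM => //; apply: (le_trans (UB _ _ _)) => //.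
by rewrite lerD2l; apply: ler_wpM2l => //; exact: ler_norm.
Qed.

Lemma locally_lipschitz_density U (A : R) : 0 <= A -> locally_lipschitz U ->
  exists rho, [/\ mu.-integrable setT (EFin \o rho),
    {ae mu, forall x : R, - A < x -> x < A -> is_derive x 1 U (rho x)} &
    forall a b, - A <= a -> a <= b -> b <= A ->
      U b - U a = \int[mu]_(t in `]a, b]) rho t].
Proof.
move=> A0 /(_ A)[k k0 kU].
have [x y Ax xy yA|rho irho rhoE] := @lipschitz_density _ U A k A0.
  have := kU y x; rewrite [`|y - x|]ger0_norm ?subr_ge0//; apply; lra.
by exists rho; split => //; exact: density_is_derive.
Qed.

Definition right_quotient U (n : nat) (x : R) : R :=
  n.+1%:R * (U (x + n.+1%:R^-1) - U x).

(** A measurable function, defined everywhere, that equals the derivative wherever there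
    is one. *)
Definition upper_derivative U (x : R) : R :=
  fine (limn_esup (fun n => (right_quotient U n x)%:E)).

Lemma upper_derivativeE U (x d : R) : is_derive x 1 U d -> upper_derivative U x = d.
Proof.
move=> dU; rewrite /upper_derivative.
suff h : (right_quotient U n x)%:E @[n --> \oo] --> d%:E by rewrite (cvg_limn_einf_sup h).2.
apply: cvg_EFin; first by near=> n.
apply/cvgrPdist_le => e e0; have [r r0 hr] := is_derive_approx dU e0.
near=> n; have n0 : 0 < (n.+1%:R : R) by [].
have nr : (n.+1%:R : R)^-1 < r.
  near: n; exact: near_infty_natSinv_lt (PosNum r0).
have := hr (x + n.+1%:R^-1); rewrite addrAC subrr add0r ger0_norm ?invr_ge0 ?ler0n// => /(_ nr) h.
rewrite distrC (_ : right_quotient U n x - d =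
  n.+1%:R * (U (x + n.+1%:R^-1) - U x - d * n.+1%:R^-1)); last first.
  by rewrite /right_quotient; field; rewrite lt0r_neq0.
rewrite normrM ger0_norm ?ler0n// mulrC -ler_pdivlMr//.
Unshelve. all: by end_near. Qed.

Lemma upper_derivative_measurable U : continuous U ->
  measurable_fun setT (upper_derivative U).
Proof.
move=> cU; apply: (measurableT_comp (@fine_measurable R setT measurableT)).
apply: measurable_fun_limn_esup => n; apply/measurable_EFinP.
apply: measurable_funM; first exact: measurable_cst.
apply: measurable_funB; apply: continuous_measurable_fun => //.
move=> x; apply: (@continuous_comp R R R (fun y : R => y + n.+1%:R^-1) U x _ (cU _)).
by apply: cvgD; [exact: cvg_id|exact: cvg_cst].
Qed.

Lemma locally_lipschitz_is_derive U : locally_lipschitz U ->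
  {ae mu, forall x : R, is_derive x 1 U (upper_derivative U x)}.
Proof.
move=> lU.
have : {ae mu, forall x : R, forall n : nat, `|x| < n%:R ->
    is_derive x 1 U (upper_derivative U x)}.
  apply: ae_foralln => n.
  have [rho [_ drho _]] := locally_lipschitz_density (ler0n R n) lU.
  apply: aeS drho => x h; rewrite ltr_norml => /andP[nx xn].
  by have d := h nx xn; rewrite (upper_derivativeE d).
apply: aeS => x h; have [n xn] : exists n : nat, `|x| < n%:R.
  by exists (Num.truncn `|x|).+1; exact: truncnS_gt.
exact: h xn.
Qed.

Lemma upper_derivative_locally_integrable U : locally_lipschitz U ->
  locally_integrable setT (upper_derivative U).
Proof.
move=> lU; have cU := locally_lipschitz_continuous lU.
have mU := upper_derivative_measurable cU.
split => //; first exact: openT.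
move=> K _ cK; have mK : measurable K.
  by apply: closed_measurable; apply: compact_closed.
have [A A0 hA] := ex_strict_bound_gt0 (compact_bounded cK).
have [rho [irho drho _]] := locally_lipschitz_density (ltW A0) lU.
rewrite (@ae_eq_integral _ _ _ mu K (fun x => `|(EFin \o rho) x|%E))//.
- have irK : mu.-integrable K (EFin \o rho) by exact: integrableS irho.
  by have /integrableP[] := irK.
- by apply/measurable_EFinP; apply: measurableT_comp => //; exact: measurable_funTS.
- apply: measurableT_comp => //; apply: measurable_funTS.
  by have /integrableP[] := irho.
apply: (aeS _ drho) => x h Kx /=; have := hA x Kx; rewrite /= ltr_norml => /andP[Ax xA].
by rewrite (upper_derivativeE (h Ax xA)).
Qed.

Lemma continuous_locally_integrable U : continuous U -> locally_integrable setT U.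
Proof.
move=> cU; split; [exact: continuous_measurable_fun|exact: openT|].
move=> K _ cK; have iU : mu.-integrable K (EFin \o U).
  by apply: continuous_compact_integrable => //; exact: continuous_subspaceT.
by have /integrableP[] := iU.
Qed.

(** For a test function [phi], the product [U phi] is locally Lipschitz with compact
    support, so the integral of its derivative over an interval containing the support
    is 0. *)
Lemma locally_lipschitz_weak_derivative U : locally_lipschitz U ->
  is_weak_derivative U (upper_derivative U).
Proof.
move=> lU; have cU := locally_lipschitz_continuous lU.
have liU := continuous_locally_integrable cU.
have lid := upper_derivative_locally_integrable lU.
split => // phi tphi.
have [_ i1] := test_function_integrable liU tphi.
have [i2 _] := test_function_integrable lid tphi.
have [A [C [_ _ dphi _ phi0]]] := test_function_bounded tphi.
(* differentiability is only available inside an interval, so the densities are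
   taken on the larger interval [-(B + 1), B + 1] *)
pose B := `|A| + 1; have AB : A < B by rewrite /B; have := ler_norm A; lra.
have B0 : 0 <= B by rewrite /B; have := normr_ge0 A; lra.
have B10 : 0 <= B + 1 by lra.
have lV := locally_lipschitz_mul_test lU tphi.
have [s [js ds sE]] := locally_lipschitz_density B10 lV.
have out (x : R) : ~ `]- B, B]%classic x -> phi x = 0 /\ derive1 phi x = 0.
  move=> Bx; apply: phi0 => Ax; apply: Bx; move: Ax; rewrite /= !in_itv/= => /andP[? ?].
  by apply/andP; split; lra.
pose D : set R := `]- B, B]%classic.
pose k x := U x * derive1 phi x + upper_derivative U x * phi x.
have ik : mu.-integrable setT (EFin \o k) by exact: integrableD i1 i2.
have k0 : \int[mu]_x k x = 0.
  transitivity (\int[mu]_(x in D) s x).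
    rewrite /Rintegral; congr fine.
    transitivity (\int[mu]_(x in D) (k x)%:E)%E.
      rewrite [RHS]integral_mkcond; apply: eq_integral => x _; rewrite patchE.
      by case: ifPn => // /negP; rewrite inE => /out[p0 p1]; rewrite /k p0 p1 !mulr0 addr0.
    apply: ae_eq_integral => //.
    - exact: measurable_itv.
    - have /integrableP[+ _] := ik; exact: measurable_funTS.
    - have /integrableP[+ _] := js; exact: measurable_funTS.
    apply: (aeS2 _ ds (locally_lipschitz_is_derive lU)) => x hs hU.
    rewrite /D/= in_itv/= => /andP[Bx xB].
    have d1 : is_derive x 1 (fun x => U x * phi x) (s x) by apply: hs; lra.
    have d2 : is_derive x 1 (fun x => U x * phi x)
        (U x *: derive1 phi x + phi x *: upper_derivative U x).
      exact: is_deriveM hU (dphi x).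
    congr EFin; rewrite -(@derive_val _ _ _ _ _ _ _ d1) (@derive_val _ _ _ _ _ _ _ d2).
    by rewrite /k [phi x *: _]mulrC.
  rewrite /D -sE; [|lra..].
  have pB : phi B = 0 by apply: (phi0 B _).1; rewrite /= in_itv/= => /andP[_]; lra.
  have pNB : phi (- B) = 0 by apply: (phi0 (- B) _).1; rewrite /= in_itv/= => /andP[+ _]; lra.
  by rewrite pB pNB !mulr0 subrr.
have kE : (\int[mu]_x (k x)%:E = \int[mu]_x (U x * derive1 phi x)%:E +
    \int[mu]_x (upper_derivative U x * phi x)%:E)%E.
  by rewrite -integralD.
have f1 : (\int[mu]_x (U x * derive1 phi x)%:E)%E \is a fin_num.
  exact: integrable_fin_num i1.
have f2 : (\int[mu]_x (upper_derivative U x * phi x)%:E)%E \is a fin_num.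
  exact: integrable_fin_num i2.
move: k0; rewrite /Rintegral kE fineD// => /eqP; rewrite addr_eq0 => /eqP h.
by rewrite -(fineK f1) -(fineK f2) h.
Qed.

End locally_lipschitz.

(** * The maximal function of an integrable function *)

Definition mass {R : realType} (f : R -> R) (x : R) : R :=
  \int[lebesgue_measure]_(t in `]-oo, x]) `|f t|.

Section mass.
Context {R : realType}.
Local Notation mu := (@lebesgue_measure R).
Variables (beta : R).
Hypotheses (beta_gt0 : 0 < beta) (beta_lt1 : beta < 1).
Implicit Types (f v : R -> R) (a b x : R).

Lemma integrable_ae_eq f v : mu.-integrable setT (EFin \o f) ->
  measurable_fun setT v -> {ae mu, forall t, f t = v t} ->
  mu.-integrable setT (EFin \o v).
Proof.
move=> fi mv fv; have mf := measurable_int _ fi.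
apply/integrableP; split; first exact/measurable_EFinP.
have <- : (\int[mu]_x `|(EFin \o f) x| = \int[mu]_x `|(EFin \o v) x|)%E.
  apply: ae_eq_integral => //.
  - exact: measurableT_comp.
  - by apply: measurableT_comp => //; exact/measurable_EFinP.
  - by apply: (aeS _ fv) => t /= -> _.
by have /integrableP[] := fi.
Qed.

Lemma massB f a b : mu.-integrable setT (EFin \o f) -> a <= b ->
  mass f b - mass f a = \int[mu]_(t in `]a, b]) `|f t|.
Proof.
move=> fi ab; have nfi : mu.-integrable setT (EFin \o (fun t => `|f t|)).
  exact: integrable_norm fi.
rewrite /mass Rintegral_itvB ?bnd_simp//.
exact: integrableS nfi.
Qed.

Lemma mass_bounds f x : mu.-integrable setT (EFin \o f) ->
  0 <= mass f x <= \int[mu]_t `|f t|.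
Proof.
move=> fi; rewrite Rintegral_subset_norm// andbT.
by apply: Rintegral_ge0 => t _.
Qed.

Lemma massB_le f a b : mu.-integrable setT (EFin \o f) ->
  mass f b - mass f a <= \int[mu]_t `|f t|.
Proof.
move=> fi; have /andP[_ h1] := mass_bounds b fi; have /andP[h2 _] := mass_bounds a fi.
by rewrite lerBlDr; apply: (le_trans h1); rewrite lerDl.
Qed.

Lemma is_derive_mass f v x : mu.-integrable setT (EFin \o f) -> continuous v ->
  {ae mu, forall t, f t = v t} -> is_derive x 1 (mass f) `|v x|.
Proof.
move=> fi cv fv; have cnv : continuous (fun t => `|v t|).
  by move=> t; exact: cvg_norm (cv t).
have mf : measurable_fun setT f by apply/measurable_EFinP; exact: measurable_int fi.
have mv : measurable_fun setT v by exact: continuous_measurable_fun.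
have vi : mu.-integrable setT (EFin \o v).
  exact: (integrable_ae_eq fi mv fv).
have nvi : mu.-integrable setT (EFin \o (fun t => `|v t|)).
  exact: integrable_norm vi.
have -> : mass f = (fun y => \int[mu]_(t in `]-oo, y]) `|v t|).
  apply/funext => y; rewrite /mass /Rintegral; congr fine; apply: ae_eq_integral => //.
  - by apply/measurable_EFinP; apply: measurableT_comp => //; exact: measurable_funTS.
  - by apply/measurable_EFinP; apply: measurableT_comp => //; exact: measurable_funTS.
  - by apply: (aeS _ fv) => t /= -> _.
have x1 : x < x + 1 by lra.
have [] := @continuous_FTC1 R (fun t => `|v t|) -oo%O x (x + 1) x1 _ _ (cnv x).
- exact: integrableS nvi.
- by rewrite ltNyr.
- by move=> dm mE; exact: DeriveDef dm (etrans (esym (derive1E _ _)) mE).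
Qed.

(** For [L >= 1] use [w(L) <= 1], for [L <= 1] use [w(L) L = 2^-beta L^beta <= 1]. *)
Lemma frac_weight_mass (L d e : R) : 0 < L -> 0 <= d -> d <= e -> d <= e * L ->
  frac_weight beta L * d <= e.
Proof.
move=> L0 d0 de dL; have b0 := beta_gt0; have b1 := beta_lt1.
have e0 := le_trans d0 de.
have two1 : 2 `^ (- beta) <= 1 :> R by rewrite -[leRHS](powRr0 2); apply: ler_powR; [rewrite ler1n|lra].
have [L1|L1] := leP 1 L.
  apply: (@le_trans _ _ (1 * d)); last by rewrite mul1r.
  apply: ler_wpM2r => //; apply: (le_trans (frac_weight_le beta_lt1 ltr01 L1)).
  by rewrite /frac_weight powR1 mulr1.
apply: (@le_trans _ _ (frac_weight beta L * (e * L))).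
  by apply: ler_wpM2l => //; exact: frac_weight_ge0.
rewrite mulrCA frac_weightM// -[leRHS]mulr1; apply: ler_wpM2l => //.
apply: mulr_ile1 => //; rewrite ?powR_ge0//.
rewrite -(powRr0 L); apply: ger_powR; rewrite ?L0 ?ltW//.
Qed.

Lemma ball_averageE f z r : mu.-integrable setT (EFin \o f) -> 0 < r ->
  ((r `^ beta / (2 * r))%:E * \int[mu]_(y in `[(z - r)%R, (z + r)%R]) `|f y|%:E)%E =
  (frac_avg beta (mass f) (z - r) (z + r))%:E.
Proof.
move=> fi r0; have nfi : mu.-integrable setT (EFin \o (fun t => `|f t|)).
  exact: integrable_norm fi.
have zr : z - r <= z + r by lra.
rewrite /frac_avg massB// [RHS]EFinM; congr mule.
  by congr EFin; rewrite frac_weightE//; congr frac_weight; ring.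
rewrite /Rintegral fineK; last first.
  by apply: integrable_fin_num => //; exact: integrableS nfi.
rewrite -integral_itv_obnd_cbnd//.
have := measurable_int _ nfi; exact: measurable_funTS.
Qed.

(** Balls containing [x] are parametrized by their endpoints instead of centre and
    radius. *)
Lemma frac_maximalE f x : mu.-integrable setT (EFin \o f) ->
  frac_maximal beta f x = ereal_sup [set y | exists a b : R,
    [/\ a <= x, x <= b, a < b & y = (frac_avg beta (mass f) a b)%:E]].
Proof.
move=> fi; congr ereal_sup; apply/seteqP; split => y /=.
  move=> [z [r [r0 xzr ->]]]; exists (z - r), (z + r).
  by move: xzr; rewrite in_itv/= => /andP[zx xz]; split => //; [clear -r0; lra|exact: ball_averageE].
move=> [a [b [ax xb ab ->]]]; exists ((a + b) / 2), ((b - a) / 2); split; first by lra.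
  by rewrite in_itv/=; apply/andP; split; lra.
rewrite ball_averageE//; last by lra.
by congr (frac_avg _ _ _ _)%:E; field.
Qed.

End mass.

Section W11_maximal.
Context {R : realType}.
Local Notation mu := (@lebesgue_measure R).
Variables (beta : R).
Hypotheses (beta_gt0 : 0 < beta) (beta_lt1 : beta < 1).
Implicit Types (f v : R -> R).

Lemma frac_maximal_fin_num f v (m : R) (x : R) : mu.-integrable setT (EFin \o f) ->
  continuous v -> {ae mu, forall t, f t = v t} -> (forall t, `|v t| <= m) ->
  frac_maximal beta f x \is a fin_num.
Proof.
move=> fi cv fv vm; rewrite frac_maximalE//.
pose e := Num.max m (\int[mu]_t `|f t|).
have up a b : a < b -> frac_avg beta (mass f) a b <= e.
  move=> ab; have ab' := ltW ab.
  have d0 : 0 <= mass f b - mass f a.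
    by rewrite massB//; apply: Rintegral_ge0 => t _.
  apply: frac_weight_mass; rewrite ?subr_gt0//.
    by rewrite /e le_max massB_le ?orbT.
  have [c _ ->] := derive_MVT (fun x => is_derive_mass x fi cv fv) ab.
  apply: ler_wpM2r; first by rewrite subr_ge0.
  by rewrite /e le_max vm.
rewrite fin_numElt; apply/andP; split; last first.
  apply: (@le_lt_trans _ _ e%:E); last exact: ltry.
  by apply: ge_ereal_sup => _ [a [b [_ _ ab ->]]]; rewrite lee_fin up.
apply: (@lt_le_trans _ _ (frac_avg beta (mass f) x (x + 1))%:E); first exact: ltNyr.
by apply: ereal_sup_ubound; exists x, (x + 1); split => //; lra.
Qed.

Lemma W11_frac_max_data f v (m : R) : mu.-integrable setT (EFin \o f) ->
  continuous v -> {ae mu, forall t, f t = v t} -> (forall t, `|v t| <= m) ->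
  frac_max_data beta (mass f) (fun t => `|v t|) (frac_maximal_fun beta f) m
    (\int[mu]_t `|f t|).
Proof.
move=> fi cv fv vm; have ffin x := frac_maximal_fin_num x fi cv fv vm.
split => //.
- by move=> x; exact: (is_derive_mass x fi cv fv).
- by move=> t; exact: cvg_norm (cv t).
- by move=> a b; exact: massB_le.
- move=> x a b ax xb ab; rewrite -lee_fin /frac_maximal_fun fineK// frac_maximalE//.
  by apply: ereal_sup_ubound; exists a, b.
- move=> x e e0; have := ffin x; rewrite frac_maximalE// => sfin.
  have [_ [a [b [ax xb ab ->]]] h] := ub_ereal_sup_adherent e0 sfin.
  exists a, b; split => //; rewrite -lte_fin EFinB /frac_maximal_fun fineK//.
  by rewrite frac_maximalE.
Qed.

End W11_maximal.

(** * Regularity and stability of the maximal function *)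

Section frac_max_consequences.
Context {R : realType}.
Variables (beta : R) (F f M : R -> R) (m N : R).
Hypotheses (beta_gt0 : 0 < beta) (beta_lt1 : beta < 1).
Hypothesis D : frac_max_data beta F f M m N.
Implicit Types x y a b d e : R.
Local Notation w := (frac_weight beta).
Local Notation P := (frac_avg beta F).
Local Notation Q := (frac_slope beta f).

Lemma frac_max_eq0 x : (forall t, f t = 0) -> M x = 0.
Proof.
move=> f0; apply/eqP; rewrite eq_le (frac_max_ge0 D) andbT.
apply/ler_addgt0Pl => e e0; have [a [b [ax xb ab]]] := fmd_sup D x e0.
have [c _ FE] := derive_MVT (fmd_derive D) ab.
by rewrite /frac_avg FE f0 mul0r mulr0 addr0; lra.
Qed.

Lemma frac_max_locally_lipschitz : locally_lipschitz M.
Proof.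
move=> A; have [[x0 fx0]|nf] := pselect (exists x0, 0 < f x0).
  exact: (frac_max_lipschitz beta_gt0 beta_lt1 D A fx0).
have f0 t : f t = 0.
  apply/eqP; rewrite eq_le (fmd_ge0 D) andbT leNgt; apply/negP => ft; apply: nf.
  by exists t.
by exists 0 => // x y *; rewrite !frac_max_eq0// subrr normr0 mul0r.
Qed.

(** Where the nonnegative function [M] vanishes it has a minimum. *)
Lemma frac_max_gt0_of_slope x d : is_derive x 1 M d -> d != 0 -> 0 < M x.
Proof.
move=> dM; rewrite lt_neqAle (frac_max_ge0 D) andbT eq_sym; apply: contraNneq => Mx.
rewrite eq_sym; apply/eqP; apply: (@derive_at_min _ M x d (x - 1) (x + 1)) => //; try lra.
by move=> y _ _; rewrite -Mx (frac_max_ge0 D).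
Qed.

(** An optimal interval for the perturbed function is near-optimal for the original one,
    so [near_optimal_slope] controls its unperturbed slope; its length is bounded below,
    so the perturbed slope is close to that. *)
Lemma frac_max_stability x d e : 0 < M x -> is_derive x 1 M d -> 0 < e ->
  exists2 dlt, 0 < dlt & forall (F' f' M' : R -> R) (m' N' d' : R),
    frac_max_data beta F' f' M' m' N' ->
    (forall a b, a < b -> `|frac_avg beta F' a b - P a b| <= dlt) ->
    (forall t, `|f' t - f t| <= dlt) -> is_derive x 1 M' d' -> `|d' - d| < e.
Proof.
move=> Mx dM e0.
have opt a b : a <= x -> x <= b -> a < b -> P a b = M x -> Q a b = d.
  by move=> ax xb ab PE; apply/esym; exact: (frac_max_deriv D dM ax xb ab PE).
have e20 : 0 < e / 2 by lra.
have [r r0 hr] := near_optimal_slope beta_gt0 beta_lt1 D Mx opt e20.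
have M20 : 0 < M x / 2 by lra.
have [L1 L10 hL] := short_interval_small beta_gt0 D M20.
have wL := frac_weight_ge0 beta L1.
(* the three bounds serve, in this order, for near-optimality of the perturbed
   interval, for its length, and for the difference of its two slopes *)
pose dlt := Num.min (Num.min (r / 3) (M x / 4)) (e / (4 * (w L1 + 1))).
have d0 : 0 < dlt by rewrite !lt_min !divr_gt0//; lra.
have dr : dlt <= r / 3 by rewrite !ge_min lexx.
have dM4 : dlt <= M x / 4 by rewrite !ge_min lexx !orbT.
have de : dlt * (4 * (w L1 + 1)) <= e.
  by rewrite -ler_pdivlMr ?ge_min ?lexx ?orbT//; lra.
exists dlt => // F' f' M' m' N' d' D' PP ff dM'.
have MM : M x - dlt <= M' x.
  rewrite leNgt; apply/negP => h; have e'0 : 0 < M x - dlt - M' x by lra.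
  have [a [b [ax xb ab hP]]] := fmd_sup D x e'0.
  have := PP a b ab; rewrite ler_norml => /andP[h1 _].
  by have := fmd_ub D' ax xb ab; lra.
have M'x : 0 < M' x by lra.
have [a [b [ax xb ab PE]]] := optimal_interval beta_gt0 beta_lt1 D' M'x.
have -> := frac_max_deriv D' dM' ax xb ab PE.
have := PP a b ab; rewrite PE ler_norml => /andP[_ h2].
have hQ := hr a b ax xb ab; have {}/hQ hQ : M x - r < P a b by lra.
have Lab : L1 <= b - a by apply: hL => //; lra.
have wab : w (b - a) <= w L1 by exact: frac_weight_le.
have w0 := frac_weight_ge0 beta (b - a).
rewrite (_ : _ - d = w (b - a) * ((f' b - f b) - (f' a - f a)) + (Q a b - d)); last first.
  by rewrite /frac_slope; ring.
apply: (le_lt_trans (ler_normD _ _)); rewrite normrM (ger0_norm w0).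
have h3 : `|(f' b - f b) - (f' a - f a)| <= 2 * dlt.
  by apply: (le_trans (ler_normB _ _)); have := ff a; have := ff b; lra.
have h4 : w (b - a) * `|(f' b - f b) - (f' a - f a)| <= w L1 * (2 * dlt) by exact: ler_pM.
lra.
Qed.

End frac_max_consequences.

(** * The edge kernel *)

(** The loss between the two sides of the comparison in [edge_set]: a factor [eta^-beta]
    because [|t - x| >= eta L], and [1/(1-beta)] because [f t >= (1-beta) lam]. *)
Definition frac_kappa {R : realType} (beta : R) : R :=
  frac_eta beta `^ (- beta) / (1 - beta).

(** The pairs [(x,t)] that the witness of a slope at [x] can produce.  The last
    condition ranges over rational points only, so that the set is visibly measurable;
    by continuity of [M] it extends to the whole segment from [x] to [t]. *)
Definition edge_set {R : realType} (beta : R) (f M : R -> R) : set (R * R) :=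
  [set p | [/\ p.1 != p.2, 0 < f p.2,
    2 `^ (- beta) * `|p.2 - p.1| `^ beta * f p.2 <= M p.1,
    M p.1 <= frac_kappa beta * (2 `^ (- beta) * `|p.2 - p.1| `^ beta * f p.2) &
    forall th : rat, 0 <= th -> th <= 1 ->
      M p.1 <= M (p.1 + ratr th * (p.2 - p.1))]].

Definition edge_kernel {R : realType} (beta : R) (f M : R -> R) (p : R * R) : R :=
  \1_(edge_set beta f M) p / `|p.2 - p.1|.

Section edge_kernel.
Context {R : realType}.
Local Notation mu := (@lebesgue_measure R).
Local Notation RR := (g_sigma_algebraType (R.-ocitv.-measurable)).
Variables (beta : R) (f M : R -> R).
Hypotheses (beta_gt0 : 0 < beta) (beta_lt1 : beta < 1).
Hypotheses (cf : continuous f) (cM : continuous M).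
Implicit Types x y t : R.
Local Notation S := (edge_set beta f M).
Local Notation K := (edge_kernel beta f M).

Lemma measurable_le_set d (T : measurableType d) (h k : T -> R) :
  measurable_fun setT h -> measurable_fun setT k -> measurable [set x | h x <= k x].
Proof.
move=> mh mk; have := measurable_fun_ler mh mk measurableT (I : measurable [set true]).
by rewrite setTI.
Qed.

Lemma measurable_lt_set d (T : measurableType d) (h k : T -> R) :
  measurable_fun setT h -> measurable_fun setT k -> measurable [set x | h x < k x].
Proof.
move=> mh mk; have := measurable_fun_ltr mh mk measurableT (I : measurable [set true]).
by rewrite setTI.
Qed.

Lemma edge_set_measurable : measurable (S : set (RR * RR)).
Proof.
have m1 : measurable_fun setT (fst : RR * RR -> R) := measurable_fst.
have m2 : measurable_fun setT (snd : RR * RR -> R) := measurable_snd.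
have mM : measurable_fun setT M by exact: continuous_measurable_fun.
have mf : measurable_fun setT f by exact: continuous_measurable_fun.
have m21 : measurable_fun setT (fun p : RR * RR => (p.2 : R) - p.1) by exact: measurable_funB.
have m12 : measurable_fun setT (fun p : RR * RR => (p.1 : R) - p.2) by exact: measurable_funB.
have mM1 : measurable_fun setT (fun p : RR * RR => M p.1) by exact: measurableT_comp.
have mf2 : measurable_fun setT (fun p : RR * RR => f p.2) by exact: measurableT_comp.
have mB : measurable_fun setT (fun p : RR * RR =>
    2 `^ (- beta) * `|(p.2 : R) - p.1| `^ beta * f p.2).
  apply: measurable_funM => //; apply: measurable_funM => //.
  apply: (measurableT_comp (measurable_powR beta)).
  exact: measurableT_comp.
pose G (n : nat) : set (RR * RR) := if (unpickle n : option rat) is Some th then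
  if 0 <= th <= 1 then [set p | M p.1 <= M ((p.1 : R) + ratr th * ((p.2 : R) - p.1))]
  else setT else setT.
rewrite (_ : edge_set _ _ _ =
  ([set p : RR * RR | 0 < `|(p.2 : R) - p.1|] `&` [set p | 0 < f p.2]) `&`
  ([set p | 2 `^ (- beta) * `|(p.2 : R) - p.1| `^ beta * f p.2 <= M p.1] `&`
   [set p | M p.1 <= frac_kappa beta * (2 `^ (- beta) * `|(p.2 : R) - p.1| `^ beta * f p.2)])
  `&` \bigcap_n G n); last first.
  apply/seteqP; split => p.
    move=> [p12 fp h1 h2 h3]; split.
      by split; split => //=; rewrite normr_gt0 subr_eq0 eq_sym.
    move=> n _; rewrite /G; case: unpickle => // th; case: ifP => // /andP[th0 th1] /=.
    exact: h3.
  move=> [[[/= p12 fp] [/= h1 h2]] h3]; split => //=.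
    by rewrite eq_sym -subr_eq0 -normr_gt0.
  move=> th th0 th1; have := h3 (pickle th) I.
  by rewrite /G pickleK th0 th1.
apply: measurableI; first apply: measurableI; first apply: measurableI.
- by apply: measurable_lt_set => //; exact: measurableT_comp.
- exact: measurable_lt_set.
- apply: measurableI; apply: measurable_le_set => //.
  exact: measurable_funM.
apply: bigcapT_measurable => n; rewrite /G; case: unpickle => // th; case: ifP => // _.
apply: measurable_le_set => //; apply: (measurableT_comp mM).
by apply: measurable_funD => //; exact: measurable_funM.
Qed.

Lemma edge_kernel_ge0 p : 0 <= K p.
Proof. by rewrite /edge_kernel divr_ge0. Qed.

Lemma edge_kernel_measurable : measurable_fun setT (K : RR * RR -> R).
Proof.
have m1 : measurable_fun setT (fst : RR * RR -> R) := measurable_fst.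
have m2 : measurable_fun setT (snd : RR * RR -> R) := measurable_snd.
have m21 : measurable_fun setT (fun p : RR * RR => (p.2 : R) - p.1) by exact: measurable_funB.
apply: measurable_funM; first exact: (measurable_indic edge_set_measurable).
rewrite (_ : (fun _ => _) = (fun p : RR * RR => `|(p.2 : R) - p.1| `^ (-1))).
  by apply: (measurableT_comp (measurable_powR (-1))); exact: measurableT_comp.
by apply/funext => p; rewrite powR_inv1.
Qed.

(** The point [y] lies on the segment from [x] to [t], at parameter [1 - s]; rational
    parameters are dense. *)
Lemma edge_set_monotone x y t s : S (x, t) -> S (y, t) -> 0 < s -> s < 1 ->
  y - t = s * (x - t) -> M x <= M y.
Proof.
move=> [_ _ _ _ /= Mx] _ s0 s1 yE; rewrite leNgt; apply/negP => yx.
pose k (th : R) := M (x + th * (t - x)).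
have cin : continuous (fun th : R => x + th * (t - x)).
  move=> th; apply: cvgD; first exact: cvg_cst.
  by apply: cvgM; [exact: cvg_id|exact: cvg_cst].
have ck : continuous k by move=> th; apply: (cvg_comp _ _ (cin th)); exact: cM.
have k1s : k (1 - s) = M y.
  by rewrite /k; congr M; move: yE; rewrite mulrBl !mulrBr !mul1r => yE; lra.
have kx : k (1 - s) < M x by rewrite k1s.
have [r /= r0 hr] := cvgr_lt (k (1 - s)) (ck (1 - s)) _ kx.
pose r' := Num.min r (Num.min s (1 - s)).
have r'0 : 0 < r' by rewrite !lt_min r0 s0/= subr_gt0.
have rr : r' <= r by rewrite ge_min lexx.
have rs : r' <= s by rewrite !ge_min lexx !orbT.
have rs1 : r' <= 1 - s by rewrite !ge_min lexx !orbT.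
have [|q] := @rat_in_itvoo R (1 - s - r') (1 - s + r'); first by lra.
rewrite in_itv/= => /andP[q1 q2].
have q0 : 0 <= q by rewrite -(ler0q R); lra.
have q3 : q <= 1 by rewrite -(ler_rat R) rmorph1; lra.
have := hr (ratr q); rewrite /ball_/= => /(_ _).
rewrite /k => h; have := Mx q q0 q3; rewrite leNgt h//.
by rewrite ltr_norml; apply/andP; split; lra.
Qed.

Let kappa_ge0 : 0 <= frac_kappa beta.
Proof. by rewrite /frac_kappa divr_ge0 ?powR_ge0// subr_ge0 ltW. Qed.

Let rho := frac_kappa beta `^ beta^-1.

Let rho_le (a b ft : R) : 0 <= a -> 0 <= b -> 0 < ft ->
  2 `^ (- beta) * a `^ beta * ft <= frac_kappa beta * (2 `^ (- beta) * b `^ beta * ft) ->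
  a <= rho * b.
Proof.
move=> a0 b0 ft0 h; have bt0 := beta_gt0.
have c0 : 0 < 2 `^ (- beta) * ft by rewrite mulr_gt0// powR_gt0.
have h1 : a `^ beta <= frac_kappa beta * b `^ beta.
  rewrite -(ler_pM2l c0); apply: le_trans (le_trans h _); rewrite le_eqVlt; apply/orP; left.
    by apply/eqP; ring.
  by apply/eqP; ring.
rewrite leNgt; apply/negP => ba.
have : (rho * b) `^ beta < a `^ beta.
  by apply: gt0_ltr_powR => //; rewrite nnegrE// mulr_ge0// powR_ge0.
rewrite powRM// ?powR_ge0// /rho -powRrM mulVf ?powRr1 ?lt0r_neq0//.
by rewrite ltNge h1.
Qed.

(** If [y] is closer to [t] than [x], then [c |x-t|^beta f t <= M x <= M y <= kappa c
    |y-t|^beta f t], and [f t] cancels; otherwise the bounds at [x] alone give [1 <=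
    rho]. *)
Lemma edge_set_comparable x y t : S (x, t) -> S (y, t) -> 0 < (x - t) * (y - t) ->
  `|x - t| <= rho * `|y - t|.
Proof.
move=> Sx Sy xy.
have dx : 0 < `|x - t| by rewrite normr_gt0; apply: contraTneq xy => ->; rewrite mul0r ltxx.
have yE : y - t = `|y - t| / `|x - t| * (x - t).
  have [xt|xt|xt] := ltgtP 0 (x - t); last by move: dx; rewrite -xt normr0 ltxx.
    have yt : 0 < y - t by rewrite -(pmulr_rgt0 _ xt).
    by rewrite !gtr0_norm//; field; rewrite lt0r_neq0.
  have yt : y - t < 0 by rewrite -(nmulr_rgt0 _ xt).
  by rewrite !ltr0_norm//; field; rewrite ltr0_neq0.
case: (Sx) => /= _ ft h1 h2 _; case: (Sy) => /= _ _ _ h3 _.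
rewrite distrC in h1 h2; rewrite distrC in h3.
have [yx|xley] := ltP `|y - t| `|x - t|; last first.
  have := rho_le (normr_ge0 _) (normr_ge0 _) ft (le_trans h1 h2).
  by move/le_trans; apply; apply: ler_wpM2l => //; exact: powR_ge0.
apply: (rho_le (normr_ge0 _) (normr_ge0 _) ft); apply: (le_trans h1); apply: le_trans h3.
have [y0|y0] := eqVneq `|y - t| 0.
  by move: xy; rewrite (eqP (etrans (esym (normr_eq0 _)) (introT eqP y0))) mulr0 ltxx.
apply: (@edge_set_monotone x y t (`|y - t| / `|x - t|)) => //.
- by rewrite divr_gt0// lt_neqAle eq_sym y0/=.
- by rewrite ltr_pdivrMr ?mul1r.
Qed.

(** All of [B] lies within distance [rho d0] of [t], where [d0] is the distance from [t]
    to a point of [B], and the integrand is at most [rho / d0] there. *)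
Let slice_piece (B : set RR) t : measurable B -> (forall x, B x -> x != t) ->
  (forall x y, B x -> B y -> `|x - t| <= rho * `|y - t|) ->
  (\int[mu]_(x in B) (`|x - t|^-1)%:E <= (2 * rho ^+ 2)%:E)%E.
Proof.
move=> mB Bt Bcmp; have r0 : 0 <= rho by exact: powR_ge0.
have [[x0 Bx0]|B0] := pselect (exists x, B x); last first.
  rewrite (_ : B = set0) ?integral_set0 ?lee_fin ?mulr_ge0 ?exprn_ge0//.
  by apply/seteqP; split => x // Bx; case: B0; exists x.
pose d0 := `|x0 - t|; have d00 : 0 < d0 by rewrite normr_gt0 subr_eq0 Bt.
have minv : measurable_fun setT (fun x : RR => (`|(x : R) - t|^-1)%:E).
  apply/measurable_EFinP; rewrite (_ : (fun _ => _) = (fun x : RR => `|(x : R) - t| `^ (-1))).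
    apply: (measurableT_comp (measurable_powR (-1))); apply: measurableT_comp => //.
    by apply: measurable_funB => //; exact: measurable_cst.
  by apply/funext => x; rewrite powR_inv1.
have Bsub : B `<=` `[t - rho * d0, t + rho * d0]%classic.
  move=> x Bx; rewrite /= in_itv/=; have := Bcmp x x0 Bx Bx0.
  by rewrite ler_norml => /andP[? ?]; rewrite /d0; apply/andP; split; lra.
apply: (@le_trans _ _ (\int[mu]_(x in B) (cst (rho / d0)%:E x))%E).
  apply: ge0_le_integral => //.
  - exact: measurable_funTS.
  - move=> x Bx; rewrite lee_fin ler_pdivlMr// mulrC ler_pdivrMr ?normr_gt0 ?subr_eq0 ?Bt//.
    exact: Bcmp.
rewrite integral_cst//.
apply: (@le_trans _ _ ((rho / d0)%:E * (2 * rho * d0)%:E)%E).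
  apply: lee_pmul => //; first by rewrite lee_fin divr_ge0// ltW.
  apply: (@le_trans _ _ (mu `[t - rho * d0, t + rho * d0]%classic)).
    by apply: le_measure; rewrite ?inE//; exact: measurable_itv.
  change (lebesgue_measure (`[(t - rho * d0)%R, (t + rho * d0)%R]%classic : set R) <= (2 * rho * d0)%:E)%E.
  have rd0 : 0 <= rho * d0 by rewrite mulr_ge0// ltW.
  rewrite lebesgue_measure_itv/=; case: ifPn => _; last by rewrite lee_fin; lra.
  by rewrite -EFinB lee_fin; lra.
by rewrite -EFinM lee_fin le_eqVlt; apply/orP; left; apply/eqP; field; rewrite lt0r_neq0.
Qed.

Lemma edge_kernel_slice t :
  (\int[mu]_x (K (x, t))%:E <= (4 * rho ^+ 2)%:E)%E.
Proof.
pose L : set RR := [set x | S (x, t) /\ (x : R) < t].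
pose G : set RR := [set x | S (x, t) /\ t < (x : R)].
have mSt : measurable [set x : RR | S (x, t)].
  have := pair2_measurable t measurableT edge_set_measurable.
  by rewrite setTI.
have mL : measurable L.
  by apply: (measurableI _ _ mSt); exact: measurable_lt_set.
have mG : measurable G.
  by apply: (measurableI _ _ mSt); exact: measurable_lt_set.
have disj : [disjoint L & G].
  by apply/disj_set2P; apply/seteqP; split => x // -[[_ /= xt] [_ /= tx]]; lra.
have mK : measurable_fun setT (fun x : RR => (K (x, t))%:E).
  by apply/measurable_EFinP; exact: (measurableT_comp edge_kernel_measurable (pair2_measurable t)).
have -> : (\int[mu]_x (K (x, t))%:E = \int[mu]_(x in L `|` G) (K (x, t))%:E)%E.
  rewrite [RHS]integral_mkcond; apply: eq_integral => x _; rewrite patchE.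
  case: ifPn => // /negP; rewrite inE => nx.
  rewrite /edge_kernel indicE memNset ?mul0r// => Sx; apply: nx.
  have : x != t by case: Sx.
  by rewrite neq_lt => /orP[xt|tx]; [left|right]; split.
rewrite ge0_integral_setU//; [|exact: measurable_funTS|by move=> x _; rewrite lee_fin edge_kernel_ge0].
rewrite (_ : 4 * rho ^+ 2 = 2 * rho ^+ 2 + 2 * rho ^+ 2); last by ring.
have KE (B : set RR) : B `<=` [set x | S (x, t)] ->
    (\int[mu]_(x in B) (K (x, t))%:E = \int[mu]_(x in B) (`|x - t|^-1)%:E)%E.
  move=> BS; apply: eq_integral => x; rewrite inE => Bx.
  by rewrite /edge_kernel indicE mem_set ?mul1r/= 1?distrC//; exact: BS.
rewrite EFinD; apply: leeD; rewrite KE; try by move=> x [].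
- apply: slice_piece => // [x [_ /= xt]|x y [Sx /= xt] [Sy /= yt]]; first by rewrite lt_eqF.
  by apply: edge_set_comparable => //; rewrite nmulr_rgt0 ?subr_lt0.
- apply: slice_piece => // [x [_ /= xt]|x y [Sx /= xt] [Sy /= yt]]; first by rewrite gt_eqF.
  by apply: edge_set_comparable => //; rewrite mulr_gt0 ?subr_gt0.
Qed.

Definition edge_transform (k : R -> R) (x : R) : \bar R :=
  (\int[mu]_t (K (x, t) * k t)%:E)%E.

Lemma edge_transform_integrand_measurable (k : R -> R) : measurable_fun setT k ->
  measurable_fun setT (fun p : RR * RR => (K p * k p.2)%:E).
Proof.
move=> mk; apply/measurable_EFinP; apply: measurable_funM; first exact: edge_kernel_measurable.
exact: (measurableT_comp mk measurable_snd).
Qed.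

Lemma edge_transform_measurable (k : R -> R) : measurable_fun setT k ->
  (forall t, 0 <= k t) -> measurable_fun setT (edge_transform k : RR -> \bar R).
Proof.
move=> mk k0.
apply: (@measurable_fun_fubini_tonelli_F _ _ RR RR R mu (fun p => (K p * k p.2)%:E)).
  exact: edge_transform_integrand_measurable.
by move=> p; rewrite lee_fin mulr_ge0// edge_kernel_ge0.
Qed.

(** Tonelli, and the uniform bound for the integral of the kernel in its first variable. *)
Lemma edge_transform_le (k : R -> R) : measurable_fun setT k -> (forall t, 0 <= k t) ->
  (\int[mu]_x edge_transform k x <= (4 * rho ^+ 2)%:E * \int[mu]_t (k t)%:E)%E.
Proof.
move=> mk k0; have Kk0 p : (0 <= (K p * k p.2)%:E)%E.
  by rewrite lee_fin mulr_ge0// edge_kernel_ge0.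
rewrite /edge_transform.
rewrite (@fubini_tonelli _ _ RR RR R mu mu (fun p => (K p * k p.2)%:E))//; last first.
  exact: edge_transform_integrand_measurable.
have c0 : 0 <= 4 * rho ^+ 2 by rewrite mulr_ge0// sqr_ge0.
rewrite -ge0_integralZl//; last 2 first.
- exact/measurable_EFinP.
- by move=> t _; rewrite lee_fin.
apply: ge0_le_integral => //.
- by move=> t _; apply: integral_ge0 => x _; exact: Kk0.
- exact: (measurable_fun_fubini_tonelli_G _ (edge_transform_integrand_measurable mk)).
- by apply: measurable_funeM; exact/measurable_EFinP.
move=> t _ /=.
under eq_integral do rewrite mulrC EFinM.
rewrite ge0_integralZl//; last 3 first.
- by apply/measurable_EFinP; exact: (measurableT_comp edge_kernel_measurable (pair2_measurable t)).
- by move=> x _; rewrite lee_fin edge_kernel_ge0.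
- by rewrite lee_fin.
by rewrite muleC; apply: lee_wpmul2r; [rewrite lee_fin|exact: edge_kernel_slice].
Qed.

End edge_kernel.

(** * Pointwise bounds for the derivative *)

Section pointwise_bound.
Context {R : realType}.
Local Notation mu := (@lebesgue_measure R).
Local Notation RR := (g_sigma_algebraType (R.-ocitv.-measurable)).
Variables (beta q : R) (F f M : R -> R) (m N : R).
Hypotheses (beta_gt0 : 0 < beta) (beta_lt1 : beta < 1) (qE : q = 1 / (1 - beta)).
Hypothesis D : frac_max_data beta F f M m N.
Implicit Types x d L lam u v t : R.
Local Notation w := (frac_weight beta).
Local Notation S := (edge_set beta f M).
Local Notation K := (edge_kernel beta f M).
Local Notation T := (edge_transform beta f M).

Lemma q_gt1 : 1 < q.
Proof. by have b0 := beta_gt0; have b1 := beta_lt1; rewrite qE ltr_pdivlMr; lra. Qed.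

Lemma slope_in_edge_set x d : is_derive x 1 M d -> d != 0 ->
  exists L lam u v,
    [/\ 0 < L, 0 < lam, `|d| <= w L * lam, (1 - beta) * lam <= m & lam * L <= N] /\
    [/\ u < v, `|f u - f v| = beta / 2 * lam &
      forall t, u <= t -> t <= v -> S (x, t) /\ `|t - x| <= L].
Proof.
move=> dM d0; have Mx := frac_max_gt0_of_slope D dM d0.
have b0 := beta_gt0; have b1 := beta_lt1; have e0 := frac_eta_gt0 beta_gt0.
have [L [lam [u [v [[L0 lam0 dle ME lamN] [uv fuv huv]]]]]] :=
  slope_witness beta_gt0 beta_lt1 D Mx dM d0.
exists L, lam, u, v; split; split => //.
  by have [_ _ /andP[h _] _] := huv u (lexx _) (ltW uv); exact: le_trans h (fmd_le D u).
move=> t ut tv; have [h1 h2 /andP[h3 h4] h5] := huv t ut tv.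
have c0 : 0 < 2 `^ (- beta) :> R by exact: powR_gt0.
have eL : 0 < frac_eta beta * L by rewrite mulr_gt0.
have tx : 0 < `|t - x| by exact: lt_le_trans h1.
have ft : 0 < f t by apply: lt_le_trans h3; rewrite mulr_gt0//; lra.
have ME' : M x = 2 `^ (- beta) * L `^ beta * lam by rewrite ME frac_weightM.
split => //; split => //=.
- by rewrite eq_sym -subr_eq0 -normr_gt0.
- rewrite ME'; apply: ler_pM; [by rewrite mulr_ge0 ?powR_ge0|exact: ltW| |].
    by apply: ler_wpM2l; [exact: ltW|apply: ge0_ler_powR => //; [exact: ltW|rewrite nnegrE ltW..]].
  by apply: (le_trans h4); rewrite ler_piMl ?(ltW lam0)//; lra.
- rewrite ME' /frac_kappa.
  have Lb : L `^ beta <= frac_eta beta `^ (- beta) * `|t - x| `^ beta.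
    have : (frac_eta beta * L) `^ beta <= `|t - x| `^ beta.
      by apply: ge0_ler_powR => //; [exact: ltW|rewrite nnegrE ltW..].
    rewrite (powRM _ (ltW e0) (ltW L0)) powRN => h6.
    rewrite mulrC ler_pdivlMr; last by rewrite powR_gt0.
    by rewrite mulrC.
  have lf : lam <= f t / (1 - beta) by rewrite ler_pdivlMr ?subr_gt0// mulrC.
  rewrite (_ : _ / _ * _ = 2 `^ (- beta) * ((frac_eta beta `^ (- beta) * `|t - x| `^ beta)
    * (f t / (1 - beta)))); last by ring.
  rewrite -mulrA ler_pM2l//; apply: ler_pM => //; [exact: powR_ge0|exact: ltW].
- by move=> th th0 th1; apply: h5; rewrite ?ler0q// -(rmorph1 (@ratr R)) ler_rat.
Qed.

Lemma slope_pow_bound L lam d : 0 < L -> 0 < lam -> `|d| <= w L * lam ->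
  (1 - beta) * lam <= m -> `|d| `^ q <= (m / (1 - beta)) `^ (q - 1) * (lam / L).
Proof.
move=> L0 lam0 dle lm; have q1 := q_gt1; have b1 := beta_lt1.
have w0 := frac_weight_ge0 beta L.
apply: (@le_trans _ _ ((w L * lam) `^ q)).
  apply: ge0_ler_powR => //; first by lra.
  by rewrite nnegrE mulr_ge0// ltW.
rewrite powRM ?(ltW lam0)//.
apply: (@le_trans _ _ (L^-1 * lam `^ q)).
  by apply: ler_wpM2r; rewrite ?powR_ge0// qE frac_weight_pow.
rewrite [leRHS]mulrC mulrAC [X in _ <= X]mulrC; apply: ler_wpM2l.
  by rewrite invr_ge0 ltW.
rewrite (_ : lam `^ q = lam * lam `^ (q - 1)); last first.
  by rewrite mulr_powRB1 ?(ltW lam0)//; lra.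
apply: ler_wpM2l; first exact: ltW.
apply: ge0_ler_powR; rewrite ?nnegrE ?(ltW lam0)//; first by lra.
  by rewrite divr_ge0 ?(fmd_m_ge0 D)//; lra.
by rewrite ler_pdivlMr ?subr_gt0// mulrC.
Qed.

Let cf : continuous f. Proof. exact: fmd_cont D. Qed.
Let cM : continuous M.
Proof. exact: locally_lipschitz_continuous (frac_max_locally_lipschitz beta_gt0 beta_lt1 D). Qed.

Lemma edge_transform_ge0 (k : R -> R) x : (forall t, 0 <= k t) -> (0 <= T k x)%E.
Proof.
move=> k0; rewrite /edge_transform; apply: integral_ge0 => t _.
by rewrite lee_fin mulr_ge0// edge_kernel_ge0.
Qed.

Lemma edge_transform_lower (k : R -> R) x L u v : measurable_fun setT k ->
  (forall t, 0 <= k t) -> 0 < L ->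
  (forall t, u <= t -> t <= v -> S (x, t) /\ `|t - x| <= L) ->
  ((L^-1)%:E * \int[mu]_(t in `]u, v]) (k t)%:E <= T k x)%E.
Proof.
move=> mk k0 L0 huv.
have mKk : measurable_fun setT (fun t : RR => (K (x, t) * k t)%:E).
  have mKx : measurable_fun setT (fun t : RR => K (x, t)).
    exact: (measurableT_comp (edge_kernel_measurable beta cf cM) (pair1_measurable (x : RR))).
  by apply/measurable_EFinP; exact: measurable_funM.
apply: (@le_trans _ _ (\int[mu]_(t in `]u, v]) (K (x, t) * k t)%:E)%E); last first.
  apply: ge0_subset_integral => //; last first.
  by move=> t _; rewrite lee_fin mulr_ge0// edge_kernel_ge0.
rewrite -ge0_integralZl//; last 3 first.
- by apply/measurable_EFinP; exact: measurable_funTS.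
- by move=> t _; rewrite lee_fin.
- by rewrite lee_fin invr_ge0 ltW.
apply: ge0_le_integral => //.
- by move=> t ?; rewrite mule_ge0 ?lee_fin ?invr_ge0 ?(ltW L0).
- by apply: measurable_funeM; apply/measurable_EFinP; exact: measurable_funTS.
- exact: measurable_funTS.
move=> t; rewrite /= in_itv/= => /andP[/ltW ut tv].
have [Sxt tL] := huv t ut tv.
rewrite -EFinM lee_fin; apply: ler_wpM2r => //.
rewrite /edge_kernel indicE mem_set// mul1r/=.
have tx : 0 < `|t - x| by case: Sxt => /= ne _ _ _ _; rewrite normr_gt0 subr_eq0 eq_sym.
by rewrite lef_pV2 ?posrE.
Qed.

(** All of [[u,v]] consists of edges of [x] at distance at most [L], so the transform of
    [k] at [x] is at least [L^-1] times the integral of [k] over [`]u, v]]. *)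
Lemma slope_transform_bound (k : R -> R) x d L lam u v (s : R) :
  mu.-integrable setT (EFin \o k) -> (forall t, 0 <= k t) -> 0 <= s ->
  0 < L -> 0 < lam -> `|d| <= w L * lam -> (1 - beta) * lam <= m -> u < v ->
  (forall t, u <= t -> t <= v -> S (x, t) /\ `|t - x| <= L) ->
  beta / 2 * lam <= s * \int[mu]_(t in `]u, v]) k t ->
  ((`|d| `^ q)%:E <= ((m / (1 - beta)) `^ (q - 1) * (2 / beta * s))%:E * T k x)%E.
Proof.
move=> ik k0 s0 L0 lam0 dle lm uv huv lamI; have b0 := beta_gt0.
have mk : measurable_fun setT k by apply/measurable_EFinP; exact: measurable_int ik.
have := edge_transform_lower mk k0 L0 huv.
have finI : (\int[mu]_(t in `]u, v]) (k t)%:E)%E \is a fin_num.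
  by apply: integrable_fin_num => //; exact: integrableS ik.
set c := (m / (1 - beta)) `^ (q - 1) => Tle.
have c0 : 0 <= c by exact: powR_ge0.
have cs : 0 <= c * (2 / beta * s) by rewrite mulr_ge0// mulr_ge0// divr_ge0// ltW.
apply: (@le_trans _ _ ((c * (2 / beta * s))%:E * ((L^-1)%:E * \int[mu]_(t in `]u, v]) (k t)%:E))%E); last first.
  by apply: lee_wpmul2l => //; rewrite lee_fin.
rewrite -(fineK finI) -!EFinM lee_fin; apply: (le_trans (slope_pow_bound L0 lam0 dle lm)).
set I := fine _; have lamI' : lam <= 2 / beta * s * I.
  have -> : lam = 2 / beta * (beta / 2 * lam) by field; exact: lt0r_neq0.
  by rewrite -[leRHS]mulrA; apply: ler_wpM2l => //; rewrite divr_ge0// ltW.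
rewrite -[leRHS]mulrA; apply: ler_wpM2l => //.
by rewrite mulrCA mulrC ler_wpM2l// invr_ge0 ltW.
Qed.

Variable g : R -> R.
Hypotheses (ig : mu.-integrable setT (EFin \o g)) (g0 : forall t, 0 <= g t).
Hypothesis fg : forall a b : R, a <= b -> `|f b - f a| <= \int[mu]_(t in `]a, b]) g t.

Lemma slope_pow_le x d : is_derive x 1 M d ->
  ((`|d| `^ q)%:E <= ((m / (1 - beta)) `^ (q - 1) * (2 / beta))%:E * T g x)%E.
Proof.
move=> dM; have q1 := q_gt1; have b0 := beta_gt0.
have [->|d0] := eqVneq d 0.
  rewrite normr0 powR0; last by rewrite gt_eqF//; lra.
  by rewrite mule_ge0 ?edge_transform_ge0// lee_fin mulr_ge0 ?powR_ge0// divr_ge0// ltW.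
have [L [lam [u [v [[L0 lam0 dle lm _] [uv fuv huv]]]]]] := slope_in_edge_set dM d0.
rewrite -[2 / beta]mulr1.
apply: (slope_transform_bound ig g0 ler01 L0 lam0 dle lm uv huv).
by rewrite mul1r -fuv distrC fg// ltW.
Qed.

(** The first term bounds the slope for [|x| <= 2n], where [1 + x^2 <= 1 + 4n^2]; the
    second one bounds it for [|x| > 2n], where [1 + x^2 <= 8 L^2]. *)
Definition truncation_constant (n : R) : R :=
  (m / (1 - beta)) `^ (q - 1) * (8 * n / beta) * (1 + 4 * n ^+ 2) + 8 * N `^ q.

(** Here [w(L)^q <= 1/L], and the mass bound gives [lam^q <= N^q L^-q <= N^q L^-1]. *)
Lemma slope_decay L lam d : 1 <= L -> 0 < lam -> `|d| <= w L * lam -> lam * L <= N ->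
  `|d| `^ q <= N `^ q / L ^+ 2.
Proof.
move=> L1 lam0 dle lamN; have q1 := q_gt1; have L0 : 0 < L by lra.
have q0 : 0 <= q by lra.
have N0 : 0 <= N by apply: le_trans lamN; rewrite mulr_ge0// ltW.
have w0 := frac_weight_ge0 beta L.
have lamL : lam <= N * L^-1 by rewrite ler_pdivlMr.
have Li0 : 0 < L^-1 by rewrite invr_gt0.
apply: (@le_trans _ _ ((w L * (N * L^-1)) `^ q)).
  apply: ge0_ler_powR => //; first by rewrite nnegrE mulr_ge0// mulr_ge0// ltW.
  by apply: (le_trans dle); apply: ler_wpM2l.
have e1 : (w L * (N * L^-1)) `^ q = w L `^ q * (N `^ q * L^-1 `^ q).
  by rewrite (powRM _ w0); [rewrite (powRM _ N0)// ltW|rewrite mulr_ge0// ltW].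
rewrite e1 (_ : N `^ q / L ^+ 2 = L^-1 * (N `^ q * L^-1)); last first.
  by field; exact: lt0r_neq0.
apply: ler_pM; [exact: powR_ge0|by rewrite mulr_ge0 ?powR_ge0| |].
  by rewrite qE; exact: frac_weight_pow.
apply: ler_wpM2l; first exact: powR_ge0.
rewrite -[leRHS](powRr1 (ltW Li0)); apply: ger_powR; last exact: ltW.
by rewrite Li0/= invf_le1.
Qed.

Lemma truncation_constant_ge0 n : 0 <= n -> 0 <= truncation_constant n.
Proof.
move=> n0; have b0 := beta_gt0; rewrite addr_ge0 ?mulr_ge0 ?powR_ge0 ?invr_ge0 ?(ltW b0)//.
by rewrite addr_ge0// mulr_ge0// sqr_ge0.
Qed.

(** Split according to whether [|g - h|] or [h] carries the larger part of the variation
    of [f] on [[u,v]].  In the second case [[u,v]] meets the support of [h], so [L >=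
    |x| - n], and [h] contributes at most [n (v - u) <= 2 n L]. *)
Lemma slope_pow_le_truncated (h : R -> R) (n : R) x d : 1 <= n ->
  mu.-integrable setT (EFin \o h) -> (forall t, 0 <= h t <= n) ->
  (forall t, n < `|t| -> h t = 0) -> is_derive x 1 M d ->
  ((`|d| `^ q)%:E <= ((m / (1 - beta)) `^ (q - 1) * (4 / beta))%:E *
     T (fun t => `|(g t - h t)%R|%R) x + (truncation_constant n / (1 + x ^+ 2))%:E)%E.
Proof.
move=> n1 ih hn hout dM; have q1 := q_gt1; have b0 := beta_gt0; have b1 := beta_lt1.
have n0 : 0 <= n by lra.
have A0 := truncation_constant_ge0 n0.
have x2 : 0 < 1 + x ^+ 2 by have := sqr_ge0 x; lra.
have Ax0 : 0 <= truncation_constant n / (1 + x ^+ 2) by rewrite divr_ge0// ltW.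
have c0 : 0 <= (m / (1 - beta)) `^ (q - 1) by exact: powR_ge0.
have T0 : (0 <= T (fun t => `|(g t - h t)%R|%R) x)%E by exact: edge_transform_ge0.
have cT0 (s : R) : 0 <= s -> (0 <= ((m / (1 - beta)) `^ (q - 1) * s)%:E *
    T (fun t => `|(g t - h t)%R|%R) x)%E.
  by move=> s0; rewrite mule_ge0// lee_fin mulr_ge0.
have b40 : 0 <= 4 / beta by rewrite divr_ge0// ltW.
have [->|d0] := eqVneq d 0.
  rewrite normr0 powR0; last by rewrite gt_eqF//; lra.
  by rewrite adde_ge0// ?lee_fin// cT0.
have [L [lam [u [v [[L0 lam0 dle lm lamN] [uv fuv huv]]]]]] := slope_in_edge_set dM d0.
have igh : mu.-integrable setT (EFin \o (fun t => `|g t - h t|)).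
  have igh0 : mu.-integrable setT (EFin \o (fun t => g t - h t)) by exact: integrableB ig ih.
  exact: integrable_norm igh0.
pose Duv : set R := `]u, v]%classic.
have mD : measurable Duv by exact: measurable_itv.
have onD (k : R -> R) : mu.-integrable setT (EFin \o k) -> mu.-integrable Duv (EFin \o k).
  by move=> ik; exact: integrableS ik.
pose I := \int[mu]_(t in Duv) g t; pose J := \int[mu]_(t in Duv) `|g t - h t|.
pose H := \int[mu]_(t in Duv) h t.
have lamI : beta / 2 * lam <= I by rewrite -fuv distrC; apply: fg; exact: ltW.
have J0 : 0 <= J by apply: Rintegral_ge0.
have IJH : I <= J + H.
  rewrite /I /J /H -RintegralD//; [|exact: onD|exact: onD].
  apply: le_Rintegral => //; [exact: onD|exact: onD (integrableD _ igh ih)|].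
  by move=> t _; have := ler_norm (g t - h t); lra.
have [IJ|JI] := leP I (2 * J).
  rewrite -[leLHS]adde0; apply: leeD; last by rewrite lee_fin.
  rewrite (_ : 4 / beta = 2 / beta * 2); last by field; exact: lt0r_neq0.
  apply: (slope_transform_bound igh _ _ L0 lam0 dle lm uv huv) => //.
  exact: le_trans lamI IJ.
rewrite -[leLHS]add0e; apply: leeD; first exact: cT0.
rewrite lee_fin ler_pdivlMr//.
have H0 : 0 < H by lra.
have [t [ut tv tn]] : exists t, [/\ u <= t, t <= v & `|t| <= n].
  apply: contrapT => no; move: H0; rewrite (_ : H = 0) ?ltxx// /H.
  rewrite (@eq_Rintegral _ _ _ mu _ (cst 0)) ?Rintegral_cst ?mul0r// => t.
  rewrite inE /Duv/= in_itv/= => /andP[/ltW ut tv]; apply: hout; rewrite ltNge; apply/negP => tn.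
  by apply: no; exists t.
have xL : `|x| <= n + L.
  have := (huv t ut tv).2; rewrite distrC => xt.
  by rewrite -[x](subrK t); apply: (le_trans (ler_normD _ _)); lra.
have HL : H <= n * (2 * L).
  apply: (@le_trans _ _ (n * (v - u))); last first.
    apply: ler_wpM2l => //.
    have := (huv u (lexx _) (ltW uv)).2; have := (huv v (ltW uv) (lexx _)).2.
    by rewrite !ler_norml => /andP[? ?] /andP[? ?]; lra.
  rewrite (_ : n * (v - u) = \int[mu]_(t in Duv) cst n t); last first.
    rewrite Rintegral_cst//; congr (_ * _).
    by have /(congr1 fine)/= := lebesgue_measure_oc (ltW uv); move=> ->.
  apply: le_Rintegral => //; first exact: onD.
    exact: (locally_integrable_oc u v (locally_integrable_cst n)).
  by move=> s _; have /andP[_] := hn s.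
rewrite /truncation_constant; set c := (m / (1 - beta)) `^ (q - 1) in c0 *.
have n8 : 0 <= 8 * n / beta by rewrite divr_ge0 ?mulr_ge0// ltW.
have Nq : 0 <= N `^ q by exact: powR_ge0.
have [xn|nx] := leP `|x| (2 * n).
  have dc : `|d| `^ q <= c * (8 * n / beta).
    apply: (le_trans (slope_pow_bound L0 lam0 dle lm)); apply: ler_wpM2l => //.
    rewrite ler_pdivrMr//.
    rewrite (_ : _ * L = 2 / beta * (2 * (n * (2 * L)))); last by field; exact: lt0r_neq0.
    have -> : lam = 2 / beta * (beta / 2 * lam) by field; exact: lt0r_neq0.
    by apply: ler_wpM2l; [rewrite divr_ge0// ltW|lra].
  apply: (@le_trans _ _ (c * (8 * n / beta) * (1 + 4 * n ^+ 2))); last first.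
    by rewrite lerDl mulr_ge0.
  have x2n : x ^+ 2 <= (2 * n) ^+ 2.
    by rewrite -[x ^+ 2]real_normK ?num_real// lerXn2r ?nnegrE// mulr_ge0.
  apply: ler_pM; [exact: powR_ge0|exact: ltW|exact: dc|].
  by rewrite lerD2l (le_trans x2n)// exprMn -natrX.
have L1 : 1 <= L by lra.
apply: (@le_trans _ _ (8 * N `^ q)); last first.
  by rewrite lerDr; apply: mulr_ge0; [exact: mulr_ge0|have := sqr_ge0 n; lra].
have h1 := slope_decay L1 lam0 dle lamN.
have L20 : 0 < L ^+ 2 by rewrite exprn_gt0.
have h2 : 1 + x ^+ 2 <= 8 * L ^+ 2.
  have x2L : x ^+ 2 <= (2 * L) ^+ 2.
    rewrite -[x ^+ 2]real_normK ?num_real// lerXn2r ?nnegrE ?mulr_ge0 ?(ltW L0)//.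
    by lra.
  have : 1 <= L ^+ 2 by rewrite exprn_ege1.
  by move: x2L; rewrite exprMn -natrX; lra.
apply: (@le_trans _ _ (N `^ q / L ^+ 2 * (8 * L ^+ 2))).
  by apply: ler_pM; [exact: powR_ge0|exact: ltW|exact: h1|exact: h2].
by rewrite le_eqVlt; apply/orP; left; apply/eqP; field; rewrite lt0r_neq0.
Qed.

End pointwise_bound.

(** * Distances in the Sobolev space *)

Section W11_difference.
Context {R : realType}.
Local Notation mu := (@lebesgue_measure R).
Implicit Types f v : R -> R.

Definition W11_dist f1 f2 : R :=
  \int[mu]_t `|f1 t - f2 t| + \int[mu]_t `|weak_derivative (f1 \- f2) t|.

Lemma W11B f1 f2 : W11 f1 -> W11 f2 -> W11 (f1 \- f2) /\
  {ae mu, forall x, weak_derivative (f1 \- f2) x = weak_derivative f1 x - weak_derivative f2 x}.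
Proof.
move=> w1 w2; have [i1 j1] := W11_integrable w1; have [i2 j2] := W11_integrable w2.
have d12 := is_weak_derivativeB (W11_weak_derivative w1) (W11_weak_derivative w2).
have wd12 : weakly_differentiable (f1 \- f2) by exists (weak_derivative f1 \- weak_derivative f2).
have dE := weak_derivative_ae_unique (weak_derivativeP wd12) d12.
split; last exact: dE.
have i12 : mu.-integrable setT (EFin \o (f1 \- f2)) by exact: integrableB i1 i2.
have j12 : mu.-integrable setT (EFin \o (weak_derivative f1 \- weak_derivative f2)).
  exact: integrableB j1 j2.
split => //; apply/Lfun1_integrable => //.
apply: (integrable_ae_eq j12); last by apply: (aeS _ dE) => x ->.
by have [_ [] ] := weak_derivativeP wd12.
Qed.

Lemma W11_norm_dist f1 f2 : W11 f1 -> W11 f2 ->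
  W11_norm (f1 \- f2) = (W11_dist f1 f2)%:E.
Proof.
move=> w1 w2; have [w12 _] := W11B w1 w2; have [i j] := W11_integrable w12.
rewrite /W11_norm !Lnorm1 /W11_dist EFinD /Rintegral !fineK//.
- by apply: integrable_fin_num => //; exact: integrable_norm j.
- by apply: integrable_fin_num => //; exact: integrable_norm i.
Qed.

Lemma W11_dist_ge0 f1 f2 : 0 <= W11_dist f1 f2.
Proof. by rewrite addr_ge0//; apply: Rintegral_ge0. Qed.

Lemma Rintegral_dist_le (k1 k2 : R -> R) :
  mu.-integrable setT (EFin \o k1) -> mu.-integrable setT (EFin \o k2) ->
  \int[mu]_t `|k1 t| <= \int[mu]_t `|k2 t| + \int[mu]_t `|k1 t - k2 t|.
Proof.
move=> i1 i2; have i12 : mu.-integrable setT (EFin \o (k1 \- k2)) by exact: integrableB i1 i2.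
have n1 : mu.-integrable setT (EFin \o (fun t => `|k1 t|)) by exact: integrable_norm i1.
have n2 : mu.-integrable setT (EFin \o (fun t => `|k2 t|)) by exact: integrable_norm i2.
have n12 : mu.-integrable setT (EFin \o (fun t => `|k1 t - k2 t|)) by exact: integrable_norm i12.
rewrite -RintegralD//; apply: le_Rintegral => //; first exact: integrableD n2 n12.
by move=> t _; rewrite -[X in `|X|](subrK (k2 t)) addrC; exact: ler_normD.
Qed.

Lemma W11_dist_derivative f1 f2 : W11 f1 -> W11 f2 ->
  \int[mu]_t `|weak_derivative f1 t - weak_derivative f2 t| <= W11_dist f1 f2.
Proof.
move=> w1 w2; have [w12 dE] := W11B w1 w2.
rewrite (_ : \int[mu]_t `|weak_derivative f1 t - weak_derivative f2 t| =
    \int[mu]_t `|weak_derivative (f1 \- f2) t|).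
  by rewrite lerDr; apply: Rintegral_ge0.
have [_ j1] := W11_integrable w1; have [_ j2] := W11_integrable w2.
have [_ j12] := W11_integrable w12.
rewrite /Rintegral; congr fine; apply: ae_eq_integral => //.
- have i12 : mu.-integrable setT (EFin \o (weak_derivative f1 \- weak_derivative f2)).
    exact: integrableB j1 j2.
  have n12 : mu.-integrable setT
    (EFin \o (fun t => `|weak_derivative f1 t - weak_derivative f2 t|)) by exact: integrable_norm i12.
  exact: measurable_int n12.
- have n12 : mu.-integrable setT (EFin \o (fun t => `|weak_derivative (f1 \- f2) t|)).
    exact: integrable_norm j12.
  exact: measurable_int n12.
- by apply: (aeS _ dE) => t /= ->.
Qed.

Lemma W11_dist_sup f1 f2 v1 v2 : W11 f1 -> W11 f2 -> continuous v1 -> continuous v2 ->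
  {ae mu, forall x, f1 x = v1 x} -> {ae mu, forall x, f2 x = v2 x} ->
  forall x, `|v1 x - v2 x| <= W11_dist f1 f2.
Proof.
move=> w1 w2 c1 c2 e1 e2 x; have [w12 _] := W11B w1 w2.
have [u [cu fu _ ub]] := W11_continuous_representative w12.
have -> : v1 x - v2 x = u x.
  have cB : continuous (v1 \- v2) by move=> y; apply: cvgB; [exact: c1|exact: c2].
  rewrite -[LHS]/((v1 \- v2) x); congr (_ x); apply: continuous_ae_eq => //.
  by apply: (aeS3 _ e1 e2 fu) => y /= -> -> ->.
by apply: (le_trans (ub x)); rewrite lerDr; apply: Rintegral_ge0.
Qed.

Lemma W11_dist_frac_avg (beta : R) f1 f2 v1 v2 a b : 0 < beta -> beta < 1 ->
  W11 f1 -> W11 f2 -> continuous v1 -> continuous v2 ->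
  {ae mu, forall x, f1 x = v1 x} -> {ae mu, forall x, f2 x = v2 x} -> a < b ->
  `|frac_avg beta (mass f1) a b - frac_avg beta (mass f2) a b| <= W11_dist f1 f2.
Proof.
move=> b0 b1 w1 w2 c1 c2 e1 e2 ab; have ab' := ltW ab.
have [i1 _] := W11_integrable w1; have [i2 _] := W11_integrable w2.
have w0 := frac_weight_ge0 beta (b - a).
rewrite /frac_avg -mulrBr normrM (ger0_norm w0); apply: frac_weight_mass => //.
- by rewrite subr_gt0.
- have n1 : mu.-integrable setT (EFin \o (fun t => `|f1 t|)) by exact: integrable_norm i1.
  have n2 : mu.-integrable setT (EFin \o (fun t => `|f2 t|)) by exact: integrable_norm i2.
  have n12 : mu.-integrable setT (EFin \o (fun t => `|f1 t| - `|f2 t|)) by exact: integrableB n1 n2.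
  have i12 : mu.-integrable setT (EFin \o (f1 \- f2)) by exact: integrableB i1 i2.
  pose D : set R := `]a, b]%classic; have mD : measurable D by exact: measurable_itv.
  have E1 : mass f1 b - mass f1 a = \int[mu]_(t in D) `|f1 t| := massB i1 ab'.
  have E2 : mass f2 b - mass f2 a = \int[mu]_(t in D) `|f2 t| := massB i2 ab'.
  rewrite E1 E2 -RintegralB//; [|exact: integrableS n1|exact: integrableS n2].
  apply: (le_trans (le_normr_Rintegral _ _)) => //; first exact: integrableS n12.
  apply: (@le_trans _ _ (\int[mu]_(t in D) `|f1 t - f2 t|)).
    have m1 : mu.-integrable setT (EFin \o (fun t => `|(`|f1 t| - `|f2 t|)|)) by exact: integrable_norm n12.
    have m2 : mu.-integrable setT (EFin \o (fun t => `|f1 t - f2 t|)) by exact: integrable_norm i12.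
    apply: le_Rintegral => //; [exact: integrableS m1|exact: integrableS m2|].
    by move=> t _; exact: ler_dist_dist.
  apply: (le_trans (Rintegral_subset_norm i12 mD)).
  by rewrite lerDl; apply: Rintegral_ge0.
- have dB (x : R) : is_derive x 1 (fun y => mass f1 y - mass f2 y) (`|v1 x| - `|v2 x|).
    exact: is_deriveB (is_derive_mass x i1 c1 e1) (is_derive_mass x i2 c2 e2).
  have [c _ cE] := derive_MVT dB ab.
  rewrite (_ : _ - _ = mass f1 b - mass f2 b - (mass f1 a - mass f2 a)); last by ring.
  rewrite cE normrM [X in _ * X]ger0_norm ?subr_ge0//; apply: ler_wpM2r; first by rewrite subr_ge0.
  apply: (le_trans (ler_dist_dist _ _)); exact: W11_dist_sup.
Qed.

End W11_difference.

(** * Integrability and domination *)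

Section frac_maximal_regularity.
Context {R : realType}.
Local Notation mu := (@lebesgue_measure R).
Variables (beta q : R).
Hypotheses (beta_gt0 : 0 < beta) (beta_lt1 : beta < 1) (qE : q = 1 / (1 - beta)).
Implicit Types (f v : R -> R).
Local Notation Mx := (frac_maximal_fun beta).

Definition representative f v : Prop :=
  [/\ continuous v, {ae mu, forall x, f x = v x} &
    forall a b, a <= b -> `|v b - v a| <= \int[mu]_(t in `]a, b]) `|weak_derivative f t|].

Lemma W11_representative f : W11 f -> exists2 v, representative f v &
  forall x, `|v x| <= \int[mu]_t `|weak_derivative f t|.
Proof. by move=> /W11_continuous_representative[v [cv fv vab vb]]; exists v. Qed.

Lemma representative_data f v (m N : R) : W11 f -> representative f v ->
  (forall x, `|v x| <= m) -> \int[mu]_t `|f t| <= N ->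
  frac_max_data beta (mass f) (fun t => `|v t|) (Mx f) m N.
Proof.
move=> wf [cv fv _] vm fN; have [fi _] := W11_integrable wf.
have D := W11_frac_max_data beta_gt0 beta_lt1 fi cv fv vm.
split; try by case: D.
by move=> a b; apply: (le_trans (fmd_mass D a b)).
Qed.

Lemma frac_maximal_weak_derivative f : W11 f ->
  [/\ forall x, frac_maximal beta f x \is a fin_num, weakly_differentiable (Mx f),
    measurable_fun setT (weak_derivative (Mx f)) &
    {ae mu, forall x : R, is_derive x 1 (Mx f) (weak_derivative (Mx f) x)}].
Proof.
move=> wf; have [v [cv fv vab] vm] := W11_representative wf.
have [fi _] := W11_integrable wf.
have D := W11_frac_max_data beta_gt0 beta_lt1 fi cv fv vm.
have lM := frac_max_locally_lipschitz beta_gt0 beta_lt1 D.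
have wM := locally_lipschitz_weak_derivative lM.
have dM : weakly_differentiable (Mx f) by exists (upper_derivative (Mx f)).
split => //.
- by move=> x; exact: frac_maximal_fin_num fi cv fv vm.
- by have [_ []] := weak_derivativeP dM.
apply: (aeS2 _ (locally_lipschitz_is_derive lM)
  (weak_derivative_ae_unique wM (weak_derivativeP dM))) => x + E.
by rewrite E.
Qed.

Lemma representative_norm_le f v a b : representative f v -> a <= b ->
  `| `|v b| - `|v a| | <= \int[mu]_(t in `]a, b]) `|weak_derivative f t|.
Proof. by move=> [_ _ h] ab; apply: (le_trans (ler_dist_dist _ _)); exact: h. Qed.

Definition kernel_constant : R := 4 * (frac_kappa beta `^ beta^-1) ^+ 2.

Lemma kernel_constant_ge0 : 0 <= kernel_constant.
Proof. by rewrite mulr_ge0// sqr_ge0. Qed.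

(** [m] is any bound for the representative, rather than the norm of the weak
    derivative: along a sequence tending to 0 it can be taken to tend to 0. *)
Lemma frac_maximal_energy f v (m : R) : W11 f -> representative f v ->
  (forall x, `|v x| <= m) ->
  (\int[mu]_x (`|weak_derivative (Mx f) x| `^ q)%:E <=
   ((m / (1 - beta)) `^ (q - 1) * (2 / beta) * kernel_constant *
    \int[mu]_t `|weak_derivative f t|)%:E)%E.
Proof.
move=> wf rv vm; have [_ _ mw dw] := frac_maximal_weak_derivative wf.
have D := representative_data wf rv vm (lexx _).
have b0 := beta_gt0.
have cf := fmd_cont D.
have cM := locally_lipschitz_continuous (frac_max_locally_lipschitz beta_gt0 beta_lt1 D).
have [_ fi'] := W11_integrable wf.
pose g t := `|weak_derivative f t|.
have ig : mu.-integrable setT (EFin \o g) by exact: integrable_norm fi'.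
have g0 t : 0 <= g t by rewrite /g.
have mg : measurable_fun setT g by apply/measurable_EFinP; exact: measurable_int ig.
set c := (m / (1 - beta)) `^ (q - 1) * (2 / beta).
have c0 : 0 <= c by rewrite mulr_ge0 ?powR_ge0// divr_ge0// ltW.
have mT := edge_transform_measurable beta cf cM mg g0.
have T0 x := edge_transform_ge0 beta (fun t => `|v t|) (Mx f) x g0.
pose Tg := edge_transform beta (fun t : R => `|v t|) (Mx f) g.
have h1 : (\int[mu]_x (`|weak_derivative (Mx f) x| `^ q)%:E <= \int[mu]_x (c%:E * Tg x))%E.
  apply: ae_ge0_le_integral => //.
  - apply/measurable_EFinP; apply: (measurableT_comp (measurable_powR q)).
    exact: measurableT_comp.
  - by move=> x _; rewrite mule_ge0.
  - exact: measurable_funeM.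
  apply: (aeS _ dw) => x dx _.
  apply: (slope_pow_le beta_gt0 beta_lt1 qE D ig g0 _ dx) => a b ab.
  exact: (representative_norm_le rv ab).
apply: (le_trans h1); rewrite ge0_integralZl//.
rewrite (_ : (_ * _ * _)%:E = c%:E * (kernel_constant * \int[mu]_t g t)%:E)%E; last first.
  by rewrite -EFinM; congr EFin; exact/esym/mulrA.
apply: lee_wpmul2l; first by rewrite lee_fin.
apply: (le_trans (edge_transform_le beta_gt0 beta_lt1 cf cM mg g0)).
have fI : (\int[mu]_t (g t)%:E)%E \is a fin_num by exact: integrable_fin_num.
by rewrite [leRHS]EFinM /Rintegral (fineK fI).
Qed.

Lemma frac_maximal_Lfun f : W11 f ->
  weak_derivative (Mx f) \in Lfun mu q%:E.
Proof.
move=> wf; have [_ _ mw dw] := frac_maximal_weak_derivative wf.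
have [v rv vm] := W11_representative wf.
have h := frac_maximal_energy wf rv vm.
have q1 := q_gt1 beta_gt0 beta_lt1 qE; have q0 : q != 0 by rewrite gt_eqF//; lra.
rewrite inE; apply/andP; split; rewrite inE//=.
rewrite /finite_norm unlock.
rewrite poweR_lty//.
apply: le_lt_trans (ltry _); apply: le_trans h.
rewrite le_eqVlt; apply/orP; left; apply/eqP; apply: eq_integral => x _.
by rewrite /= -poweR_EFin.
Qed.

End frac_maximal_regularity.

Section domination.
Context {R : realType}.
Local Notation mu := (@lebesgue_measure R).

Lemma cvge_near_le (u : nat -> \bar R) : u j @[j --> \oo] --> 0%E ->
  forall e : R, 0 < e -> \forall j \near \oo, (u j <= e%:E)%E.
Proof.
move=> /fine_cvgP[fu cu] e e0; have /cvgrPdist_le/(_ _ e0) ce := cu; near=> j.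
have fj : u j \is a fin_num by near: j.
rewrite -(fineK fj) lee_fin; apply: (le_trans (ler_norm _)); rewrite -normrN -sub0r.
by near: j; exact: ce.
Unshelve. all: by end_near. Qed.

Lemma near_le_cvge0 (u : nat -> \bar R) : (forall j, (0 <= u j)%E) ->
  (forall e : R, 0 < e -> \forall j \near \oo, (u j <= e%:E)%E) ->
  u j @[j --> \oo] --> 0%E.
Proof.
move=> u0 ue; apply/fine_cvgP; split.
  have := ue 1 ltr01; apply: filterS => j uj1.
  by rewrite ge0_fin_numE//; apply: le_lt_trans uj1 (ltry _).
apply/cvgrPdist_le => e e0; have := ue e e0; apply: filterS => j uje.
have fj : u j \is a fin_num by rewrite ge0_fin_numE//; apply: le_lt_trans uje (ltry _).
rewrite /= sub0r normrN ger0_norm ?fine_ge0//.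
by rewrite -lee_fin fineK.
Qed.

(** Apply dominated convergence to [min(E_j, X)]; the remainder [E_j - min(E_j, X)] is
    at most [Y_j]. *)
Lemma almost_dominated_cvg (E_ : nat -> R -> R) :
  (forall j, measurable_fun setT (E_ j)) -> (forall j x, 0 <= E_ j x) ->
  {ae mu, forall x, E_ j x @[j --> \oo] --> (0 : R)} ->
  (forall e : R, 0 < e -> exists X : R -> R, exists Y_ : nat -> R -> \bar R,
    [/\ mu.-integrable setT (EFin \o X), forall x, 0 <= X x,
      forall j, measurable_fun setT (Y_ j) /\ (forall x, (0 <= Y_ j x)%E) &
      \forall j \near \oo, {ae mu, forall x, ((E_ j x)%:E <= (X x)%:E + Y_ j x)%E} /\
        (\int[mu]_x Y_ j x <= e%:E)%E]) ->
  forall e : R, 0 < e -> \forall j \near \oo, (\int[mu]_x (E_ j x)%:E <= e%:E)%E.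
Proof.
move=> mE E0 Eae dom e e0; have e20 : 0 < e / 2 by lra.
(* half of e for the remainder Y, half for the dominated part *)
have [X [Y_ [iX X0 hY near_dom]]] := dom _ e20.
pose m_ j x := Num.min (E_ j x) (X x).
have mX : measurable_fun setT X by apply/measurable_EFinP; exact: measurable_int iX.
have mm j : measurable_fun setT (m_ j) by exact: measurable_minr.
have m0 j x : 0 <= m_ j x by rewrite le_min E0 X0.
have mcvg : (\int[mu]_x (m_ j x)%:E)%E @[j --> \oo] --> 0%E.
  have [|||||] := @dominated_convergence _ _ R mu setT measurableT
    (fun j x => (m_ j x)%:E) (cst 0%E) (EFin \o X).
  - by move=> j; apply/measurable_EFinP; exact: mm.
  - exact: measurable_cst.
  - apply: (aeS _ Eae) => x Ex _; apply: cvg_EFin; first by near=> j.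
    apply/cvgrPdist_le => e' e'0; have /cvgrPdist_le/(_ _ e'0) := Ex.
    apply: filterS => j; rewrite /= !sub0r !normrN !ger0_norm//.
    by apply: le_trans; rewrite ge_min lexx.
  - exact: iX.
  - apply: aeW => x j _ /=; rewrite lee_fin ger0_norm// ge_min lexx orbT//.
  by move=> _ _ +; rewrite integral0.
have msmall : \forall j \near \oo, (\int[mu]_x (m_ j x)%:E <= (e / 2)%:E)%E.
  by have /cvge_near_le := mcvg; apply.
near=> j.
have [aeE Ye] : {ae mu, forall x, ((E_ j x)%:E <= (X x)%:E + Y_ j x)%E} /\
        (\int[mu]_x Y_ j x <= (e / 2)%:E)%E by near: j; exact: near_dom.
have mj : (\int[mu]_x (m_ j x)%:E <= (e / 2)%:E)%E by near: j; exact: msmall.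
apply: (@le_trans _ _ (\int[mu]_x ((m_ j x)%:E + Y_ j x))%E).
  apply: ae_ge0_le_integral => //.
  - by move=> x _; rewrite lee_fin E0.
  - by apply/measurable_EFinP; exact: mE.
  - by move=> x _; rewrite adde_ge0 ?lee_fin// (hY j).2.
  - by apply: emeasurable_funD; [apply/measurable_EFinP; exact: mm|exact: (hY j).1].
  apply: (aeS _ aeE) => x h _; rewrite /m_ /Num.min; case: ifPn => // _.
  by rewrite leeDl// (hY j).2.
rewrite ge0_integralD//; last 4 first.
- by move=> x _; rewrite lee_fin.
- by apply/measurable_EFinP; exact: mm.
- by move=> x _; exact: (hY j).2.
- exact: (hY j).1.
by rewrite [e]splitr EFinD; exact: leeD.
Unshelve. all: by end_near. Qed.

Lemma inverse_square_integrable : mu.-integrable setT (EFin \o (fun x : R => (1 + x ^+ 2)^-1)).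
Proof.
have x0 (x : R) : 0 < 1 + x ^+ 2 by have := sqr_ge0 x; lra.
have c1 : continuous (fun x : R => (1 + x ^+ 2)^-1).
  exact: continuous_oneDsqrV.
apply/integrableP; split; first by apply/measurable_EFinP; exact: continuous_measurable_fun.
under eq_integral => x _ do rewrite /= ger0_norm ?invr_ge0 ?(ltW (x0 x))//.
rewrite ge0_symfun_integralT//; last 2 first.
- by move=> x; rewrite invr_ge0 ltW.
- by move=> x /=; rewrite sqrrN.
rewrite (_ : [set x : R | 0 <= x] = `[0, +oo[%classic); last first.
  by apply/seteqP; split => x /=; rewrite in_itv/= andbT.
have := @integral0y_oneDsqr R; rewrite /oneDsqr => ->.
by rewrite -EFinM ltry.
Qed.

End domination.

(** * Convergence of the derivatives *)

Section continuity.
Context {R : realType}.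
Local Notation mu := (@lebesgue_measure R).

Lemma bounded_truncation (g : R -> R) (e : R) : mu.-integrable setT (EFin \o g) ->
  (forall t, 0 <= g t) -> 0 < e ->
  exists n h, [/\ 1 <= n, mu.-integrable setT (EFin \o h), forall t, 0 <= h t <= n,
    forall t : R, n < `|t| -> h t = 0 & \int[mu]_t `|g t - h t| <= e].
Proof.
move=> ig g0 e0; have mg : measurable_fun setT g by apply/measurable_EFinP; exact: measurable_int ig.
pose h_ (k : nat) : R -> R := (fun t => Num.min (g t) k.+1%:R) \_ `[- k.+1%:R, k.+1%:R].
have inE (k : nat) (t : R) : (t \in `[- k.+1%:R, k.+1%:R]%classic) = (`|t| <= k.+1%:R).
  by rewrite mem_setE in_itv/= ler_norml.
have hE k t : h_ k t = if `|t| <= k.+1%:R then Num.min (g t) k.+1%:R else 0.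
  by rewrite /h_ patchE inE.
have mh k : measurable_fun setT (h_ k).
  apply/(measurable_restrictT _ _).1 => //; apply: measurable_funTS; exact: measurable_minr.
have h0 k t : 0 <= h_ k t.
  by rewrite hE; case: ifP => // _; rewrite le_min g0 ler0n.
have hg k t : h_ k t <= g t.
  by rewrite hE; case: ifP => // _; rewrite ge_min lexx.
have hn k t : h_ k t <= k.+1%:R.
  by rewrite hE; case: ifP => // _; rewrite ge_min lexx orbT.
have ih k : mu.-integrable setT (EFin \o h_ k).
  apply: (le_integrable measurableT _ _ ig); first by apply/measurable_EFinP; exact: mh.
  by move=> t _ /=; rewrite lee_fin !ger0_norm.
have cvg0 : (\int[mu]_t (`|g t - h_ k t|)%:E)%E @[k --> \oo] --> 0%E.
  have [|||||] := @dominated_convergence _ _ R mu setT measurableT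
    (fun k t => (`|g t - h_ k t|)%:E) (cst 0%E) (EFin \o g).
  - move=> k; apply/measurable_EFinP; apply: measurableT_comp => //.
    by apply: measurable_funB => //; exact: mh.
  - exact: measurable_cst.
  - apply: aeW => t _; apply: cvg_near_cst.
    exists (Num.truncn (Num.max `|t| (g t))) => // k /= Kk.
    have : Num.max `|t| (g t) <= k.+1%:R.
      by apply: (le_trans (ltW (truncnS_gt _))); rewrite ler_nat.
    by rewrite ge_max => /andP[tk gk]; rewrite hE tk (min_idPl gk) subrr normr0.
  - exact: ig.
  - apply: aeW => t k _ /=; rewrite lee_fin normr_id ger0_norm ?subr_ge0//.
    by rewrite lerBlDr lerDl.
  by move=> _ _ +; rewrite integral0.
have [k _ /(_ k (leqnn k)) hk] := cvge_near_le cvg0 e0.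
exists k.+1%:R, (h_ k); split => //.
- by rewrite ler1n.
- by move=> t; rewrite h0 hn.
- by move=> t; rewrite hE ltNge => /negbTE ->.
have igh : mu.-integrable setT (EFin \o (g \- h_ k)) by exact: integrableB ig (ih k).
have ingh : mu.-integrable setT (EFin \o (fun t => `|g t - h_ k t|)) by exact: integrable_norm igh.
rewrite -lee_fin /Rintegral fineK//; exact: integrable_fin_num.
Qed.

Lemma powR_dist_le (q a b : R) : 0 <= q ->
  `|a - b| `^ q <= 2 `^ q * (`|a| `^ q + `|b| `^ q).
Proof.
move=> q0; have mx : `|a - b| <= 2 * Num.max `|a| `|b|.
  apply: (le_trans (ler_normB _ _)); have h1 : `|a| <= Num.max `|a| `|b| by rewrite le_max lexx.
  have h2 : `|b| <= Num.max `|a| `|b| by rewrite le_max lexx orbT.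
  lra.
have m0 : 0 <= Num.max `|a| `|b| by rewrite le_max normr_ge0.
apply: (@le_trans _ _ ((2 * Num.max `|a| `|b|) `^ q)).
  by apply: ge0_ler_powR => //; rewrite nnegrE ?mulr_ge0.
rewrite powRM//; apply: ler_wpM2l; first exact: powR_ge0.
rewrite /Num.max; case: ifP => _.
  by rewrite lerDr powR_ge0.
by rewrite lerDl powR_ge0.
Qed.

Lemma powR_small (q e : R) : 0 < q -> 0 < e ->
  exists2 d, 0 < d & forall x, 0 <= x -> x <= d -> x `^ q <= e.
Proof.
move=> q0 e0; exists (e `^ q^-1); first exact: powR_gt0.
move=> x x0 xd; apply: (@le_trans _ _ ((e `^ q^-1) `^ q)).
  by apply: ge0_ler_powR => //; rewrite ?nnegrE ?powR_ge0// ltW.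
by rewrite -powRrM mulVf ?powRr1 ?(ltW e0)// gt_eqF.
Qed.

Let regroup (p c a : R) (t t' : \bar R) : 0 <= p -> 0 <= c -> 0 <= a ->
  (0 <= t -> 0 <= t' ->
  p%:E * ((c%:E * t + a%:E) + (c%:E * t' + a%:E)) =
  (p * (2 * a))%:E + (p * c)%:E * (t + t'))%E.
Proof.
move=> p0 c0 a0 t0 t'0.
have ct : (0 <= c%:E * t)%E by rewrite mule_ge0.
have ct' : (0 <= c%:E * t')%E by rewrite mule_ge0.
have s0 : (0 <= c%:E * (t + t'))%E by rewrite mule_ge0 ?adde_ge0.
have a2 : (0 <= (a + a)%:E)%E by rewrite lee_fin addr_ge0.
rewrite addeACA -EFinD -ge0_muleDr// [X in (p%:E * X)%E]addeC [LHS]ge0_muleDr//.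
by rewrite muleA -!EFinM; congr (_ + _)%E; congr EFin; ring.
Qed.

Variables (beta q : R).
Hypotheses (beta_gt0 : 0 < beta) (beta_lt1 : beta < 1) (qE : q = 1 / (1 - beta)).
Local Notation Mx := (frac_maximal_fun beta).
Variables (f : R -> R) (f_ : nat -> R -> R).
Hypotheses (wf : W11 f) (wf_ : forall j, W11 (f_ j)).
Hypothesis dist0 : forall e : R, 0 < e -> \forall j \near \oo, W11_dist (f_ j) f <= e.

Let q_gt1 : 1 < q. Proof. exact: q_gt1 beta_gt0 beta_lt1 qE. Qed.
Let q_gt0 : 0 < q. Proof. by have := q_gt1; lra. Qed.
Let kc := kernel_constant beta.
Let m := \int[mu]_t `|weak_derivative f t|.
Let N := \int[mu]_t `|f t|.

Let m_le j : \int[mu]_t `|weak_derivative (f_ j) t| <= m + W11_dist (f_ j) f.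
Proof.
have [_ i1] := W11_integrable (wf_ j); have [_ i2] := W11_integrable wf.
apply: (le_trans (Rintegral_dist_le i1 i2)); rewrite lerD2l.
exact: W11_dist_derivative.
Qed.

Let N_le j : \int[mu]_t `|f_ j t| <= N + W11_dist (f_ j) f.
Proof.
have [i1 _] := W11_integrable (wf_ j); have [i2 _] := W11_integrable wf.
apply: (le_trans (Rintegral_dist_le i1 i2)); rewrite lerD2l.
by rewrite lerDl; apply: Rintegral_ge0.
Qed.

Let m_ge0 : 0 <= m. Proof. exact: Rintegral_ge0. Qed.
Let N_ge0 : 0 <= N. Proof. exact: Rintegral_ge0. Qed.

Let E_ j x := `|weak_derivative (Mx (f_ j)) x - weak_derivative (Mx f) x| `^ q.

Let measurable_wd (k : R -> R) : W11 k -> measurable_fun setT (weak_derivative (Mx k)).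
Proof. by move=> wk; have [] := frac_maximal_weak_derivative beta_gt0 beta_lt1 wk. Qed.

Let ae_wd (k : R -> R) : W11 k ->
  {ae mu, forall x : R, is_derive x 1 (Mx k) (weak_derivative (Mx k) x)}.
Proof. by move=> wk; have [] := frac_maximal_weak_derivative beta_gt0 beta_lt1 wk. Qed.

Let E_measurable j : measurable_fun setT (E_ j).
Proof.
apply: (measurableT_comp (measurable_powR q)); apply: measurableT_comp => //.
by apply: measurable_funB; exact: measurable_wd.
Qed.

(** The limit has zero derivative, and [frac_maximal_energy] applies to [f_ j] with the
    bound [W11_dist (f_ j) f] for its representative, which enters with the positive
    exponent [q - 1]. *)
Let zero_limit v : representative f v -> (forall x, v x = 0) ->
  forall e : R, 0 < e -> \forall j \near \oo, (\int[mu]_x (E_ j x)%:E <= e%:E)%E.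
Proof.
move=> rv v0 e e0; have b0 := beta_gt0; have b1 := beta_lt1.
have vm x : `|v x| <= 0 by rewrite v0 normr0.
have D := representative_data beta_gt0 beta_lt1 wf rv vm (lexx _).
have M0 x : Mx f x = 0 by apply: (frac_max_eq0 D) => t; rewrite v0 normr0.
have kc0 : 0 <= kc by exact: kernel_constant_ge0.
pose C := 2 / beta * kc * (m + 1).
have m1 : 0 <= m + 1 by rewrite addr_ge0.
have C0 : 0 <= C by rewrite mulr_ge0// mulr_ge0// divr_ge0// ltW.
have q10 : 0 < q - 1 by rewrite subr_gt0.
have eC : 0 < e / (C + 1) by rewrite divr_gt0//; lra.
have [d d0 hd] := powR_small q10 eC.
(* distances below this bound make the power of W11_dist / (1 - beta) small *)
have bd : 0 < (1 - beta) * d by rewrite mulr_gt0//; lra.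
near=> j.
have dj1 : W11_dist (f_ j) f <= 1 by near: j; exact: dist0.
have djd : W11_dist (f_ j) f <= (1 - beta) * d by near: j; exact: dist0.
have dj0 := W11_dist_ge0 (f_ j) f.
have [vj rvj _] := W11_representative (wf_ j).
have vjm x : `|vj x| <= W11_dist (f_ j) f.
  have [cv fv _] := rv; have [cvj fvj _] := rvj.
  by have := W11_dist_sup (wf_ j) wf cvj cv fvj fv x; rewrite v0 subr0.
have := frac_maximal_energy beta_gt0 beta_lt1 qE (wf_ j) rvj vjm.
set RHS := ((_ * _ * _ * _)%:E : \bar R) => h.
apply: (@le_trans _ _ RHS).
  apply: le_trans h; rewrite le_eqVlt; apply/orP; left; apply/eqP.
  apply: ae_eq_integral => //.
  - by apply/measurable_EFinP; exact: E_measurable.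
  - apply/measurable_EFinP; apply: (measurableT_comp (measurable_powR q)).
    by apply: measurableT_comp => //; exact: measurable_wd.
  apply: (aeS _ (ae_wd wf)) => x dx _ /=; rewrite /E_.
  have dx0 : is_derive x 1 (Mx f) 0.
    by rewrite (_ : Mx f = cst 0); [exact: is_derive_cst|apply/funext => y; rewrite M0].
  suff -> : weak_derivative (Mx f) x = 0 by rewrite subr0.
  by rewrite -(@derive_val _ _ _ _ _ _ _ dx) (@derive_val _ _ _ _ _ _ _ dx0).
rewrite /RHS lee_fin.
have mj : \int[mu]_t `|weak_derivative (f_ j) t| <= m + 1.
  by apply: (le_trans (m_le j)); rewrite lerD2l.
set I := \int[mu]_t _ in mj *.
have I0 : 0 <= I by exact: Rintegral_ge0.
have h1 : (W11_dist (f_ j) f / (1 - beta)) `^ (q - 1) <= e / (C + 1).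
  apply: hd; first by rewrite divr_ge0//; lra.
  by rewrite ler_pdivrMr ?subr_gt0// mulrC.
set A := (_ / (1 - beta)) `^ (q - 1) in h1 *.
have -> : A * (2 / beta) * kernel_constant beta * I = A * (2 / beta * kc * I).
  by rewrite /kc !mulrA.
have bk0 : 0 <= 2 / beta * kc by rewrite mulr_ge0// divr_ge0// ltW.
apply: (@le_trans _ _ (e / (C + 1) * C)).
  apply: ler_pM; [exact: powR_ge0|exact: mulr_ge0|exact: h1|exact: ler_wpM2l].
rewrite mulrAC ler_pdivrMr; last by lra.
by apply: ler_wpM2l; [exact: ltW|lra].
Unshelve. all: by end_near. Qed.

(** [frac_max_stability] at the points where all the maximal functions are
    differentiable. *)
Let E_ae_cvg v (x0 : R) : representative f v -> v x0 != 0 ->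
  (forall x, `|v x| <= m) -> {ae mu, forall x, E_ j x @[j --> \oo] --> (0 : R)}.
Proof.
move=> rv vx0 vm; have [cv fv _] := rv.
have D := representative_data beta_gt0 beta_lt1 wf rv vm (lexx _).
have ae_all : {ae mu, forall x : R, forall j,
    is_derive x 1 (Mx (f_ j)) (weak_derivative (Mx (f_ j)) x)}.
  by apply: ae_foralln => j; exact: ae_wd.
apply: (aeS2 _ (ae_wd wf) ae_all) => x dx dxj.
have Mx0 : 0 < Mx f x by apply: (frac_max_gt0 D (x0 := x0)); rewrite normr_gt0.
apply/cvgrPdist_le => e e0; have [d d0 hd] := powR_small q_gt0 e0.
have [dlt dlt0 hdlt] := frac_max_stability beta_gt0 beta_lt1 D Mx0 dx d0.
have := dist0 dlt0; apply: filterS => j djd.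
rewrite sub0r normrN ger0_norm ?powR_ge0//; apply: hd => //; apply: ltW.
have [vj rvj vmj] := W11_representative (wf_ j); have [cvj fvj _] := rvj.
have Dj := representative_data beta_gt0 beta_lt1 (wf_ j) rvj vmj (lexx _).
apply: (hdlt _ _ _ _ _ _ Dj _ _ (dxj j)) => [a b ab|t].
  by apply: le_trans djd; apply: (W11_dist_frac_avg (v1 := vj) (v2 := v)).
apply: (le_trans (ler_dist_dist _ _)); apply: le_trans djd.
exact: W11_dist_sup.
Qed.

(** The sup and mass bounds [m + 1] and [N + 1] hold for [f] and eventually for [f_ j],
    which makes the constant in [slope_pow_le_truncated] independent of [j]. *)
Let nonzero_limit v (x0 : R) : representative f v -> v x0 != 0 ->
  (forall x, `|v x| <= m) ->
  forall e : R, 0 < e -> \forall j \near \oo, (\int[mu]_x (E_ j x)%:E <= e%:E)%E.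
Proof.
move=> rv vx0 vm; have b0 := beta_gt0; have b1 := beta_lt1.
apply: almost_dominated_cvg; first exact: E_measurable.
- by move=> j x; exact: powR_ge0.
- exact: E_ae_cvg rv vx0 vm.
move=> e e0; have kc0 : 0 <= kc by exact: kernel_constant_ge0.
have [_ fi'] := W11_integrable wf.
pose g t := `|weak_derivative f t|.
have ig : mu.-integrable setT (EFin \o g) by exact: integrable_norm fi'.
have g0 t : 0 <= g t by rewrite /g.
pose cbar := ((m + 1) / (1 - beta)) `^ (q - 1) * (4 / beta).
have cbar0 : 0 <= cbar by rewrite mulr_ge0 ?powR_ge0// divr_ge0// ltW.
pose q2 : R := 2 `^ q; have q20 : 0 <= q2 by exact: powR_ge0.
pose C := q2 * cbar * kc.
have C0 : 0 <= C by rewrite mulr_ge0// mulr_ge0.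
(* one part of the error budget for g - h, and two for its perturbed version *)
have C3 : 0 < 3 * (C + 1) by rewrite mulr_gt0//; lra.
have e10 : 0 < e / (3 * (C + 1)) by exact: divr_gt0.
have e1C : e / (3 * (C + 1)) * (3 * C) <= e.
  by rewrite mulrAC ler_pdivrMr//; apply: ler_wpM2l; [exact: ltW|lra].
have [n [h [n1 ih hn hout ghe]]] := bounded_truncation ig g0 e10.
set e1 := e / (3 * (C + 1)) in e10 e1C ghe.
pose A := truncation_constant beta q (m + 1) (N + 1) n.
have n0 : 0 <= n by lra.
have A0 : 0 <= A by exact: truncation_constant_ge0.
pose gj j t := `|weak_derivative (f_ j) t|.
have igj j : mu.-integrable setT (EFin \o gj j).
  by have [_ i] := W11_integrable (wf_ j); exact: integrable_norm i.
have idiff (k : R -> R) : mu.-integrable setT (EFin \o k) ->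
    mu.-integrable setT (EFin \o (fun t => `|k t - h t|)).
  move=> ik; have i : mu.-integrable setT (EFin \o (k \- h)) by exact: integrableB ik ih.
  exact: integrable_norm i.
have mdiff (k : R -> R) : mu.-integrable setT (EFin \o k) ->
    measurable_fun setT (fun t => `|k t - h t|).
  by move=> ik; apply/measurable_EFinP; exact: measurable_int (idiff _ ik).
have exvj : forall j, exists v, representative (f_ j) v /\
    forall x, `|v x| <= \int[mu]_t `|weak_derivative (f_ j) t|.
  by move=> j; have [vj rvj vmj] := W11_representative (wf_ j); exists vj.
have [vj hvj] := choice exvj.
have Dj j := representative_data beta_gt0 beta_lt1 (wf_ j) (hvj j).1 (hvj j).2 (lexx _).
have D := representative_data beta_gt0 beta_lt1 wf rv vm (lexx _).
have cfj j := fmd_cont (Dj j); have cf := fmd_cont D.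
have cMj j := locally_lipschitz_continuous (frac_max_locally_lipschitz beta_gt0 beta_lt1 (Dj j)).
have cM := locally_lipschitz_continuous (frac_max_locally_lipschitz beta_gt0 beta_lt1 D).
pose Tj j := edge_transform beta (fun t => `|vj j t|) (Mx (f_ j)) (fun t => `|gj j t - h t|).
pose T := edge_transform beta (fun t => `|v t|) (Mx f) (fun t => `|g t - h t|).
have Tj0 j x : (0 <= Tj j x)%E by exact: edge_transform_ge0.
have T0 x : (0 <= T x)%E by exact: edge_transform_ge0.
have mTj j := edge_transform_measurable beta (cfj j) (cMj j) (mdiff _ (igj j))
  (fun t => normr_ge0 _).
have mT := edge_transform_measurable beta cf cM (mdiff _ ig) (fun t => normr_ge0 _).
have mTT j := emeasurable_funD (mTj j) mT.
exists (fun x => q2 * (2 * (A / (1 + x ^+ 2)))).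
exists (fun j x => (q2 * cbar)%:E * (Tj j x + T x))%E.
split.
- pose k2 : R -> R := fun x => (1 + x ^+ 2)^-1.
  rewrite (_ : EFin \o _ = (fun x => (q2 * (2 * A))%:E * (EFin \o k2) x)%E).
    by apply: integrableZl => //; exact: inverse_square_integrable.
  by apply/funext => x /=; rewrite -EFinM; congr EFin; rewrite !mulrA.
- by move=> x; rewrite mulr_ge0// mulr_ge0// divr_ge0// addr_ge0// sqr_ge0.
- move=> j; split.
    exact: (measurable_funeM _ (mTT j)).
  by move=> x; apply: mule_ge0; [rewrite lee_fin; exact: mulr_ge0|exact: adde_ge0].
near=> j.
have dj1 : W11_dist (f_ j) f <= 1 by near: j; exact: dist0.
have dje : W11_dist (f_ j) f <= e1 by near: j; exact: dist0.
have mj1 x : `|vj j x| <= m + 1.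
  by apply: (le_trans ((hvj j).2 x)); apply: (le_trans (m_le j)); rewrite lerD2l.
have Nj1 : \int[mu]_t `|f_ j t| <= N + 1.
  by apply: (le_trans (N_le j)); rewrite lerD2l.
have D1j := representative_data beta_gt0 beta_lt1 (wf_ j) (hvj j).1 mj1 Nj1.
have vm1 x : `|v x| <= m + 1 by apply: (le_trans (vm x)); rewrite lerDl.
have N1 : N <= N + 1 by rewrite lerDl.
have D1 := representative_data beta_gt0 beta_lt1 wf rv vm1 N1.
split.
  apply: (aeS2 _ (ae_wd (wf_ j)) (ae_wd wf)) => x dxj dx.
  have hj := slope_pow_le_truncated beta_gt0 beta_lt1 qE D1j (igj j)
    (fun a b ab => representative_norm_le (hvj j).1 ab) n1 ih hn hout dxj.
  have h0 := slope_pow_le_truncated beta_gt0 beta_lt1 qE D1 ig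
    (fun a b ab => representative_norm_le rv ab) n1 ih hn hout dx.
  apply: (@le_trans _ _ (q2%:E * ((`|weak_derivative (Mx (f_ j)) x| `^ q)%:E +
      (`|weak_derivative (Mx f) x| `^ q)%:E))%E).
    by rewrite -EFinD -EFinM lee_fin; apply: powR_dist_le; exact: ltW.
  apply: (@le_trans _ _ (q2%:E * ((cbar%:E * Tj j x + (A / (1 + x ^+ 2))%:E) +
      (cbar%:E * T x + (A / (1 + x ^+ 2))%:E)))%E).
    by apply: lee_wpmul2l; [rewrite lee_fin|exact: (leeD hj h0)].
  have Ax : 0 <= A / (1 + x ^+ 2) by rewrite divr_ge0// addr_ge0// sqr_ge0.
  by rewrite (regroup q20 cbar0 Ax (Tj0 j x) (T0 x)).
have c20 : (0 <= (q2 * cbar)%:E)%E by rewrite lee_fin mulr_ge0.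
rewrite (ge0_integralZl mu measurableT (mTT j) (fun x _ => adde_ge0 (Tj0 j x) (T0 x)) c20).
rewrite (ge0_integralD mu measurableT (fun x _ => Tj0 j x) (mTj j) (fun x _ => T0 x) mT).
have ITj := edge_transform_le beta_gt0 beta_lt1 (cfj j) (cMj j) (mdiff _ (igj j)) (fun t => normr_ge0 _).
have IT := edge_transform_le beta_gt0 beta_lt1 cf cM (mdiff _ ig) (fun t => normr_ge0 _).
have fin (k : R -> R) : mu.-integrable setT (EFin \o k) ->
    (\int[mu]_t (k t)%:E)%E = (\int[mu]_t k t)%:E.
  by move=> ik; rewrite /Rintegral fineK//; exact: integrable_fin_num.
rewrite fin in ITj; last exact: idiff.
rewrite fin in IT; last exact: idiff.
have gjh : \int[mu]_t `|gj j t - h t| <= 2 * e1.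
  have iB : mu.-integrable setT (EFin \o (gj j \- g)) by exact: integrableB (igj j) ig.
  have inB : mu.-integrable setT (EFin \o (fun t => `|gj j t - g t|)) by exact: integrable_norm iB.
  apply: (@le_trans _ _ (\int[mu]_t (`|gj j t - g t| + `|g t - h t|))).
    apply: le_Rintegral => //; [exact: idiff|exact: integrableD inB (idiff _ ig)|].
    move=> t _; rewrite (_ : gj j t - h t = (gj j t - g t) + (g t - h t)); last by ring.
    exact: ler_normD.
  rewrite RintegralD//; last exact: idiff.
  have : \int[mu]_t `|gj j t - g t| <= e1; last by lra.
  apply: le_trans dje; apply: le_trans (W11_dist_derivative (wf_ j) wf).
  have [_ jj] := W11_integrable (wf_ j).
  have iD : mu.-integrable setT (EFin \o (weak_derivative (f_ j) \- weak_derivative f)).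
    exact: integrableB jj fi'.
  apply: le_Rintegral => //; first exact: integrable_norm iD.
  by move=> t _; exact: ler_dist_dist.
apply: (@le_trans _ _ ((q2 * cbar)%:E * ((kc * (2 * e1))%:E + (kc * e1)%:E))%E).
  apply: lee_wpmul2l; first by rewrite lee_fin mulr_ge0.
  by apply: leeD; [apply: (le_trans ITj)|apply: (le_trans IT)];
    rewrite -EFinM lee_fin; exact: ler_wpM2l.
have alg (a b k t : R) : a * b * (k * (2 * t) + k * t) = t * (3 * (a * b * k)) by ring.
by rewrite -EFinD -EFinM lee_fin alg; exact: e1C.
Unshelve. all: by end_near. Qed.

Lemma frac_maximal_derivative_cvg (e : R) : 0 < e -> \forall j \near \oo,
  (\int[mu]_x (`|weak_derivative (Mx (f_ j)) x - weak_derivative (Mx f) x| `^ q)%:E <= e%:E)%E.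
Proof.
have [v rv vm] := W11_representative wf.
have [[x0 vx0]|v0] := pselect (exists x, v x != 0); first exact: nonzero_limit rv vx0 vm e.
apply: zero_limit rv _ e => x; apply/eqP; apply: contrapT => /negP vx.
by apply: v0; exists x.
Qed.

End continuity.

(** * Continuity of the derivative map *)

Theorem theorem1p1 (R : realType) (beta q : R)
    (beta_gt0 : 0 < beta) (beta_lt1 : beta < 1) (qE : q = 1 / (1 - beta)) :
  (* the map f |-> (M_beta f)' is well defined from W^{1,1} to L^q *)
  (forall f : R -> R, W11 f ->
     [/\ forall x : R, frac_maximal beta f x \is a fin_num,
         weakly_differentiable (frac_maximal_fun beta f) &
         weak_derivative (frac_maximal_fun beta f)
           \in Lfun lebesgue_measure q%:E]) /\
  (* and it is continuous *)
  (forall (f : R -> R) (f_ : nat -> R -> R),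
     W11 f -> (forall j : nat, W11 (f_ j)) ->
     W11_norm (f_ j \- f) @[j --> \oo] --> 0%E ->
     ('N[lebesgue_measure]_(q%:E)[EFin \o
        (weak_derivative (frac_maximal_fun beta (f_ j)) \-
         weak_derivative (frac_maximal_fun beta f))%R])%E @[j --> \oo] --> 0%E).
Proof.
split.
  move=> f wf; have [fin dM _ _] := frac_maximal_weak_derivative beta_gt0 beta_lt1 wf.
  by split => //; exact: frac_maximal_Lfun.
move=> f f_ wf wf_ cvg0.
have q1 : 1 < q by exact: q_gt1 beta_gt0 beta_lt1 qE.
have q0 : 0 < q by lra.
have dist0 (e : R) : 0 < e -> \forall j \near \oo, W11_dist (f_ j) f <= e.
  move=> e0; have := cvge_near_le cvg0 e0; apply: filterS => j.
  by rewrite W11_norm_dist.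
apply: near_le_cvge0 => [j|e e0]; first exact: Lnorm_ge0.
have eq0 : 0 < e `^ q by exact: powR_gt0.
have := frac_maximal_derivative_cvg beta_gt0 beta_lt1 qE wf wf_ dist0 eq0.
(* by definition the norm is the q-th root of the integral of the q-th power *)
apply: filterS => j hj; rewrite unlock.
apply: (@le_trans _ _ (((e `^ q)%:E) `^ q^-1)%E); last first.
  by rewrite poweR_EFin -powRrM mulfV ?powRr1 ?(ltW e0)// gt_eqF.
apply: gt0_ler_poweR.
- by rewrite invr_ge0 ltW.
- rewrite in_itv/= leey andbT; by apply: integral_ge0 => x _; rewrite lee_fin powR_ge0.
- by rewrite in_itv/= leey andbT lee_fin ltW.
apply: le_trans hj; rewrite le_eqVlt; apply/orP; left; apply/eqP.
by apply: eq_integral => x _; rewrite /= -poweR_EFin.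
Qed.
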